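(* Let $d\ge1$, $T>0$, and let $H:\mathbb R^{2d}\to\mathbb R^d$ be locally Lipschitz with $|H(z)|\le C(1+|z|)$ for all $z\in\mathbb R^{2d}$. Let $L:\mathbb R^{2d}\times\mathcal P_1(\mathbb R^{2d})\to[0,+\infty)$ be continuous in $(x,v)\in\mathbb R^{2d}$ and such that whenever $(\mu_j)_j\subset\mathcal P_1(\mathbb R^{2d})$ converges narrowly to $\mu\in\mathcal P_1(\mathbb R^{2d})$, then $L(x,v,\mu_j)\to L(x,v,\mu)$ uniformly with respect to $(x,v)$ on compact subsets of $\mathbb R^{2d}$. Let $\psi:\mathbb R^d\to[0,+\infty)$ be convex and let $C_\psi\ge0$, $1\le q<+\infty$ be such that $\operatorname{Lip}(\psi,B(0,R))\le C_\psi R^{q-1}$ for all $R>0$. Let $\ell\in L^q(0,T)$. For every $N\in\mathbb N$ let $\mu_N^0=\frac1N\sum_{i=1}^N\delta_{((x_N^0)_i,(v_N^0)_i)}$ with all points $((x_N^0)_i,(v_N^0)_i)\in B(0,R_0)\subset\mathbb R^{2d}$, $R_0>0$ independent of $N$, and suppose $\lim_{N\to\infty}\mathcal W_1(\mu_N^0,\mu^0)=0$ for some compactly supported $\mu^0\in\mathcal P_1(\mathbb R^{2d})$. Let $(f_N)_{N\in\mathbb N}$ be a sequence in $\mathcal F_\ell$ (see context, with $n=2d$) and let $\mu_N(t)=\frac1N\sum_{i=1}^N\delta_{(x_i(t),v_i(t))}$, where $(x_i,v_i)_{i=1}^N$ is the Carathéodory solution on $[0,T]$ of $$\dot x_i=v_i,\qquad\dot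 v_i=(H\star\mu_N)(x_i,v_i)+f_N(t,x_i,v_i),\qquad i=1,\dots,N,$$ with initial datum $(x(0),v(0))=(x_N^0,v_N^0)$. Fix $1<p<\infty$, and let $(f_{N_k})_k$ and $(\mu_{N_k})_k$ be subsequences such that $f_{N_k}$ converges in the local weak sense (see context) to some $f\in\mathcal F_\ell$ and $\mathcal W_1(\mu_{N_k}(t),\mu(t))\to0$ uniformly in $t\in[0,T]$, where $\mu:[0,T]\to\mathcal P_1(\mathbb R^{2d})$ is a weak equi-compactly supported solution (see context) of $$\frac{\partial\mu}{\partial t}+v\cdot\nabla_x\mu+\nabla_v\cdot[(H\star\mu+f)\mu]=0$$ with forcing term $f$ and $\mu(0)=\mu^0$. Then $$\liminf_{k\to\infty}\int_0^T\int_{\mathbb R^{2d}}\big(L(x,v,\mu_{N_k}(t))+\psi(f_{N_k}(t,x,v))\big)\,d\mu_{N_k}(t)(x,v)\,dt\ \ge\ \int_0^T\int_{\mathbb R^{2d}}\big(L(x,v,\mu(t))+\psi(f(t,x,v))\big)\,d\mu(t)(x,v)\,dt.$$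
   Context: $\mathcal P_1(\mathbb R^n)$ is the set of Borel probability measures on $\mathbb R^n$ with finite first moment and $\mathcal W_1$ the 1-Wasserstein distance. $(H\star\mu)(z)=\int H(z-\zeta)\,d\mu(\zeta)$. $\operatorname{Lip}(g,A)$ is the Lipschitz constant of $g$ on $A$. A Carathéodory function is measurable in $t$ and continuous in the space variable; a Carathéodory solution of an ODE is an absolutely continuous function satisfying the equation a.e. Admissible controls: for $\ell\in L^q(0,T)$, $\mathcal F_\ell$ is the class of Carathéodory functions $f:[0,T]\times\mathbb R^n\to\mathbb R^d$ such that for a.e. $t\in[0,T]$: $f(t,\cdot)\in W^{1,\infty}_{loc}(\mathbb R^n,\mathbb R^d)$ and $|f(t,0)|+\operatorname{Lip}(f(t,\cdot),\mathbb R^n)\le\ell(t)$. Local weak convergence: for $\ell\in L^q(0,T)$ and fixed $1<p<\infty$, a sequence $(f_k)$ in $\mathcal F_\ell$ converges to $f\in\mathcal F_\ell$ in the local weak sense if $\lim_{k\to\infty}\int_0^T\langle\varphi(t),f_k(t,\cdot)-f(t,\cdot)\rangle\,dt=0$ for all $\varphi\in L^{q'}([0,T],H^{-1,p'}(\mathbb R^n,\mathbb R^d))$ for which there is a relatively compact set $\Omega\subset\mathbb R^n$ with $\operatorname{supp}\varphi(t)\Subset\Omega$ for all $t\in[0,T]$. Here $q',p'$ are conjugate exponents, $H^{-1,p'}$ is the dual of $W^{1,p}$, and $\langle\cdot,\cdot\rangle$ is the duality (after multiplying $f_k-f$ by a smooth compactly supported cutoff equal to $1$ near $\overline\Omega$,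 which does not affect the value). Weak solution: given $f\in\mathcal F_\ell$, a $\mathcal W_1$-continuous map $\mu:[0,T]\to\mathcal P_1(\mathbb R^{2d})$ is a weak equi-compactly supported solution of the equation with forcing term $f$ if there is $R>0$ with $\operatorname{supp}\mu(t)\subset B(0,R)$ for every $t\in[0,T]$ and, with $w_{H,\mu,f}(t,x,v):=(v,\;H\star\mu(t)(x,v)+f(t,x,v))$, $$\frac{d}{dt}\int_{\mathbb R^{2d}}\zeta\,d\mu(t)=\int_{\mathbb R^{2d}}\nabla\zeta(x,v)\cdot w_{H,\mu,f}(t,x,v)\,d\mu(t)(x,v)$$ in the sense of distributions on $(0,T)$ for every $\zeta\in C_c^\infty(\mathbb R^d\times\mathbb R^d)$. *)

(* Defs.v *)
From HB Require Import structures.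
From mathcomp Require Import all_boot all_order all_algebra.
From mathcomp Require Import all_classical all_reals all_analysis.

Set Implicit Arguments.
Unset Strict Implicit.
Unset Printing Implicit Defensive.

Import Order.TTheory GRing.Theory Num.Theory.
Import numFieldNormedType.Exports.

Local Open Scope classical_set_scope.
Local Open Scope ring_scope.

(* The library norm [`|A|] of a matrix is the sup norm; it induces the topology
   used below, but all quantitative bounds refer to the Euclidean norm. *)
Definition enorm {R : realType} {m n : nat} (A : 'M[R]_(m, n)) : R :=
  Num.sqrt (\sum_i \sum_j A i j ^+ 2).

Definition eball {R : realType} {n : nat} (c : 'rV[R]_n) (r : R) :
    set 'rV[R]_n :=
  [set z | enorm (z - c) < r].

(* The Lipschitz constant of [g] on [A], with values in the extended reals.
   The pairs with [x = y] contribute [0 / 0 = 0]. *)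
Definition Lip {R : realType} {n : nat} {V : zmodType} (nrm : V -> R)
    (g : 'rV[R]_n -> V) (A : set 'rV[R]_n) : \bar R :=
  ereal_sup [set e | exists x y,
    [/\ A x, A y & e = (nrm (g x - g y) / enorm (x - y))%:E]].

Definition locally_Lip {R : realType} {n m : nat}
    (g : 'rV[R]_n -> 'rV[R]_m) : Prop :=
  forall z, exists2 r, 0 < r & (Lip enorm g (eball z r) < +oo)%E.

Section borel_matrix.
Variables (R : realType) (m n : nat).

Definition mx_borel : set (set 'M[R]_(m, n)) := <<s @open 'M[R]_(m, n) >>.

Let mx_borel0 : mx_borel set0.
Proof. exact: sigma_algebra0. Qed.

Let mx_borelC A : mx_borel A -> mx_borel (~` A).
Proof. exact: sigma_algebraC. Qed.

Let mx_borel_bigcup (F : (set 'M[R]_(m, n))^nat) :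
  (forall i, mx_borel (F i)) -> mx_borel (\bigcup_i (F i)).
Proof. exact: sigma_algebra_bigcup. Qed.

HB.instance Definition _ :=
  @isMeasurable.Build default_measure_display 'M[R]_(m, n) mx_borel
    mx_borel0 mx_borelC mx_borel_bigcup.

End borel_matrix.

Section lebesgue_Rn.
Context {R : realType}.

Let box n (c : {ffun 'I_n -> rat * rat}) : set 'rV[R]_n :=
  [set z | forall i, ratr (c i).1 < z ord0 i < ratr (c i).2].

Let open_box n (U : set 'rV[R]_n) : open U ->
  U = \bigcup_(c in [set c | box c `<=` U]) box c.
Proof.
rewrite openE => oU; apply/seteqP; split => [z Uz|z [c cU]]; last exact: cU.
have /nbhs_ballP[e /= e0 eU] := oU _ Uz.
have ex i : exists ab : rat * rat,
    [/\ z ord0 i - e < ratr ab.1, ratr ab.1 < z ord0 i,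
        z ord0 i < ratr ab.2 & ratr ab.2 < z ord0 i + e].
  have h1 : z ord0 i - e < z ord0 i by rewrite ltrBlDr ltrDl.
  have h2 : z ord0 i < z ord0 i + e by rewrite ltrDl.
  have [a] := rat_in_itvoo h1; have [b] := rat_in_itvoo h2.
  by rewrite !in_itv/= => /andP[? ?] /andP[? ?]; exists (a, b).
have /choice[c cP] := ex.
have cE i : [ffun j => c j] i = c i by rewrite ffunE.
exists [ffun j => c j] => /=; last first.
  by move=> i; rewrite cE; have [_ -> -> _] := cP i.
move=> y /= yc; apply: eU; split => // i j; rewrite ord1 /ball /=.
have := yc j; rewrite cE => /andP[y1 y2]; have [z1 z2 z3 z4] := cP j.
rewrite ltr_distlC.
by rewrite (lt_trans z1 y1) (lt_trans y2 z4).
Qed.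

Lemma measurable_rV d (T : measurableType d) n (f : T -> 'rV[R]_n) :
  (forall i, measurable_fun setT (fun t => f t ord0 i)) ->
  measurable_fun setT f.
Proof.
move=> mf; apply: (measurability (@open 'rV[R]_n)) => // _ [U oU <-].
rewrite setTI (open_box oU) preimage_bigcup bigcup_mkcond.
apply: countable_bigcupT_measurable => [|c]; first exact: countableP.
case: ifP => // _.
rewrite (_ : _ @^-1` _ = \bigcap_(i in [set: 'I_n])
   ((fun t => f t ord0 i) @^-1` `]ratr (c i).1, ratr (c i).2[%classic)).
  apply: fin_bigcap_measurable => // i _.
  by rewrite -[X in measurable X]setTI; apply: mf.
apply/seteqP; split => [t /= tc i _|t /= tc i].
  by rewrite /= in_itv/=; exact: tc.
by have := tc i Logic.I; rewrite /= in_itv.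
Qed.

Lemma measurable_coord n (i : 'I_n) :
  measurable_fun setT (fun z : 'rV[R]_n => z ord0 i).
Proof.
apply: (measurability _ (measurable_realfun.RGenOInfty.measurableE R)) => _ [_ [x ->] <-].
apply: sub_sigma_algebra; rewrite setTI.
apply: open_comp; last exact: interval_open.
by move=> z _; exact: coord_continuous.
Qed.

Let rcons0 n (xz : measurableTypeR R * 'rV[R]_n) : 'rV[R]_n.+1 :=
  row_mx (xz.1)%:M xz.2.

Let measurable_rcons0 n : measurable_fun setT (@rcons0 n).
Proof.
apply: measurable_rV => i.
have [j ->|j ->] := split_ordP (i : 'I_(1 + n)).
  rewrite (_ : (fun _ => _) = fst); first exact: measurable_fst.
  apply/funext => xz; apply: etrans (@row_mxEl _ 1 1 n _ _ _ _) _.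
  by rewrite [j]ord1 mxE /= mulr1n.
rewrite (_ : (fun _ => _) = (fun z : 'rV[R]_n => z ord0 j) \o snd).
  by apply: measurableT_comp; [exact: measurable_coord|exact: measurable_snd].
by apply/funext => xz; exact: (@row_mxEr _ 1 1 n).
Qed.

Section lebesgue_step.
Variables (n : nat) (m : {sigma_finite_measure set 'rV[R]_n -> \bar R}).

Definition lebesgue_step : set 'rV[R]_n.+1 -> \bar R :=
  pushforward (@lebesgue_measure R \x m)%E (@rcons0 n).

Let lebesgue_step0 : lebesgue_step set0 = 0%E.
Proof. by rewrite /lebesgue_step /pushforward preimage_set0 measure0. Qed.

Let lebesgue_step_ge0 A : (0 <= lebesgue_step A)%E.
Proof. by rewrite /lebesgue_step /pushforward measure_ge0. Qed.

Let lebesgue_step_sigma_additive : semi_sigma_additive lebesgue_step.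
Proof.
move=> F mF tF mUF; rewrite /lebesgue_step /pushforward preimage_bigcup.
have mpre A : measurable A -> measurable (@rcons0 n @^-1` A).
  by move=> mA; rewrite -[X in measurable X]setTI; exact: measurable_rcons0.
apply: measure_semi_sigma_additive.
- by move=> k; exact: mpre.
- apply/trivIsetP => /= i j _ _ ij; rewrite -preimage_setI.
  by move/trivIsetP : tF => /(_ _ _ _ _ ij) ->//; rewrite preimage_set0.
- by rewrite -preimage_bigcup; exact: mpre.
Qed.

HB.instance Definition _ := isMeasure.Build _ _ _ lebesgue_step
  lebesgue_step0 lebesgue_step_ge0 lebesgue_step_sigma_additive.

Let lebesgue_step_sigma_finite : sigma_finite setT lebesgue_step.
Proof.
have /sigma_finiteP[F [FT ndF Foo]] := sigma_finiteT (@lebesgue_measure R).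
have /sigma_finiteP[G [GT ndG Goo]] := sigma_finiteT m.
pose hd (z : 'rV[R]_(1 + n)) : measurableTypeR R := z ord0 ord0.
pose tl (z : 'rV[R]_(1 + n)) : 'rV[R]_n := rsubmx z.
have mhd : measurable_fun setT hd by exact: measurable_coord.
have mtl : measurable_fun setT tl.
  apply: measurable_rV => i.
  rewrite (_ : (fun _ => _) = (fun z : 'rV[R]_(1 + n) => z ord0 (rshift 1 i))).
    exact: measurable_coord.
  by apply/funext => z; rewrite mxE.
have hdK xz : hd (@rcons0 n xz) = xz.1.
  rewrite /hd; have <- : lshift n ord0 = ord0 :> 'I_(1 + n) by exact/val_inj.
  by rewrite (@row_mxEl _ 1 1 n) mxE eqxx.
have tlK xz : tl (@rcons0 n xz) = xz.2 by rewrite /tl row_mxKr.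
exists (fun k => (hd @^-1` F k) `&` (tl @^-1` G k)).
  apply/seteqP; split => // z _.
  have [k1 _ Fk1] : (\bigcup_i F i) (hd z) by rewrite -FT.
  have [k2 _ Gk2] : (\bigcup_i G i) (tl z) by rewrite -GT.
  exists (maxn k1 k2) => //; split.
    by have /subsetPset := ndF _ _ (leq_maxl k1 k2); apply.
  by have /subsetPset := ndG _ _ (leq_maxr k1 k2); apply.
move=> k; have [mF Fk] := Foo k; have [mG Gk] := Goo k; split.
  apply: measurableI; rewrite -[X in measurable X]setTI; first exact: mhd.
  exact: mtl.
rewrite /lebesgue_step /pushforward (_ : _ @^-1` _ = F k `*` G k); last first.
  by apply/seteqP; split => xz /=; rewrite hdK tlK.
by rewrite product_measure1E// lte_mul_pinfty// ge0_fin_numE.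
Qed.

HB.instance Definition _ :=
  Measure_isSigmaFinite.Build _ _ _ lebesgue_step lebesgue_step_sigma_finite.

End lebesgue_step.

Fixpoint lebesgue_Rn (n : nat) :
    {sigma_finite_measure set 'rV[R]_n -> \bar R} :=
  if n is n'.+1 then lebesgue_step (lebesgue_Rn n') else dirac (0 : 'rV[R]_0).

Lemma lebesgue_Rn_box n (A : 'I_n -> set (measurableTypeR R)) :
  (forall i, measurable (A i)) ->
  lebesgue_Rn n [set z | forall i, A i (z ord0 i)] =
    (\prod_(i < n) lebesgue_measure (A i))%E.
Proof.
elim: n A => [|n IH] A mA.
  rewrite big_ord0 -[RHS](diracT R (0 : 'rV[R]_0)).
  by congr (dirac _ _); apply/seteqP; split => // z _ [].
pose B : set 'rV[R]_n := [set z | forall i, A (lift ord0 i) (z ord0 i)].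
have mB : measurable B.
  rewrite (_ : B = \bigcap_(i in [set: 'I_n])
      ((fun z : 'rV[R]_n => z ord0 i) @^-1` A (lift ord0 i))).
    apply: fin_bigcap_measurable => // i _.
    by rewrite -[X in measurable X]setTI; apply: measurable_coord => //; exact: mA.
  apply/seteqP; split => [z zB i _|z zB i]; first exact: zB.
  exact: (zB i Logic.I).
transitivity ((@lebesgue_measure R \x lebesgue_Rn n)%E (A ord0 `*` B)).
  have e0 (xz : R * 'rV[R]_n) : rcons0 xz ord0 ord0 = xz.1.
    transitivity (row_mx (xz.1)%:M xz.2 ord0 (lshift n ord0)).
      by congr (row_mx _ _ _ _); exact/val_inj.
    by rewrite row_mxEl mxE eqxx.
  have eS (xz : R * 'rV[R]_n) i :
      rcons0 xz ord0 (lift ord0 i) = xz.2 ord0 i.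
    transitivity (row_mx (xz.1)%:M xz.2 ord0 (rshift 1 i)).
      by congr (row_mx _ _ _ _); exact/val_inj.
    by rewrite row_mxEr.
  congr (product_measure1 _ _ _).
  apply/seteqP; split => [xz /= Axz|xz /= [A0 AS] i].
    by split => [|i]; [rewrite -e0|rewrite -eS].
  by case: (unliftP ord0 i) => [j ->|->]; rewrite ?e0 ?eS.
rewrite product_measure1E; [|exact: mA|exact: mB].
rewrite [RHS]big_ord_recl; congr (_ * _)%E.
by apply: (IH (fun i => A (lift ord0 i))) => i; exact: mA.
Qed.

End lebesgue_Rn.

(* The time variable carries the sigma-algebra of Lebesgue measurable sets, and
   time integrals are taken with respect to the completed Lebesgue measure. *)
Notation time R :=
  (caratheodory_type ((@wlength R idfun)^*)%mu) (only parsing).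
Notation dt := completed_lebesgue_measure (only parsing).

Section measures_on_Rn.
Context {R : realType} {n : nat}.
Implicit Types mu nu : probability 'rV[R]_n R.

Definition P1 mu : Prop := (\int[mu]_z (enorm z)%:E < +oo)%E.

Definition msupp mu : set 'rV[R]_n :=
  [set z | forall U, open U -> U z -> (0 < mu U)%E].

Definition coupling mu nu
    (pi : probability ('rV[R]_n * 'rV[R]_n)%type R) : Prop :=
  forall A, measurable A -> pi (A `*` setT) = mu A /\ pi (setT `*` A) = nu A.

Definition W1 mu nu : \bar R :=
  ereal_inf [set (\int[pi]_z (enorm (z.1 - z.2))%:E)%E | pi in coupling mu nu].

Definition narrow_cvg (mus : nat -> probability 'rV[R]_n R) mu : Prop :=
  forall g : 'rV[R]_n -> R, continuous g -> (exists M, forall z, `|g z| <= M) ->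
    (\int[mus k]_z g z)%R @[k --> \oo] --> (\int[mu]_z g z)%R.

Definition convolution {m : nat} (H : 'rV[R]_n -> 'rV[R]_m) mu
    (z : 'rV[R]_n) : 'rV[R]_m :=
  \row_j (\int[mu]_y (H (z - y) ord0 j))%R.

End measures_on_Rn.

Section empirical.
Context d (T : measurableType d) (R : realType) (N : nat) (z : 'I_N.+1 -> T).
Local Open Scope ereal_scope.

Definition empirical_meas : set T -> \bar R :=
  mscale ((N.+1%:R : R)^-1)%:nng%R (msum (fun i => dirac (z (inord i))) N.+1).

HB.instance Definition _ := Measure.on empirical_meas.

Let empirical_measT : empirical_meas setT = 1.
Proof.
rewrite /empirical_meas /mscale /= /msum.
rewrite (eq_bigr (fun=> 1%:E)) => [|i _]; last exact: diracT.
by rewrite sumEFin sumr_const card_ord -EFinM mulVf.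
Qed.

HB.instance Definition _ :=
  Measure_isProbability.Build _ _ _ empirical_meas empirical_measT.

End empirical.

(* [1/N sum_i delta_(z i)]; the value for [N = 0] is irrelevant. *)
Definition empirical {R : realType} {n : nat} (N : nat) :
    ('I_N -> 'rV[R]_n) -> probability 'rV[R]_n R :=
  match N with
  | 0 => fun=> dirac (0 : 'rV[R]_n)
  | N'.+1 => fun z => empirical_meas R z
  end.

Section test_functions.
Context {R : realType} {n : nat}.

Definition basis_vec (i : 'I_n) : 'rV[R]_n := delta_mx ord0 i.

Definition partial (i : 'I_n) (g : 'rV[R]_n -> R) : 'rV[R]_n -> R :=
  fun x => 'D_(basis_vec i) g x.

Definition iter_partial (s : seq 'I_n) (g : 'rV[R]_n -> R) :
    'rV[R]_n -> R :=
  foldr partial g s.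

Definition smooth (g : 'rV[R]_n -> R) : Prop :=
  forall s : seq 'I_n, continuous (iter_partial s g) /\
    forall i x, derivable (iter_partial s g) x (basis_vec i).

Definition test_function (g : 'rV[R]_n -> R) : Prop :=
  smooth g /\ compact (closure [set x | g x != 0]).

End test_functions.

Definition time_test_function {R : realType} (T : R) (eta : R -> R) : Prop :=
  [/\ forall k t, derivable (derive1n k eta) t 1,
      compact (closure [set t | eta t != 0]) &
      closure [set t | eta t != 0] `<=` `]0, T[].

Section sobolev.
Context {R : realType} {n m : nat}.
Implicit Types (u : 'rV[R]_n -> 'rV[R]_m) (G : 'rV[R]_n -> 'M[R]_(n, m)).
Local Notation leb := (@lebesgue_Rn R n).

Definition loc_integrable {a b : nat} (g : 'rV[R]_n -> 'M[R]_(a, b)) : Prop :=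
  measurable_fun setT g /\
  forall K, compact K -> (\int[leb]_(x in K) (enorm (g x))%:E < +oo)%E.

(* [G x i j] is the weak partial derivative of [u_j] in direction [i]. *)
Definition is_weak_grad u G : Prop :=
  [/\ loc_integrable u, loc_integrable G &
    forall zeta i j, test_function zeta ->
      (\int[leb]_x (u x ord0 j * partial i zeta x) =
        - (\int[leb]_x (G x i j * zeta x)))%R].

Definition weak_grad u : 'rV[R]_n -> 'M[R]_(n, m) :=
  get [set G | is_weak_grad u G].

Definition W1infloc u : Prop :=
  exists2 G, is_weak_grad u G &
    forall K, compact K -> exists M : R,
      {ae leb, forall x, K x -> enorm (u x) <= M /\ enorm (G x) <= M}.

Definition in_Lp (p : R) {a b : nat} (g : 'rV[R]_n -> 'M[R]_(a, b)) : Prop :=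
  measurable_fun setT g /\ (\int[leb]_x (enorm (g x) `^ p)%:E < +oo)%E.

Definition W1p (p : R) u : Prop :=
  in_Lp p u /\ exists2 G, is_weak_grad u G & in_Lp p G.

Definition W1p_norm (p : R) u : \bar R :=
  ((\int[leb]_x (enorm (u x) `^ p + enorm (weak_grad u x) `^ p)%:E)
    `^ p^-1)%E.

(* Elements of the dual of W^{1,p}(R^n, R^m), as functionals on representatives:
   only their values on [W1p p] matter, and the bound makes them invariant under
   a.e. equality. *)
Definition is_dual (p : R) (phi : ('rV[R]_n -> 'rV[R]_m) -> R) : Prop :=
  (forall a u v, W1p p u -> W1p p v ->
    phi (fun x => a *: u x + v x) = a * phi u + phi v) /\
  exists C : R, forall u, W1p p u -> (`|phi u|%:E <= C%:E * W1p_norm p u)%E.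

Definition dual_norm (p : R) (phi : ('rV[R]_n -> 'rV[R]_m) -> R) : \bar R :=
  ereal_sup [set `|phi u|%:E | u in [set u | W1p p u /\ (W1p_norm p u <= 1)%E]].

(* Complement of the largest open set on which [phi] vanishes as a
   distribution. *)
Definition dual_supp (phi : ('rV[R]_n -> 'rV[R]_m) -> R) : set 'rV[R]_n :=
  ~` \bigcup_(U in [set U | open U /\
      forall u, (forall j, test_function (fun x => u x ord0 j)) ->
        closure [set x | u x != 0] `<=` U -> phi u = 0]) U.

End sobolev.

Section bochner.
Context {R : realType} {n m : nat}.
Local Notation functional := (('rV[R]_n -> 'rV[R]_m) -> R).

Definition simple_map (p : R) (s : R -> functional) : Prop :=
  exists k (A : 'I_k -> set (time R)) (Phi : 'I_k -> functional),
    (forall i, measurable (A i) /\ is_dual p (Phi i)) /\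
    forall t u, s t u = \sum_i \1_(A i) t * Phi i u.

Definition strongly_measurable (p T : R) (phi : R -> functional) : Prop :=
  exists2 s : nat -> R -> functional, (forall k, simple_map p (s k)) &
    {ae dt, forall t : R, t \in `[0, T] ->
      dual_norm p (fun u => s k t u - phi t u) @[k --> \oo] --> 0%E}.

(* L^r([0, T], H^{-1,p'}), where H^{-1,p'} is the dual of W^{1,p}. *)
Definition bochner_Lp (p : R) (r : \bar R) (T : R) (phi : R -> functional) :
    Prop :=
  [/\ forall t, t \in `[0, T] -> is_dual p (phi t),
      strongly_measurable p T phi &
      ('N[dt]_r[(fun t : time R => dual_norm p (phi t)) \_ `[0%R, T]] < +oo)%E].

End bochner.

Section controls.
Context {R : realType} {n m : nat}.
Implicit Types f : R -> 'rV[R]_n -> 'rV[R]_m.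

Definition in_Lq (q T : R) (ell : R -> R) : Prop :=
  measurable_fun (`[0, T] : set (time R)) ell /\
  (\int[dt]_(t in (`[0%R, T] : set (time R))) (`|ell t| `^ q)%:E < +oo)%E.

Definition caratheodory_fun (T : R) f : Prop :=
  (forall z, measurable_fun (`[0, T] : set (time R)) (f ^~ z)) /\
  forall t, t \in `[0, T] -> continuous (f t).

(* The class F_ell. *)
Definition admissible (T : R) (ell : R -> R) f : Prop :=
  caratheodory_fun T f /\
  {ae dt, forall t : R, t \in `[0, T] ->
    W1infloc (f t) /\
    ((enorm (f t 0))%:E + Lip enorm (f t) setT <= (ell t)%:E)%E}.

Definition cutoff (Omega : set 'rV[R]_n) (chi : 'rV[R]_n -> R) : Prop :=
  test_function chi /\
  exists V, [/\ open V, closure Omega `<=` V & forall x, V x -> chi x = 1].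

(* The duality [<phi t, fs k t - f t>] is evaluated after localization by a
   cutoff [chi], on which its value does not depend. *)
Definition local_weak_cvg (p q T : R) (fs : nat -> R -> 'rV[R]_n -> 'rV[R]_m)
    f : Prop :=
  forall (phi : R -> ('rV[R]_n -> 'rV[R]_m) -> R) (Omega : set 'rV[R]_n) chi,
    bochner_Lp p (hoelder_conjugate q%:E) T phi ->
    compact (closure Omega) ->
    (forall t, t \in `[0, T] ->
      compact (dual_supp (phi t)) /\ dual_supp (phi t) `<=` interior Omega) ->
    cutoff Omega chi ->
    (\int[dt]_(t in (`[0, T] : set (time R)))
      phi t (fun x => chi x *: (fs k t x - f t x)))%R @[k --> \oo] --> 0.

End controls.

Section dynamics.
Context {R : realType} {d : nat}.
Local Notation phase := 'rV[R]_(d + d).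
Implicit Types (H : phase -> 'rV[R]_d) (f : R -> phase -> 'rV[R]_d).

Definition abs_continuous {n : nat} (T : R) (g : R -> 'rV[R]_n) : Prop :=
  forall e : R, 0 < e -> exists2 delta : R, 0 < delta &
    forall k (a b : 'I_k -> R),
      (forall i, [/\ 0 <= a i, a i <= b i & b i <= T]) ->
      (forall i j, i != j -> `]a i, b i[ `&` `]a j, b j[ = set0) ->
      \sum_i (b i - a i) < delta ->
      \sum_i enorm (g (b i) - g (a i)) < e.

Definition particles {N : nat} (x v : 'I_N -> R -> 'rV[R]_d) (t : R) :
    probability phase R :=
  empirical (fun i => row_mx (x i t) (v i t)).

Definition particle_solution {N : nat} (T : R) H f
    (x0 v0 : 'I_N -> 'rV[R]_d) (x v : 'I_N -> R -> 'rV[R]_d) : Prop :=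
  forall i, [/\ abs_continuous T (x i), abs_continuous T (v i),
    x i 0 = x0 i, v i 0 = v0 i &
    {ae dt, forall t : R, t \in `[0, T] ->
      let z := row_mx (x i t) (v i t) in
      is_derive t 1 (x i) (v i t) /\
      is_derive t 1 (v i) (convolution H (particles x v t) z + f t z)}].

Definition velocity H (mu : R -> probability phase R) f (t : R) (z : phase) :
    phase :=
  row_mx (rsubmx z) (convolution H (mu t) z + f t z).

Definition weak_solution (T : R) H f (mu : R -> probability phase R) : Prop :=
  [/\ forall t, t \in `[0, T] -> P1 (mu t),
      forall t, t \in `[0, T] -> forall e : R, 0 < e ->
        exists2 delta : R, 0 < delta &
          forall s, s \in `[0, T] -> `|s - t| < delta ->
            (W1 (mu s) (mu t) < e%:E)%E,
      exists2 r : R, 0 < r &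
        forall t, t \in `[0, T] -> msupp (mu t) `<=` eball 0 r &
      forall (zeta : phase -> R) (eta : R -> R),
        test_function zeta -> time_test_function T eta ->
        (- (\int[dt]_(t in (`[0, T] : set (time R)))
              (derive1 eta t * \int[mu t]_z zeta z)) =
          \int[dt]_(t in (`[0, T] : set (time R)))
            (eta t * \int[mu t]_z
              (\sum_i partial i zeta z * velocity H mu f t z ord0 i)))%R].

End dynamics.

(* Main.v *)
Require Import Defs.
From mathcomp Require Import all_boot all_order all_algebra.
From mathcomp Require Import all_classical all_reals all_analysis.
From mathcomp Require Import measurable_realfun ring lra.

(* Testing the local weak convergence against [1_A(t)] times integration of one
   component over a small box, and using the uniform Lipschitz bound to replace
   the box average by a point value, one finds that [f_k(., z)] converges to
   [f(., z)] weakly against indicators of time sets, for every fixed [z]. Since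
   [psi] is a countable supremum of affine functions, this makes
   [int w psi(f(t, z)) dt] lower semicontinuous along [f_k] for every weight [w]
   with values in [[0, 1]].

   A partition of unity with small supports, centred in a ball carrying all the
   limit measures, replaces [int psi(f_k(t, .)) dmu_k(t)] by a finite sum of
   values of [psi(f_k(t, .))] at the centres. The weights converge uniformly in
   time because the W1 distances do, and the errors are controlled by
   [1 + ell^q], the Lipschitz bound on [psi] making [psi(f_k(t, .))] Lipschitz
   with constant [O(ell(t)^q)]. The Lagrangian part is handled by Fatou's lemma
   in time, narrow convergence and truncation giving the pointwise bound. *)

Set Implicit Arguments.
Unset Strict Implicit.
Unset Printing Implicit Defensive.

Import Order.TTheory GRing.Theory Num.Theory.
Import numFieldNormedType.Exports.

Local Open Scope classical_set_scope.
Local Open Scope ring_scope.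

(** Both factors vary with the index: the controls converge only weakly in time, and the measures
    that integrate them move as well, so neither convergence can simply be inserted into the other.
    Fixing finitely many centres separates them. The measures then survive only as scalar weights,
    and the controls only as values at fixed points, where convexity absorbs what is left of the
    weakness. The mesh is chosen before the accuracy in the index, because the number of centres
    depends on it.

    The box functional must also be placed in the dual Sobolev space. The dual norm is a supremum
    over functions whose Sobolev norm refers to a chosen weak gradient, and already for the zero
    function this choice has to be identified almost everywhere. This is why bump functions and the
    fundamental lemma of the calculus of variations come before any duality. *)

(* The integral of a nonnegative function is a supremum over simple functions
   below it, hence monotone without measurability. The time integrands of the
   theorem are integrals over varying measures and need not be measurable. *)
Section lower_integral.
Context d (X : measurableType d) (R : realType).
Variable m : {measure set X -> \bar R}.
Local Open Scope ereal_scope.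

Import HBNNSimple.

Lemma ge0_le_lower_integral (D : set X) (f g : X -> \bar R) :
  (forall x, D x -> 0 <= f x) -> (forall x, D x -> f x <= g x) ->
  \int[m]_(x in D) f x <= \int[m]_(x in D) g x.
Proof.
move=> f0 fg; have g0 x : D x -> 0 <= g x.
  by move=> Dx; rewrite (le_trans (f0 x Dx) (fg x Dx)).
rewrite !ge0_integralE//; apply: ge_ereal_sup => _ [h hf <-].
apply: ereal_sup_ubound; exists h => // x; apply: (le_trans (hf x)).
by rewrite /patch; case: ifPn => // /set_mem; exact: fg.
Qed.

Lemma le_lower_integral (D : set X) (f g : X -> \bar R) :
  (forall x, D x -> f x <= g x) ->
  \int[m]_(x in D) f x <= \int[m]_(x in D) g x.
Proof.
move=> fg; rewrite integralE (integralE m D g); apply: leeB.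
  apply: ge0_le_lower_integral => x Dx; rewrite ?funepos_ge0//.
  by rewrite !funeposE; apply: le_max2 => //; exact: fg.
apply: ge0_le_lower_integral => x Dx; rewrite ?funeneg_ge0//.
by rewrite !funenegE; apply: le_max2 => //; rewrite leeN2; exact: fg.
Qed.

Lemma subset_lower_integral (D E : set X) (f : X -> \bar R) :
  (forall x, E x -> 0 <= f x) -> D `<=` E ->
  \int[m]_(x in D) f x <= \int[m]_(x in E) f x.
Proof.
move=> f0 DE; rewrite (integral_mkcond D) (integral_mkcond E).
apply: ge0_le_lower_integral => x _.
  by rewrite patchE; case: ifPn => // /set_mem/DE/f0.
rewrite !patchE; case: ifPn => [/set_mem Dx|_].
  by rewrite mem_set//; exact: DE.
by case: ifPn => // /set_mem/f0.
Qed.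

(** Neither [f] nor [g] is assumed measurable, so the null set is discarded from each simple
    function [h] below [f]; off [N] the bound on [h] passes to [g]. *)
Lemma ge0_le_lower_integral_ae (D N : set X) (f g : X -> \bar R) :
  measurable N -> m N = 0 ->
  (forall x, D x -> 0 <= f x) -> (forall x, D x -> 0 <= g x) ->
  (forall x, (D `\` N) x -> f x <= g x) ->
  \int[m]_(x in D) f x <= \int[m]_(x in D) g x.
Proof.
move=> mN N0 f0 g0 fg; rewrite [leLHS]ge0_integralE//.
apply: ge_ereal_sup => _ [h hf <-].
have -> : sintegral m h = \int[m]_x (h x)%:E.
  by rewrite integral_nnsfun// patch_setT.
have mh : measurable_fun setT (fun x => (h x)%:E) by exact/measurable_EFinP.
rewrite (ge0_negligible_integral mN measurableT mh)//.
  rewrite integral_mkcond [leRHS]integral_mkcond.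
  apply: ge0_le_lower_integral => x _; rewrite !patchE.
    by case: ifPn => // _; rewrite lee_fin.
  case: ifPn => [/set_mem[_ Nx]|_]; last by case: ifPn => // /set_mem/g0.
  apply: (le_trans (hf x)); rewrite patchE; case: ifPn => // /set_mem Dx.
  exact: fg.
by move=> x _; rewrite lee_fin.
Qed.

Lemma le_lower_integral_ae (D N : set X) (f g : X -> \bar R) :
  measurable N -> m N = 0 ->
  (forall x, (D `\` N) x -> f x <= g x) ->
  \int[m]_(x in D) f x <= \int[m]_(x in D) g x.
Proof.
move=> mN N0 fg; rewrite integralE (integralE m D g); apply: leeB.
  apply: (ge0_le_lower_integral_ae mN N0) => x Dx; rewrite ?funepos_ge0//.
  by rewrite !funeposE; apply: le_max2 => //; exact: fg.
apply: (ge0_le_lower_integral_ae mN N0) => x Dx; rewrite ?funeneg_ge0//.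
by rewrite !funenegE; apply: le_max2 => //; rewrite leeN2; exact: fg.
Qed.

(** Subadditivity fails for lower integrals in general but survives when one summand is measurable.
    For a simple [h] below [f + g], the positive part of [h - g] is measurable, stays below [f], and
    together with [g] dominates [h]. *)
Lemma lower_integralD_le (D : set X) (f : X -> \bar R) (g : X -> R) :
  measurable D -> (forall x, D x -> 0 <= f x) -> (forall x, D x -> (0 <= g x)%R) ->
  measurable_fun D g ->
  \int[m]_(x in D) (f x + (g x)%:E) <=
    \int[m]_(x in D) f x + \int[m]_(x in D) (g x)%:E.
Proof.
move=> mD f0 g0 mg; rewrite [leLHS]ge0_integralE; last first.
  by move=> x Dx; rewrite adde_ge0// ?f0// lee_fin g0.
apply: ge_ereal_sup => _ [h hf <-].
have -> : sintegral m h = \int[m]_(x in D) (h x)%:E.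
  rewrite integral_mkcond -[LHS]/(sintegral m h).
  transitivity (\int[m]_x (h x)%:E); first by rewrite integral_nnsfun// patch_setT.
  apply: eq_integral => x _; rewrite patchE; case: ifPn => // xD.
  have := hf x; rewrite patchE (negbTE xD) => hx.
  by apply/eqP; rewrite eq_le hx lee_fin/=.
pose p x := Num.max (h x - g x)%R 0%R.
have mp : measurable_fun D p.
  apply: measurable_maxr; last exact: measurable_cst.
  by apply: measurable_funB => //; exact: measurable_funTS.
apply: (@le_trans _ _ (\int[m]_(x in D) ((p x)%:E + (g x)%:E))).
  apply: ge0_le_lower_integral => x Dx; first by rewrite lee_fin.
  by rewrite -EFinD lee_fin -lerBlDr le_max lexx.
rewrite ge0_integralD//=.
- apply: leeD2r; apply: ge0_le_lower_integral => x Dx.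
    by rewrite lee_fin le_max lexx orbT.
  have := hf x; rewrite patchE mem_set// => hx.
  rewrite /p EFin_max ge_max f0// andbT EFinB leeBlDr//.
- by move=> x Dx; rewrite lee_fin le_max lexx orbT.
- exact/measurable_EFinP.
- exact/measurable_EFinP.
Qed.

End lower_integral.

(** * Order properties of the lower limit *)

Section liminf.
Context {R : realType}.
Local Open Scope ereal_scope.
Implicit Types (u v : (\bar R)^nat) (y : \bar R).

Lemma near_le_limn_einf u y :
  (\forall k \near \oo, y <= u k) -> y <= limn_einf u.
Proof.
move=> [n _ yu]; rewrite limn_einf_lim; apply: lime_ge; first exact: is_cvg_einfs.
exists n => // k /= nk; apply: le_ereal_inf_tmp => _ [j /= kj <-].
by apply: yu => /=; exact: leq_trans kj.
Qed.

Lemma le_limn_einf u v :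
  (\forall k \near \oo, u k <= v k) -> limn_einf u <= limn_einf v.
Proof.
move=> [n _ uv]; rewrite !limn_einf_lim.
apply: lee_lim; [exact: is_cvg_einfs|exact: is_cvg_einfs|].
exists n => // k /= nk; apply: le_ereal_inf_tmp => _ [j /= kj <-].
apply: (@le_trans _ _ (u j)); first by apply: ereal_inf_lbound; exists j.
by apply: uv => /=; exact: leq_trans kj.
Qed.

End liminf.

(** * The Euclidean norm against the sup norm *)

Section euclidean_norm.
Context {R : realType} {m n : nat}.
Implicit Types A B : 'M[R]_(m, n).

Lemma enorm_ge0 A : 0 <= enorm A.
Proof. exact: sqrtr_ge0. Qed.

Lemma sqr_enorm A : enorm A ^+ 2 = \sum_i \sum_j A i j ^+ 2.
Proof. by rewrite sqr_sqrtr//; do 2 (apply: sumr_ge0 => ? _); exact: sqr_ge0. Qed.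

Lemma enorm0 : enorm (0 : 'M[R]_(m, n)) = 0.
Proof.
rewrite /enorm big1 ?sqrtr0// => i _; rewrite big1// => j _.
by rewrite mxE expr0n.
Qed.

Lemma enormN A : enorm (- A) = enorm A.
Proof.
congr Num.sqrt; apply: eq_bigr => i _; apply: eq_bigr => j _.
by rewrite mxE sqrrN.
Qed.

Lemma le_entry_enorm A i j : `|A i j| <= enorm A.
Proof.
rewrite -sqrtr_sqr ler_sqrt; last first.
  by do 2 (apply: sumr_ge0 => ? _); exact: sqr_ge0.
rewrite (bigD1 i)//= (bigD1 j)//= -addrA lerDl addr_ge0//.
  by apply: sumr_ge0 => ? _; exact: sqr_ge0.
by do 2 (apply: sumr_ge0 => ? _); exact: sqr_ge0.
Qed.

Lemma le_norm_enorm A : `|A| <= enorm A.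
Proof.
rewrite [leLHS]/Num.norm/= mx_normrE; apply/bigmax_leP; split => [|[i j] _].
  exact: enorm_ge0.
exact: le_entry_enorm.
Qed.

Lemma le_entry_norm A i j : `|A i j| <= `|A|.
Proof.
rewrite [leRHS]/Num.norm/= mx_normrE; apply/bigmax_geP; right.
by exists (i, j).
Qed.

Lemma le_enorm_norm A : enorm A <= (m * n)%:R * `|A|.
Proof.
rewrite -[leRHS]ger0_norm ?mulr_ge0// -sqrtr_sqr ler_sqrt ?sqr_ge0//.
apply: (@le_trans _ _ (\sum_(i < m) \sum_(j < n) `|A| ^+ 2)).
  apply: ler_sum => i _; apply: ler_sum => j _.
  by rewrite -real_normK ?num_real// lerXn2r ?nnegrE//; exact: le_entry_norm.
rewrite !sumr_const !card_ord -mulrnA mulnC exprMn.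
rewrite -[X in X <= _]mulr_natl ler_wpM2r ?sqr_ge0// -natrX ler_nat.
by case: (m * n)%N => // k; rewrite expnS leq_pmulr// expn_gt0.
Qed.

(** The entrywise bound [(a + b)^2 <= 2 a^2 + 2 b^2] gives this with the harmless constant 2,
    without Cauchy-Schwarz. *)
Lemma enormD_le A B : enorm (A + B) <= 2 * (enorm A + enorm B).
Proof.
have h0 : 0 <= 2 * (enorm A + enorm B) by rewrite mulr_ge0// addr_ge0 ?enorm_ge0.
rewrite -[leRHS]ger0_norm// -sqrtr_sqr ler_sqrt ?sqr_ge0//.
apply: (@le_trans _ _ (2 * (enorm A ^+ 2 + enorm B ^+ 2))).
  rewrite !sqr_enorm -big_split mulr_sumr; apply: ler_sum => i _ /=.
  rewrite -big_split mulr_sumr; apply: ler_sum => j _ /=; rewrite mxE.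
  by have := sqr_ge0 (A i j - B i j); nra.
have := enorm_ge0 A; have := enorm_ge0 B; nra.
Qed.

Lemma continuous_measurable_mx (g : 'M[R]_(m, n) -> R) :
  continuous g -> measurable_fun setT g.
Proof.
move=> cg; apply: (measurability _ (measurable_realfun.RGenOInfty.measurableE R)).
move=> _ [_ [x ->] <-].
apply: sub_sigma_algebra; rewrite setTI.
by apply: open_comp; last exact: interval_open.
Qed.

Lemma measurable_entry i j :
  measurable_fun setT (fun A : 'M[R]_(m, n) => A i j).
Proof. by apply: continuous_measurable_mx => A; exact: coord_continuous. Qed.

Lemma measurable_enorm : measurable_fun setT (@enorm R m n).
Proof.
apply: (@measurableT_comp _ _ _ _ _ _ (@Num.sqrt R)).
  by apply: continuous_measurable_fun; exact: sqrt_continuous.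
apply: measurable_sum => i; apply: measurable_sum => j.
by apply: measurable_funX; exact: measurable_entry.
Qed.

End euclidean_norm.

(** * Boxes, Borel sets and moduli of continuity *)

Section boxes.
Context {R : realType} {n : nat}.
Implicit Types ab : 'rV[R]_n * 'rV[R]_n.

Definition box ab : set 'rV[R]_n :=
  [set z | forall i, ab.1 ord0 i < z ord0 i < ab.2 ord0 i].

Lemma measurable_open_rV (U : set 'rV[R]_n) : open U -> measurable U.
Proof. by move=> oU; exact: sub_sigma_algebra. Qed.

Lemma measurable_closed_rV (U : set 'rV[R]_n) : closed U -> measurable U.
Proof.
move=> cU; rewrite -[U]setCK; apply: measurableC; apply: measurable_open_rV.
by rewrite openC.
Qed.

Lemma measurable_compact_rV (U : set 'rV[R]_n) : compact U -> measurable U.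
Proof.
move=> cU; apply: measurable_closed_rV; apply: compact_closed cU.
exact: (@norm_hausdorff R 'rV[R]_n).
Qed.

Lemma boxE ab :
  box ab = \bigcap_(i in [set: 'I_n]) ((fun z : 'rV[R]_n => z ord0 i) @^-1`
    `]ab.1 ord0 i, ab.2 ord0 i[%classic).
Proof.
apply/seteqP; split => [z h i _|z h i] /=.
  by rewrite in_itv/=; exact: h.
by have := h i Logic.I; rewrite /= in_itv.
Qed.

Lemma measurable_box ab : measurable (box ab).
Proof.
rewrite boxE; apply: fin_bigcap_measurable => // i _.
by rewrite -[X in measurable X]setTI; apply: measurable_coord.
Qed.

Lemma box_basis : exists B : nat -> 'rV[R]_n * 'rV[R]_n, forall U, open U ->
  U = \bigcup_(k in [set k | box (B k) `<=` U]) box (B k).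
Proof.
pose r (c : {ffun 'I_n -> rat * rat}) : 'rV[R]_n * 'rV[R]_n :=
  (\row_i ratr (c i).1, \row_i ratr (c i).2).
(* Numbers that code no box receive both corners 0. The union collects only boxes contained in [U],
   so the default is harmless. *)
pose B k := r (odflt [ffun=> (0, 0)] (unpickle k)).
exists B => U; rewrite openE => oU.
apply/seteqP; split => [z Uz|z [c cU]]; last exact: cU.
have /nbhs_ballP[e /= e0 eU] := oU _ Uz.
have ex i : exists ab : rat * rat,
    [/\ z ord0 i - e < ratr ab.1, ratr ab.1 < z ord0 i,
        z ord0 i < ratr ab.2 & ratr ab.2 < z ord0 i + e].
  have h1 : z ord0 i - e < z ord0 i by rewrite ltrBlDr ltrDl.
  have h2 : z ord0 i < z ord0 i + e by rewrite ltrDl.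
  have [a] := rat_in_itvoo h1; have [b] := rat_in_itvoo h2.
  by rewrite !in_itv/= => /andP[? ?] /andP[? ?]; exists (a, b).
have /choice[c cP] := ex.
have BE : B (pickle [ffun j => c j]) = r [ffun j => c j].
  by rewrite /B pickleK.
exists (pickle [ffun j => c j]); rewrite /= BE /box /=; last first.
  by move=> i; rewrite !mxE ffunE; have [_ -> -> _] := cP i.
move=> y /= yc; apply: eU; split => // i j; rewrite ord1 /ball /=.
have := yc j; rewrite !mxE ffunE => /andP[y1 y2]; have [z1 z2 z3 z4] := cP j.
rewrite ltr_distlC.
by rewrite (lt_trans z1 y1) (lt_trans y2 z4).
Qed.

(** Since boxes are also stable under intersection, an identity checked on boxes extends to all
    Borel sets by Dynkin's theorem. *)
Lemma measurable_rVE :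
  @measurable _ 'rV[R]_n = <<s range box >>.
Proof.
apply/seteqP; split; last first.
  apply: smallest_sub; first exact: sigma_algebra_measurable.
  by move=> _ [ab _ <-]; exact: measurable_box.
apply: smallest_sub; first exact: smallest_sigma_algebra.
move=> U oU; have [B /(_ _ oU) ->] := box_basis.
rewrite bigcup_mkcond; apply: sigma_algebra_bigcup => k.
case: ifPn => _; last exact: sigma_algebra0.
by apply: sub_gen_smallest; exists (B k).
Qed.

Lemma setI_closed_box : setI_closed (range box).
Proof.
move=> _ _ [ab _ <-] [cd _ <-].
exists (\row_i Num.max (ab.1 ord0 i) (cd.1 ord0 i),
        \row_i Num.min (ab.2 ord0 i) (cd.2 ord0 i)) => //.
apply/seteqP; split => [z h|z [h1 h2] i].
  have {}h i : (ab.1 ord0 i < z ord0 i < ab.2 ord0 i) &&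
      (cd.1 ord0 i < z ord0 i < cd.2 ord0 i).
    have := h i; rewrite /= !mxE gt_max lt_min.
    by move=> /andP[/andP[-> ->] /andP[-> ->]].
  by split => i; have /andP[] := h i.
by rewrite /= !mxE gt_max lt_min; have /andP[-> ->] := h1 i; have /andP[-> ->] := h2 i.
Qed.

Lemma compact_norm_le (r : R) : compact [set z : 'rV[R]_n | `|z| <= r].
Proof.
apply: bounded_closed_compact.
  exists r; split; first exact: num_real.
  by move=> x rx z /= zr; rewrite (le_trans zr)// ltW.
apply: (closed_comp _ (@closed_le _ r)) => z _; exact: norm_continuous.
Qed.

(** Uniform continuity near [K], with only [y] confined to [K]: of two coupled measures only the
    limit one will be known to be carried by [K], and the other point [x] may lie anywhere. The
    radii play the role of the filter in the near-covering form of compactness. *)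
Lemma compact_modulus (K : set 'rV[R]_n) (g : 'rV[R]_n -> R) (e : R) :
  compact K -> continuous g -> 0 < e ->
  exists2 r : R, 0 < r & forall x y, K y -> `|x - y| < r -> `|g x - g y| < e.
Proof.
move=> /compact_near_coveringP cK cg e0.
have := cK R (0^'+) (fun r y => forall x, `|x - y| < r -> `|g x - g y| < e) _.
move=> /(_ _)[].
  move=> y Ky.
  have /cvgrPdist_lt /(_ (e / 2)) := cg y; rewrite divr_gt0// => /(_ isT).
  move=> /nbhs_ballP[r /= r0 h].
  exists (ball y (r / 2), [set s | 0 < s < r / 2]).
    split; first by apply: nbhsx_ballx; rewrite divr_gt0.
    exists (r / 2) => /=; first by rewrite divr_gt0.
    move=> s /=; rewrite sub0r normrN => /ltr_normlW hs s0.
    by rewrite s0 hs.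
  move=> [y' s] [/= yy' /andP[s0 sr]] x xy'.
  have y'E : `|y - y'| < r / 2 by move: yy'; rewrite -ball_normE.
  have h1 : `|g y - g x| < e / 2.
    apply: h; rewrite -ball_normE /= (splitr r).
    rewrite (le_lt_trans (ler_distD y' _ _))// ltrD//.
    by rewrite distrC (lt_trans xy').
  have h2 : `|g y - g y'| < e / 2.
    by apply: h; rewrite -ball_normE /= (lt_le_trans y'E)// ler_pdivrMr// ler_peMr ?ltW// ltrDl.
  by rewrite (splitr e) (le_lt_trans (ler_distD (g y) _ _))// ltrD// distrC.
move=> r /= r0 h.
exists (r / 2); first by rewrite divr_gt0.
move=> x y Ky; apply: (h (r / 2)) => //=; last by rewrite divr_gt0.
by rewrite sub0r normrN gtr0_norm ?divr_gt0// ltr_pdivrMr// ltr_pMr// ltrDl.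
Qed.

(** Close pairs cost at most [e]; for pairs at distance at least [r] the trivial bound [2 M] is at
    most [2 M / r] times the distance. A majorant linear in the distance is what a transport plan
    can integrate. *)
Lemma bounded_cont_modulus (K : set 'rV[R]_n) (g : 'rV[R]_n -> R) (M e : R) :
  compact K -> continuous g -> (forall z, `|g z| <= M) -> 0 < e ->
  exists2 c : R, 0 <= c &
    forall x y, K y -> `|g x - g y| <= e + c * enorm (x - y).
Proof.
move=> cK cg gM e0; have [r r0 h] := compact_modulus cK cg e0.
have M0 : 0 <= M by exact: le_trans (gM 0).
exists (2 * M / r); first by rewrite divr_ge0 ?mulr_ge0// ltW.
move=> x y Ky; have [xy|xy] := ltP `|x - y| r.
  rewrite (le_trans (ltW (h _ _ Ky xy)))// lerDl mulr_ge0 ?enorm_ge0//.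
  by rewrite divr_ge0 ?mulr_ge0// ltW.
apply: (@le_trans _ _ (2 * M)).
  by rewrite (le_trans (ler_normB _ _))// mulr2n mulrDl mul1r lerD.
rewrite -[leLHS]add0r lerD ?(ltW e0)// mulrAC ler_pdivlMr// ler_wpM2l ?mulr_ge0//.
by rewrite (le_trans xy)// le_norm_enorm.
Qed.

End boxes.

(** * Integrals under the Wasserstein distance *)

Section wasserstein.
Context {R : realType} {n : nat}.
Implicit Types mu nu : probability 'rV[R]_n R.

Lemma integrable_bounded_probability d (X : measurableType d)
    (P : probability X R) (g : X -> R) (M : R) :
  measurable_fun setT g -> (forall x, `|g x| <= M) ->
  P.-integrable setT (EFin \o g).
Proof.
move=> mg gM; apply: measurable_bounded_integrable => //.
  by have := probability_setT P => /= ->; rewrite ltry.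
exists M; split; first exact: num_real.
by move=> x Mx y _ /=; rewrite (le_trans (gM y))// ltW.
Qed.

Lemma coupling_integral mu nu pi (g : 'rV[R]_n -> R) (M : R) :
  coupling mu nu pi -> measurable_fun setT g -> (forall z, `|g z| <= M) ->
  (\int[pi]_z (g z.1)%:E = \int[mu]_z (g z)%:E)%E /\
  (\int[pi]_z (g z.2)%:E = \int[nu]_z (g z)%:E)%E.
Proof.
move=> cpl mg gM; split.
  rewrite (eq_measure_integral (pushforward pi fst)); last first.
    move=> A mA _; have [h _] := cpl A mA; rewrite /= /pushforward.
    by apply: etrans (esym h) _; congr (pi _); apply/seteqP; split => [[x y] []|[x y]].
  rewrite integral_pushforward//.
  - exact/measurable_EFinP.
  - apply: (@integrable_bounded_probability _ _ _ _ M) => //.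
    exact: (measurableT_comp mg measurable_fst).
rewrite (eq_measure_integral (pushforward pi snd)); last first.
  move=> A mA _; have [_ h] := cpl A mA; rewrite /= /pushforward.
  by apply: etrans (esym h) _; congr (pi _); apply/seteqP; split => [[x y] []|[x y]].
rewrite integral_pushforward//.
- exact/measurable_EFinP.
- apply: (@integrable_bounded_probability _ _ _ _ M) => //.
  exact: (measurableT_comp mg measurable_snd).
Qed.

Lemma measurable_enormB :
  measurable_fun setT
    (fun z : 'rV[R]_n * 'rV[R]_n => enorm (z.1 - z.2)).
Proof.
apply: (@measurableT_comp _ _ _ _ _ _ (@Num.sqrt R)).
  by apply: continuous_measurable_fun; exact: sqrt_continuous.
apply: measurable_sum => i; apply: measurable_sum => j.
apply: measurable_funX.
rewrite (_ : (fun _ => _) = (fun z : 'rV[R]_n * 'rV[R]_n => z.1 ord0 j) \-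
   (fun z : 'rV[R]_n * 'rV[R]_n => z.2 ord0 j)); last first.
  by apply/funext => z; rewrite !mxE ord1.
by apply: measurable_funB;
  [apply: (measurableT_comp (@measurable_coord R n j) measurable_fst)|
   apply: (measurableT_comp (@measurable_coord R n j) measurable_snd)].
Qed.

(** Some coupling has cost below [w]. The pairs whose second point leaves [K] are null for it,
    because its second marginal is [nu]; on the others the modulus of [g] is integrated. *)
Lemma le_W1_integral mu nu (K : set 'rV[R]_n) (g : 'rV[R]_n -> R) (M e c w : R) :
  measurable K -> nu (~` K) = 0%E ->
  measurable_fun setT g -> (forall z, `|g z| <= M) -> 0 <= e -> 0 <= c ->
  (forall x y, K y -> `|g x - g y| <= e + c * enorm (x - y)) ->
  (W1 mu nu < w%:E)%E ->
  `|(\int[mu]_z g z)%R - (\int[nu]_z g z)%R| <= e + c * w.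
Proof.
move=> mK nuK mg gM e0 c0 hg /ereal_inf_lt[_ [pi cpl <-]] piw.
have [<- <-] : (fine (\int[pi]_z (g z.1)%:E) = (\int[mu]_z g z)%R) /\
    (fine (\int[pi]_z (g z.2)%:E) = (\int[nu]_z g z)%R).
  by have [-> ->] := coupling_integral cpl mg gM.
have mg1 : measurable_fun setT (g \o fst : 'rV[R]_n * 'rV[R]_n -> R).
  exact: (measurableT_comp mg measurable_fst).
have mg2 : measurable_fun setT (g \o snd : 'rV[R]_n * 'rV[R]_n -> R).
  exact: (measurableT_comp mg measurable_snd).

have i1 : pi.-integrable setT (EFin \o (g \o fst)).
  by apply: (@integrable_bounded_probability _ _ _ _ M) => // z; exact: gM.
have i2 : pi.-integrable setT (EFin \o (g \o snd)).
  by apply: (@integrable_bounded_probability _ _ _ _ M) => // z; exact: gM.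
rewrite -fineB; [|exact: integrable_fin_num|exact: integrable_fin_num].
rewrite -integralB//.
have mE := measurable_enormB.
rewrite -lee_fin; apply: (@le_trans _ _ (\int[pi]_z `|g z.1 - g z.2|%:E)%E).
  have iB := integrableB measurableT i1 i2.
  rewrite -abse_EFin fineK; last exact: integrable_fin_num.
  by apply: (le_trans (le_abse_integral _ _ _)) => //; exact: measurable_int iB.
apply: (@le_trans _ _ (\int[pi]_z (e%:E + c%:E * (enorm (z.1 - z.2))%:E))%E).
  apply: (@le_lower_integral_ae _ _ _ _ _ (setT `*` ~` K)) => //.
  - by apply: measurableX => //; exact: measurableC.
  - by have [_ h] := cpl (~` K) (measurableC mK); exact: etrans h nuK.
  - move=> [x y] [_ /= h]; rewrite -EFinM -EFinD lee_fin; apply: hg.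
    by apply: contrapT => nK; apply: h.
rewrite ge0_integralD//; last 2 first.
- by move=> z _; rewrite mule_ge0// lee_fin// enorm_ge0.
- by apply: emeasurable_funM => //; exact/measurable_EFinP.
have E1 : (\int[pi]__ e%:E = e%:E)%E.
  by rewrite integral_cst//; have := probability_setT pi => /= ->; rewrite mule1.
rewrite E1 ge0_integralZl//; last 2 first.
- exact/measurable_EFinP.
- by move=> z _; rewrite lee_fin enorm_ge0.
by rewrite EFinD leeD2l// EFinM lee_wpmul2l ?lee_fin// ltW.
Qed.

(** The threshold [w] depends on [K], [g], [M] and [e] but not on the measures. This uniformity
    yields both the convergence of the weights uniformly in time and their continuity in time. *)
Lemma W1_integral_modulus (K : set 'rV[R]_n) (g : 'rV[R]_n -> R) (M e : R) :
  compact K -> continuous g -> (forall z, `|g z| <= M) -> 0 < e ->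
  exists2 w : R, 0 < w & forall mu nu, nu (~` K) = 0%E -> (W1 mu nu < w%:E)%E ->
    `|(\int[mu]_z g z)%R - (\int[nu]_z g z)%R| < e.
Proof.
move=> cK cg gM e0; have e20 : 0 < e / 2 by rewrite divr_gt0.
have [c c0 hc] := bounded_cont_modulus cK cg gM e20.
have c10 : 0 < c + 1 by rewrite ltr_wpDl.
exists (e / 2 / (c + 1)); first by rewrite divr_gt0.
move=> mu nu nuK W; apply: (le_lt_trans (le_W1_integral (measurable_compact_rV cK) nuK
  (continuous_measurable_mx cg) gM (ltW e20) c0 hc W)).
rewrite [ltRHS]splitr ltrD2l mulrCA gtr_pMr//.
by rewrite ltr_pdivrMr// mul1r ltrDl.
Qed.

Lemma W1_narrow_cvg (mus : nat -> probability 'rV[R]_n R) mu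
    (K : set 'rV[R]_n) : compact K -> mu (~` K) = 0%E ->
  (forall e : R, 0 < e -> \forall k \near \oo, (W1 (mus k) mu < e%:E)%E) ->
  narrow_cvg mus mu.
Proof.
move=> cK muK musmu g cg [M gM]; apply/cvgrPdist_lt => /= e e0.
have [w w0 h] := W1_integral_modulus cK cg gM e0.
by apply: filterS (musmu w w0) => k; rewrite distrC; exact: h.
Qed.

(** A point outside the support has a null open neighbourhood, hence lies in one of the countably
    many basic boxes of measure zero; their union is null. *)
Lemma msupp_full mu (r : R) : msupp mu `<=` eball 0 r ->
  mu (~` [set z | `|z| <= r]) = 0%E.
Proof.
move=> sr; have [B hB] := @box_basis R n.
pose F k := if mu (box (B k)) == 0%E then box (B k) else set0.
have F0 : mu.-negligible (\bigcup_k F k).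
  apply: negligible_bigcup => k; rewrite /F; case: ifPn => [/eqP h|_].
    by exists (box (B k)); split => //; exact: measurable_box.
  exact: negligible_set0.
have mN : measurable (~` [set z : 'rV[R]_n | `|z| <= r]).
  by apply: measurableC; apply: measurable_compact_rV; exact: compact_norm_le.
apply: measure_negligible => //; apply: negligibleS F0 => z /= zr.
have : ~ msupp mu z.
  move=> /sr; rewrite /eball /= subr0 => h; apply: zr.
  by rewrite (le_trans (le_norm_enorm _))// ltW.
move=> /existsNP[U /not_implyP[oU /not_implyP[Uz /negP]]]; rewrite -leNgt => U0.
have := oU => /hB UE; move: (Uz); rewrite UE => -[k /= kU kz].
exists k => //; rewrite /F ifT//; rewrite eq_le measure_ge0 andbT.
apply: le_trans U0; apply: le_measure => //; rewrite inE.
  exact: measurable_box.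
exact: measurable_open_rV.
Qed.

End wasserstein.

(** * A family of functions flat at the origin *)

Section flat_exponential.
Context {R : realType}.

(** For [k = 0] this is the classical smooth function that is flat at the origin; the powers [x^-k]
    appear when it is differentiated. *)
Definition flat_exp (k : nat) (x : R) : R :=
  if 0 < x then x ^- k * expR (- x^-1) else 0.

Lemma flat_exp_ge0 k x : 0 <= flat_exp k x.
Proof.
rewrite /flat_exp; case: ifPn => // x0.
by rewrite mulr_ge0 ?expR_ge0// invr_ge0 exprn_ge0// ltW.
Qed.

Lemma flat_exp_gt0 k x : (0 < flat_exp k x) = (0 < x).
Proof.
rewrite /flat_exp; case: ifPn => [x0|_]; last by rewrite ltxx.
by rewrite mulr_gt0 ?expR_gt0// invr_gt0 exprn_gt0.
Qed.

Lemma flat_exp_eq0 k x : x <= 0 -> flat_exp k x = 0.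
Proof. by rewrite /flat_exp leNgt => /negbTE ->. Qed.

(** The Taylor term of order [k.+1] bounds [exp(1/x)] from below, so the exponential beats the power
    with one factor [x] to spare. *)
Lemma flat_exp_le k x : flat_exp k x <= k.+1`!%:R * `|x|.
Proof.
rewrite /flat_exp; case: ifPn => [x0|_]; last by rewrite mulr_ge0.
have y0 : 0 < x^-1 by rewrite invr_gt0.
have h : (x^-1) ^+ k.+1 / k.+1`!%:R <= expR x^-1.
  by rewrite (le_trans _ (expR_ge1Dxn k (ltW y0)))// lerDr.
rewrite gtr0_norm// expRN -exprVn ler_pdivrMr ?expR_gt0//.
have f0 : 0 < k.+1`!%:R :> R by rewrite ltr0n fact_gt0.
move: h; rewrite ler_pdivrMr// => h.
have -> : x^-1 ^+ k = x * x^-1 ^+ k.+1.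
  by rewrite exprS mulrA divff ?gt_eqF// mul1r.
by rewrite [X in X * expR _]mulrC -mulrA ler_wpM2l ?(ltW x0)// mulrC.
Qed.

Lemma is_derive_flat_exp k (x : R) :
  is_derive x (1 : R) (flat_exp k)
    (- k%:R * flat_exp k.+1 x + flat_exp k.+2 x).
Proof.
have [x0|x0|->] := ltgtP x 0.
- rewrite !flat_exp_eq0 ?(ltW x0)// mulr0 addr0.
  apply: (@near_eq_is_derive _ _ _ (cst 0)); rewrite ?oner_eq0//.
  near=> y; rewrite /= flat_exp_eq0// ltW//; near: y.
  exact: lt_nbhsl.
- have -> : - k%:R * flat_exp k.+1 x + flat_exp k.+2 x =
      - (x ^+ k) ^- 2 *: (k%:R * x ^+ k.-1) * expR (- x^-1)
        + x ^- k * (x ^- 2 * expR (- x^-1)).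
    have xn0 : x != 0 by rewrite gt_eqF.
    rewrite /flat_exp x0 /GRing.scale /=; case: k => [|k] /=.
      by rewrite !expr0 !invr1 mulr0n oppr0 !mul0r mulr0 mul0r !mul1r.
    rewrite !exprS; have : x ^+ k != 0 by rewrite expf_neq0.
    move: (x ^+ k) (expR _) (k.+1%:R : R) => a E c a0.
    by rewrite expr0 mulr1; field; rewrite xn0 a0.
  apply: (@near_eq_is_derive _ _ _ (fun y : R => (y ^+ k)^-1 * expR (- y^-1))).
    near=> y; rewrite /flat_exp ifT//; near: y.
    exact: lt_nbhsr.
  have xn0 : x != 0 by rewrite gt_eqF.
  have d1 : is_derive x (1 : R) (fun y => (y ^+ k)^-1)
      (- (x ^+ k) ^- 2 *: (k%:R * x ^+ k.-1)).
    have dX : derivable (fun y : R => y ^+ k) x 1 by exact: exprn_derivable.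
    apply: DeriveDef; first by apply: derivableV => //; rewrite expf_neq0.
    rewrite deriveV ?expf_neq0//; congr (_ *: _).
    by rewrite exp_derive /GRing.scale /= mulr1.
  have d2 : is_derive x (1 : R) (fun y => - y^-1) (x ^- 2).
    apply: DeriveDef; first by apply: derivableN; exact: derivableV.
    rewrite deriveN; last exact: derivableV.
    by rewrite deriveV// derive_id /GRing.scale /= mulr1 opprK.
  have d3 := @is_derive1_comp _ expR (fun y : R => - y^-1) x _ _
    (is_derive_expR (- x^-1)) d2.
  have h := is_deriveM d1 d3; move: h.
  set D1 := (X in is_derive _ _ _ X -> _); set D2 := (X in _ -> is_derive _ _ _ X).
  have -> : D1 = D2 by rewrite /D1 /D2 /GRing.scale /=; ring.
  exact.
- rewrite !flat_exp_eq0// mulr0 addr0.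
  have h0 : h^-1 *: (flat_exp k (h *: (1 : R) + 0) - flat_exp k 0) @[h --> 0^'] --> (0 : R).
    apply/cvgrPdist_le => e e0; near=> h.
    have hn0 : h != 0 by near: h; exact: nbhs_dnbhs_neq.
    rewrite sub0r normrN addr0 [flat_exp k 0]flat_exp_eq0// subr0.
    rewrite /GRing.scale /= mulr1.
    (* The difference quotient at the origin is the next function of the family, and its linear
       bound gives the limit 0. *)
    have -> : h^-1 * flat_exp k h = flat_exp k.+1 h.
      rewrite /flat_exp; case: ifPn => _; rewrite ?mulr0//.
      by rewrite mulrA exprS invfM.
    rewrite ger0_norm ?flat_exp_ge0// (le_trans (flat_exp_le _ _))//.
    rewrite mulrC -ler_pdivlMr ?ltr0n ?fact_gt0//.
    near: h; apply: nbhs_dnbhs.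
    have : 0 < e / (k.+2)`!%:R by rewrite divr_gt0// ltr0n fact_gt0.
    move=> d0; exists (e / (k.+2)`!%:R) => //= h.
    by rewrite /= sub0r normrN => /ltW.
  apply: DeriveDef; first by apply/cvg_ex; exists 0.
  exact/cvg_lim.
Unshelve. all: end_near. Qed.

End flat_exponential.

(** * A class of smooth functions closed under partial derivatives *)

Section smooth_functions.
Context {R : realType} {n : nat}.
Local Notation rV := 'rV[R]_n.

(* The derivative of [x^-k e^(-1/x)] is a combination of functions of the same
   form, so this class is stable under partial derivatives. *)
Inductive smooth_gen : (rV -> R) -> Prop :=
| smooth_gen_cst c : smooth_gen (fun=> c)
| smooth_gen_coord i : smooth_gen (fun z => z ord0 i)
| smooth_gen_add f g : smooth_gen f -> smooth_gen g ->
    smooth_gen (fun z => f z + g z)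
| smooth_gen_mul f g : smooth_gen f -> smooth_gen g ->
    smooth_gen (fun z => f z * g z)
| smooth_gen_inv f : smooth_gen f -> (forall z, f z != 0) ->
    smooth_gen (fun z => (f z)^-1)
| smooth_gen_flat k f : smooth_gen f -> smooth_gen (fun z => flat_exp k (f z)).

Lemma smooth_gen_sum (I : finType) (F : I -> rV -> R) :
  (forall i, smooth_gen (F i)) -> smooth_gen (fun z => \sum_i F i z).
Proof.
move=> hF; rewrite -[index_enum I]/(index_enum I); elim: (index_enum I) => [|i s IH].
  rewrite (_ : (fun _ => _) = fun=> 0); first exact: smooth_gen_cst.
  by apply/funext => z; rewrite big_nil.
rewrite (_ : (fun _ => _) = fun z => F i z + \sum_(i <- s) F i z).
  exact: smooth_gen_add.
by apply/funext => z; rewrite big_cons.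
Qed.

Lemma smooth_gen_prod (I : finType) (F : I -> rV -> R) :
  (forall i, smooth_gen (F i)) -> smooth_gen (fun z => \prod_i F i z).
Proof.
move=> hF; elim: (index_enum I) => [|i s IH].
  rewrite (_ : (fun _ => _) = fun=> 1); first exact: smooth_gen_cst.
  by apply/funext => z; rewrite big_nil.
rewrite (_ : (fun _ => _) = fun z => F i z * \prod_(i <- s) F i z).
  exact: smooth_gen_mul.
by apply/funext => z; rewrite big_cons.
Qed.

Lemma smooth_gen_sub f g : smooth_gen f -> smooth_gen g ->
  smooth_gen (fun z => f z - g z).
Proof.
move=> hf hg.
rewrite (_ : (fun _ => _) = fun z => f z + (-1) * g z); last first.
  by apply/funext => z; rewrite mulN1r.
apply: smooth_gen_add => //; apply: smooth_gen_mul => //.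
exact: smooth_gen_cst.
Qed.

Lemma differentiable_flat_exp k (x : R) : differentiable (flat_exp k) x.
Proof. by apply/derivable1_diffP; have := is_derive_flat_exp k x. Qed.

Lemma differentiable_smooth_gen f z : smooth_gen f -> differentiable f z.
Proof.
elim=> {f}.
- by move=> c; exact: differentiable_cst.
- by move=> i; exact: differentiable_coord.
- by move=> f g _ df _ dg; exact: (differentiableD df dg).
- by move=> f g _ df _ dg; exact: (differentiableM df dg).
- by move=> f _ df f0; exact: (differentiableV df (f0 z)).
- move=> k f _ df.
  exact: (differentiable_comp df (differentiable_flat_exp k (f z))).
Qed.

Lemma partial_smooth_gen i f : smooth_gen f -> smooth_gen (partial i f).
Proof.
have dv g z : smooth_gen g -> derivable g z (basis_vec i).
  by move=> hg; apply: diff_derivable; exact: differentiable_smooth_gen.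
elim=> {f}.
- move=> c; rewrite (_ : partial i _ = fun=> 0); first exact: smooth_gen_cst.
  by apply/funext => z; exact: derive_cst.
- move=> j; rewrite (_ : partial i _ = fun=> basis_vec i ord0 j).
    exact: smooth_gen_cst.
  apply/funext => z; apply/cvg_lim => //; apply: cvg_near_cst; near=> h.
  rewrite /= !mxE addrK /GRing.scale /= mulrA mulVf ?mul1r//.
  by near: h; exact: nbhs_dnbhs_neq.
- move=> f g hf Hf hg Hg.
  rewrite (_ : partial i _ = fun z => partial i f z + partial i g z).
    exact: smooth_gen_add.
  by apply/funext => z; rewrite /partial; apply: deriveD; exact: dv.
- move=> f g hf Hf hg Hg.
  rewrite (_ : partial i _ =
      fun z => f z * partial i g z + g z * partial i f z).
    by apply: smooth_gen_add; exact: smooth_gen_mul.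
  by apply/funext => z; rewrite /partial; apply: deriveM; exact: dv.
- move=> f hf Hf f0.
  rewrite (_ : partial i _ =
      fun z => - 1 * ((f z)^-1 * ((f z)^-1 * partial i f z))).
    apply: smooth_gen_mul; first exact: smooth_gen_cst.
    by do 2 (apply: smooth_gen_mul; first exact: smooth_gen_inv).
  apply/funext => z; rewrite /partial deriveV//; last exact: dv.
  by rewrite /GRing.scale /= expr2 invfM mulN1r mulNr mulrA.
- move=> k f hf Hf.
  rewrite (_ : partial i _ = fun z =>
    (- k%:R * flat_exp k.+1 (f z) + flat_exp k.+2 (f z)) * partial i f z).
    apply: smooth_gen_mul => //; apply: smooth_gen_add.
      by apply: smooth_gen_mul; [exact: smooth_gen_cst|exact: smooth_gen_flat].
    exact: smooth_gen_flat.
  apply/funext => z; rewrite /partial.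
  have df := differentiable_smooth_gen z hf.
  have dg := differentiable_flat_exp k (f z).
  rewrite -[X in 'D_(basis_vec i) X _]/(flat_exp k \o f).
  rewrite deriveE; last exact: differentiable_comp.
  rewrite (diff_comp df dg) /= (diff1E dg) derive1E -(deriveE _ df).
  have /(@derive_val _ _ _) -> := is_derive_flat_exp k (f z).
  by rewrite /GRing.scale /= mulrC.
Unshelve. all: end_near. Qed.

Lemma smooth_gen_smooth f : smooth_gen f -> smooth f.
Proof.
move=> hf s; have : smooth_gen (iter_partial s f).
  by elim: s => //= i s; exact: partial_smooth_gen.
move=> hs; split.
  by move=> z; apply: differentiable_continuous; exact: differentiable_smooth_gen.
by move=> i x; apply: diff_derivable; exact: differentiable_smooth_gen.
Qed.

Lemma continuous_smooth_gen f : smooth_gen f -> continuous f.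
Proof. by move=> hf; have [] := smooth_gen_smooth hf [::]. Qed.

Lemma smooth_gen_test_function f (r : R) : smooth_gen f ->
  (forall z, r < `|z| -> f z = 0) -> test_function f.
Proof.
move=> hf fr; split; first exact: smooth_gen_smooth.
apply: (subclosed_compact _ (@compact_norm_le R n r)).
  exact: closed_closure.
have /closure_id -> : closed [set z : rV | `|z| <= r].
  by apply: compact_closed; [exact: (@norm_hausdorff R rV)|exact: compact_norm_le].
apply: closure_subset => z /= /eqP fz; rewrite leNgt; apply/negP => /fr.
exact: fz.
Qed.

End smooth_functions.

(** * The fundamental lemma of the calculus of variations *)

Section fundamental_lemma.
Context {R : realType} {n : nat}.
Local Notation rV := 'rV[R]_n.
Local Notation leb := (@lebesgue_Rn R n).
Implicit Types ab : rV * rV.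

Lemma lebesgue_Rn_boxE ab :
  leb (box ab) = (\prod_i Num.max 0 (ab.2 ord0 i - ab.1 ord0 i))%:E.
Proof.
rewrite (_ : box ab =
    [set z | forall i, [set` `]ab.1 ord0 i, ab.2 ord0 i[] (z ord0 i)]); last first.
  by apply/seteqP; split => z h i; have := h i; rewrite /= in_itv.
rewrite (@lebesgue_Rn_box R n (fun i => [set` `]ab.1 ord0 i, ab.2 ord0 i[])); last first.
  by move=> i; exact: measurable_itv.
elim/big_rec2: _ => // i y1 y2 _ ->; rewrite EFinM; congr (_ * _)%E.
have := @lebesgue_measure_itv R `]ab.1 ord0 i, ab.2 ord0 i[ => /= ->.
rewrite lte_fin; case: ltP => h.
  by rewrite max_r ?subr_ge0 ?ltW// EFinB.
by rewrite max_l// subr_le0.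
Qed.

Lemma lebesgue_Rn_box_fin ab : (leb (box ab) < +oo)%E.
Proof. by rewrite lebesgue_Rn_boxE ltry. Qed.

Lemma lebesgue_Rn_box_gt0 ab : (forall i, ab.1 ord0 i < ab.2 ord0 i) ->
  (0 < leb (box ab))%E.
Proof.
move=> h; rewrite lebesgue_Rn_boxE lte_fin; apply: prodr_gt0 => i _.
by rewrite lt_max subr_gt0 h orbT.
Qed.

Lemma norm_box ab z : box ab z -> `|z| <= `|ab.1| + `|ab.2|.
Proof.
move=> zab.
rewrite [leLHS]/Num.norm/= mx_normrE; apply/bigmax_leP; split => [|[i j] _].
  by rewrite addr_ge0.
rewrite ord1 /=; have /andP[/ltW h1 /ltW h2] := zab j.
have g1 := le_entry_norm ab.1 ord0 j; have g2 := le_entry_norm ab.2 ord0 j.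
move: g1 g2; rewrite !ler_norml => /andP[g1 g1'] /andP[g2 g2'].
have n1 := normr_ge0 ab.1; have n2 := normr_ge0 ab.2.
by apply/andP; split; lra.
Qed.

Definition box_bump ab (z : rV) : R :=
  \prod_i (flat_exp 0 (z ord0 i - ab.1 ord0 i) *
           flat_exp 0 (ab.2 ord0 i - z ord0 i)).

Lemma smooth_gen_box_bump ab : smooth_gen (box_bump ab).
Proof.
apply: smooth_gen_prod => i; apply: smooth_gen_mul;
  apply: smooth_gen_flat; apply: smooth_gen_sub;
  by [exact: smooth_gen_coord|exact: smooth_gen_cst].
Qed.

Lemma box_bump_ge0 ab z : 0 <= box_bump ab z.
Proof. by apply: prodr_ge0 => i _; rewrite mulr_ge0 ?flat_exp_ge0. Qed.

Lemma box_bump_gt0 ab z : box ab z -> 0 < box_bump ab z.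
Proof.
move=> h; apply: prodr_gt0 => i _; have /andP[h1 h2] := h i.
by rewrite mulr_gt0// flat_exp_gt0 subr_gt0.
Qed.

Lemma box_bump_eq0 ab z : ~ box ab z -> box_bump ab z = 0.
Proof.
move=> /existsNP[i /negP]; rewrite negb_and -!leNgt => h.
rewrite /box_bump (bigD1 i)//=; case/orP: h => h.
  by rewrite (flat_exp_eq0 _ (x := z ord0 i - _)) ?mul0r// subr_le0.
by rewrite (flat_exp_eq0 _ (x := _ - z ord0 i)) ?mulr0 ?mul0r// subr_le0.
Qed.

(** With [b] the bump, [k b / (k b + 1)] is a test function with values in [[0, 1]], zero off the
    box, that increases with [k] to the indicator of the box. *)
Definition box_approx ab (k : nat) (z : rV) : R :=
  k%:R * box_bump ab z * (k%:R * box_bump ab z + 1)^-1.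

Lemma box_approx_eq0 ab k z : ~ box ab z -> box_approx ab k z = 0.
Proof. by move=> h; rewrite /box_approx box_bump_eq0// mulr0 mul0r. Qed.

Lemma box_approx_ge0 ab k z : 0 <= box_approx ab k z.
Proof.
have h := box_bump_ge0 ab z.
by rewrite mulr_ge0 ?mulr_ge0// invr_ge0 addr_ge0// mulr_ge0.
Qed.

Lemma box_approx_le1 ab k z : box_approx ab k z <= 1.
Proof.
have h := box_bump_ge0 ab z.
by rewrite ler_pdivrMr ?mul1r ?lerDl// ltr_wpDl// mulr_ge0.
Qed.

Lemma box_approx_cvg ab z : box ab z -> box_approx ab ^~ z @ \oo --> (1 : R).
Proof.
move=> /box_bump_gt0 b0; apply/cvgrPdist_le => e e0.
near=> k.
have d0 : 0 < k%:R * box_bump ab z + 1 by rewrite ltr_wpDl// mulr_ge0// ltW.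
have -> : 1 - box_approx ab k z = (k%:R * box_bump ab z + 1)^-1.
  by rewrite /box_approx; field; rewrite gt_eqF.
rewrite gtr0_norm ?invr_gt0// -[leRHS]invrK lef_pV2 ?posrE ?invr_gt0//.
rewrite (@le_trans _ _ (k%:R * box_bump ab z))// ?lerDl//.
rewrite -ler_pdivrMr//; near: k; exact: nbhs_infty_ger.
Unshelve. all: end_near. Qed.

Lemma test_function_box_approx ab k : test_function (box_approx ab k).
Proof.
apply: (@smooth_gen_test_function _ _ _ (`|ab.1| + `|ab.2|)).
  apply: smooth_gen_mul.
    by apply: smooth_gen_mul; [exact: smooth_gen_cst|exact: smooth_gen_box_bump].
  apply: smooth_gen_inv.
    apply: smooth_gen_add; last exact: smooth_gen_cst.
    by apply: smooth_gen_mul; [exact: smooth_gen_cst|exact: smooth_gen_box_bump].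
  by move=> z; rewrite gt_eqF// ltr_wpDl// mulr_ge0// box_bump_ge0.
move=> z zr; apply: box_approx_eq0 => /norm_box; apply/negP.
by rewrite -ltNge.
Qed.

Definition cube (r : R) : rV * rV := (const_mx (- r), const_mx r).

Lemma cubeP r z : `|z| < r -> box (cube r) z.
Proof.
move=> zr i; rewrite /cube /= !mxE -ltr_norml.
by rewrite (le_lt_trans _ zr)// le_entry_norm.
Qed.

Lemma box_compact ab : exists2 K, compact K & box ab `<=` K.
Proof.
exists [set z | `|z| <= `|ab.1| + `|ab.2|]; first exact: compact_norm_le.
exact: norm_box.
Qed.

(** The integrals of [g] against the approximate indicators vanish; since they are dominated by
    [|g|] on the box, the limit vanishes as well. *)
Lemma fundamental_lemma_box (g : rV -> R) ab :
  measurable_fun setT g ->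
  leb.-integrable (box ab) (EFin \o g) ->
  (forall zeta, test_function zeta -> (\int[leb]_x (g x * zeta x) = 0)%R) ->
  (\int[leb]_(x in box ab) (g x)%:E = 0)%E.
Proof.
move=> mg ig hg.
have mB := measurable_box ab.
pose F k x := (g x * box_approx ab k x)%:E.
have mF k : measurable_fun setT (fun x => g x * box_approx ab k x).
  apply: measurable_funM => //; apply: continuous_measurable_mx.
  by have [/(_ [::]) []] := test_function_box_approx ab k.
have absF k x : (`|F k x| <= `|(EFin \o g) x|)%E.
  rewrite /F /= lee_fin normrM ler_piMr// ger0_norm ?box_approx_ge0//.
  exact: box_approx_le1.
have iF k : leb.-integrable (box ab) (F k).
  apply: (le_integrable mB _ _ ig) => //.
    by apply/measurable_EFinP; exact: measurable_funTS.
have F0 k : (\int[leb]_(x in box ab) F k x = 0)%E.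
  have := hg _ (test_function_box_approx ab k).
  rewrite /Rintegral.
  have -> : (\int[leb]_x (g x * box_approx ab k x)%:E =
      \int[leb]_(x in box ab) F k x)%E.
    rewrite [RHS]integral_mkcond; apply: eq_integral => x _; rewrite patchE.
    case: ifPn => // /negP h; rewrite box_approx_eq0 ?mulr0//.
    by move=> xB; apply: h; exact/mem_set.
  by move=> h; rewrite -[LHS]fineK ?h//; exact: integrable_fin_num.
have : (fun k => \int[leb]_(x in box ab) F k x)%E @ \oo -->
    (\int[leb]_(x in box ab) (EFin \o g) x)%E.
  have h1 k : measurable_fun (box ab) (F k).
    by apply/measurable_EFinP; exact: measurable_funTS.
  have h2 : measurable_fun (box ab) (EFin \o g).
    by apply/measurable_EFinP; exact: measurable_funTS.
  have h3 : {ae leb, forall x, box ab x -> F ^~ x @ \oo --> (EFin \o g) x}.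
    apply: aeW => x xB; apply: cvg_EFin; first exact: nearW.
    rewrite -[X in _ --> X]mulr1; apply: cvgM; first exact: cvg_cst.
    exact: box_approx_cvg.
  have h4 : {ae leb, forall x k, box ab x -> (`|F k x| <= `|(EFin \o g) x|)%E}.
    by apply: aeW => x k _; exact: absF.
  by have [] := dominated_convergence mB h1 h2 h3 (integrable_abse ig) h4.
rewrite (_ : (fun k => _) = cst 0%E); last by apply/funext.
by move/cvg_lim => <- //; rewrite lim_cst.
Qed.

(** The sets [E] for which [g] integrates to zero over [E] intersected with the cube form a Dynkin
    system containing the boxes. The cube keeps every integral finite, which closure under
    complements requires. *)
Lemma fundamental_lemma (g : rV -> R) (r : R) :
  measurable_fun setT g ->
  leb.-integrable (box (cube r)) (EFin \o g) ->
  (forall zeta, test_function zeta -> (\int[leb]_x (g x * zeta x) = 0)%R) ->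
  {ae leb, forall x, box (cube r) x -> g x = 0}.
Proof.
move=> mg ig hg; set Q := box (cube r).
have mQ : measurable Q := measurable_box _.
have iE E : measurable E -> leb.-integrable (E `&` Q) (EFin \o g).
  by move=> mE; apply: integrableS ig => //; exact: measurableI.
have h E : measurable E -> (\int[leb]_(x in E `&` Q) (g x)%:E = 0)%E.
  move=> mE; have : <<s range box >> E by rewrite -measurable_rVE.
  move: E {mE}; apply: (@dynkin_induction _ _ (range box)
    (fun E => \int[leb]_(x in E `&` Q) (g x)%:E = 0)%E).
  - exact: measurable_rVE.
  - exact: setI_closed_box.
  - by rewrite setTI; exact: fundamental_lemma_box.
  - move=> _ [ab _ <-]; have [cd _ E] := setI_closed_box (ex_intro2 _ _ ab Logic.I erefl)
      (ex_intro2 _ _ (cube r) Logic.I erefl).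
    rewrite -E; apply: fundamental_lemma_box => //; rewrite E.
    by apply: iE; exact: measurable_box.
  - move=> S mS S0.
    have : (\int[leb]_(x in (S `&` Q) `|` (~` S `&` Q)) (g x)%:E = 0)%E.
      rewrite -setIUl setUv setTI; exact: fundamental_lemma_box.
    rewrite integral_setU//=.
    + by rewrite S0 add0e.
    + exact: measurableI.
    + by apply: measurableI => //; exact: measurableC.
    + by apply: measurable_funTS; exact/measurable_EFinP.
    + rewrite disj_set2E; apply/eqP/seteqP; split => // x [[? _] [? _]]; contradiction.
  - move=> F mF tF F0; rewrite setI_bigcupl integral_bigcup.
    + by rewrite eseries0// => k _ _; exact: F0.
    + by apply: trivIset_setIr.
    + by move=> k; exact: measurableI.
    + rewrite -setI_bigcupl; apply: iE; exact: bigcupT_measurable.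
have := @integral_ae_eq _ _ _ leb Q mQ (cst 0%E) (EFin \o g) ig _ _.
move=> /(_ _ _)[].
- exact: measurable_cst.
- move=> E EQ mE; rewrite integral0 -[RHS](h E mE).
  by congr (integral _ _ _); rewrite setIidl.
move=> N [mN N0 hN]; exists N; split => // x /= nx; apply: hN => /= e.
by apply: nx => Qx; have [] := e Qx.
Qed.

End fundamental_lemma.

(** * Box integrals as elements of the dual Sobolev space *)

Section sobolev_dual.
Context {R : realType} {n m : nat}.
Local Notation leb := (@lebesgue_Rn R n).
Implicit Types (u v : 'rV[R]_n -> 'rV[R]_m) (p : R).

(** Hoelder's inequality against the indicator of the box; [C] is the norm of that indicator for the
    conjugate exponent [r]. *)
Lemma Lp_integrable_box p (ab : 'rV[R]_n * 'rV[R]_n) : 1 < p ->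
  exists2 C : R, 0 <= C & forall u, in_Lp p u ->
    (\int[leb]_(x in box ab) (enorm (u x))%:E <=
      C%:E * (\int[leb]_x (enorm (u x) `^ p)%:E) `^ p^-1)%E.
Proof.
move=> p1; have p0 : 0 < p by rewrite (lt_trans _ p1).
pose r := (1 - p^-1)^-1.
have r0 : 0 < r by rewrite invr_gt0 subr_gt0 invf_lt1.
have mB := measurable_box ab.
have Nr : ('N[leb]_r%:E[EFin \o (\1_(box ab) : _ -> R)] < +oo)%E.
  rewrite unlock /Lnorm; apply: poweR_lty.
  rewrite (eq_integral (EFin \o (\1_(box ab) : _ -> R))); last first.
    move=> x _ /=; rewrite indicE; case: (x \in _) => /=.
      by rewrite normr1 powR1.
    by rewrite normr0 powR0// gt_eqF.
  by rewrite integral_indic// setIT lebesgue_Rn_box_fin.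
exists (fine 'N[leb]_r%:E[EFin \o (\1_(box ab) : _ -> R)]).
  by rewrite fine_ge0// Lnorm_ge0.
move=> u [mu Lu].
have me : measurable_fun setT (fun x => enorm (u x)).
  exact: (measurableT_comp measurable_enorm mu).
have := @hoelder _ _ _ leb (fun x => enorm (u x)) \1_(box ab) p r me
  (measurable_indic mB) p0 r0.
rewrite invrK addrC subrK => /(_ erefl).
rewrite Lnorm1 => h.
have NpE : ('N[leb]_p%:E[EFin \o (fun x => enorm (u x))] =
    (\int[leb]_x (enorm (u x) `^ p)%:E) `^ p^-1)%E.
  rewrite unlock /Lnorm; congr (_ `^ _)%E; apply: eq_integral => x _ /=.
  by rewrite ger0_norm// enorm_ge0.
rewrite -NpE.
rewrite fineK ?ge0_fin_numE ?Lnorm_ge0// muleC.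
have -> : (\int[leb]_(x in box ab) (enorm (u x))%:E =
    \int[leb]_x `|(EFin \o ((fun x => enorm (u x)) \* \1_(box ab))%R) x|)%E.
  rewrite integral_mkcond; apply: eq_integral => x _; rewrite patchE /= indicE.
  by case: ifPn => _ /=; rewrite ?mulr1 ?mulr0 ?normr0// ger0_norm// enorm_ge0.
exact: h.
Qed.

Lemma in_Lp_integrable_box p ab u j : 1 < p -> in_Lp p u ->
  leb.-integrable (box ab) (EFin \o (fun x => u x ord0 j)).
Proof.
move=> p1 Lu; have [C C0 hC] := Lp_integrable_box ab p1.
have mu : measurable_fun setT (fun x => u x ord0 j).
  by apply: (measurableT_comp (measurable_entry _ _)); case: Lu.
apply/integrableP; split; first by apply/measurable_EFinP; exact: measurable_funTS.
apply: (@le_lt_trans _ _ (\int[leb]_(x in box ab) (enorm (u x))%:E)%E).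
  by apply: ge0_le_lower_integral => // x _; rewrite lee_fin le_entry_enorm.
apply: (le_lt_trans (hC u Lu)); rewrite lte_mul_pinfty//.
by apply: poweR_lty; case: Lu.
Qed.

Definition box_functional (ab : 'rV[R]_n * 'rV[R]_n) (j : 'I_m) u : R :=
  (\int[leb]_(x in box ab) u x ord0 j)%R.

Lemma is_dual_box_functional p ab j : 1 < p -> is_dual p (box_functional ab j).
Proof.
move=> p1; have p0 : 0 < p by rewrite (lt_trans _ p1).
have mB := measurable_box ab.
split.
  move=> a u v [Lu _] [Lv _]; rewrite /box_functional.
  have iu := in_Lp_integrable_box ab j p1 Lu.
  have iv := in_Lp_integrable_box ab j p1 Lv.
  rewrite -RintegralZl// -RintegralD//; last first.
    by apply: (integrableZl mB a iu).
  by apply: eq_Rintegral => x _; rewrite !mxE.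
have [C C0 hC] := Lp_integrable_box ab p1; exists C => u [Lu _].
have iu := in_Lp_integrable_box ab j p1 Lu.
rewrite /box_functional EFin_normr_Rintegral//.
apply: (@le_trans _ _ (\int[leb]_(x in box ab) (enorm (u x))%:E)%E).
  apply: (le_trans (le_abse_integral _ mB (measurable_int _ iu))).
  by apply: ge0_le_lower_integral => // x _; rewrite lee_fin le_entry_enorm.
apply: (le_trans (hC u Lu)); rewrite lee_wpmul2l// /W1p_norm.
apply: gt0_ler_poweR.
- by rewrite invr_ge0 ltW.
- by rewrite in_itv/= leey andbT; apply: integral_ge0 => x _; rewrite lee_fin powR_ge0.
- rewrite in_itv/= leey andbT; apply: integral_ge0 => x _.
  by rewrite lee_fin addr_ge0 ?powR_ge0.
apply: ge0_le_lower_integral => x _; rewrite lee_fin ?powR_ge0//.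
by rewrite lerDl powR_ge0.
Qed.

Lemma is_dualZ p c (phi : ('rV[R]_n -> 'rV[R]_m) -> R) :
  is_dual p phi -> is_dual p (fun u => c * phi u).
Proof.
move=> [lin [C hC]]; split.
  by move=> a u v Wu Wv; rewrite lin// mulrDr mulrCA.
exists (`|c| * C) => u Wu; rewrite normrM EFinM EFinM -muleA.
by rewrite lee_wpmul2l ?lee_fin// hC.
Qed.

(** [weak_grad] selects some weak gradient, so for the zero function it is known only through
    uniqueness almost everywhere. The fundamental lemma is applied to each entry on cubes that
    exhaust the space. *)
Lemma is_weak_grad0_ae (G : 'rV[R]_n -> 'M[R]_(n, m)) :
  is_weak_grad (fun=> 0 : 'rV[R]_m) G -> {ae leb, forall x, G x = 0}.
Proof.
move=> [_ [mG iG] hG].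
have : {ae leb, forall x (k : nat) (i : 'I_n) (j : 'I_m),
    box (cube k%:R) x -> G x i j = 0}.
  apply: ae_foralln => k; apply: filter_forall => i; apply: filter_forall => j.
  have mGij : measurable_fun setT (fun x => G x i j).
    exact: (measurableT_comp (measurable_entry _ _) mG).
  apply: fundamental_lemma => //.
    apply/integrableP; split; first by apply/measurable_EFinP; exact: measurable_funTS.
    have [K cK BK] := box_compact (cube (k%:R : R) : 'rV[R]_n * _).
    apply: le_lt_trans (iG K cK).
    apply: (@le_trans _ _ (\int[leb]_(x in box (cube k%:R)) (enorm (G x))%:E)%E).
      by apply: ge0_le_lower_integral => // x _; rewrite lee_fin le_entry_enorm.
    by apply: subset_lower_integral => // x _; rewrite lee_fin enorm_ge0.
  move=> zeta tz; have := hG zeta i j tz.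
  rewrite (_ : (fun x => _) = cst 0); last first.
    by apply/funext => x; rewrite mxE mul0r.
  by rewrite Rintegral_cst// mul0r => /esym/eqP; rewrite oppr_eq0 => /eqP.
apply: filterS => x hx; apply/matrixP => i j; rewrite mxE.
have [k xk] : exists k : nat, `|x| < k%:R.
  by exists (Num.bound `|x|); exact: archi_boundP.
by apply: (hx k); exact: cubeP.
Qed.

Lemma is_weak_grad0 :
  is_weak_grad (fun=> 0 : 'rV[R]_m) (fun=> 0 : 'M[R]_(n, m)).
Proof.
have li a b : @loc_integrable R n a b (fun=> 0).
  split; first exact: measurable_cst.
  by move=> K _; rewrite integral0_eq// => x _; rewrite enorm0.
split => // zeta i j _.
rewrite (_ : (fun x => _) = cst 0); last by apply/funext => x; rewrite mxE mul0r.
rewrite [in RHS](_ : (fun x => _) = cst 0); last first.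
  by apply/funext => x; rewrite mxE mul0r.
by rewrite Rintegral_cst// mul0r oppr0.
Qed.

Lemma W1p0 p : 1 < p -> @W1p R n m p (fun=> 0) /\
  (@W1p_norm R n m p (fun=> 0%R) <= 1)%E.
Proof.
move=> p1; have p0 : p != 0 by rewrite gt_eqF// (lt_trans _ p1).
have L0 a b : @in_Lp R n p a b (fun=> 0).
  split; first exact: measurable_cst.
  by rewrite integral0_eq// => x _; rewrite enorm0 powR0.
split; first by split => //; exists (fun=> 0) => //; exact: is_weak_grad0.
rewrite /W1p_norm.
have : @is_weak_grad R n m (fun=> 0) (weak_grad (fun=> 0)).
  apply: (@getPex _ [set G | @is_weak_grad R n m (fun=> 0) G]).
  by exists (fun=> 0); exact: is_weak_grad0.
move=> /is_weak_grad0_ae[N [mN N0 hN]].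
rewrite (_ : (\int[leb]_x _)%E = 0%E).
  by rewrite poweR0r ?invr_neq0// lee_fin.
apply/eqP; rewrite eq_le integral_ge0 ?andbT; last first.
  by move=> x _; rewrite lee_fin addr_ge0 ?powR_ge0.
rewrite -[leRHS](integral0 leb setT).
apply: (@le_lower_integral_ae _ _ _ _ _ N) => //.
move=> x [_ Nx]; rewrite enorm0 powR0// add0r.
rewrite (_ : weak_grad _ x = 0) ?enorm0 ?powR0//.
by apply: contrapT => /= h; apply: Nx; exact: hN.
Qed.

(** A supremum over an empty unit ball would be minus infinity; the zero function shows that the
    ball is not empty. *)
Lemma dual_norm_ge0 p (phi : ('rV[R]_n -> 'rV[R]_m) -> R) : 1 < p ->
  (0 <= dual_norm p phi)%E.
Proof.
move=> p1; apply: (@le_trans _ _ (`|phi (fun=> 0)|%:E)); first by rewrite lee_fin.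
by apply: ereal_sup_ubound; exists (fun=> 0) => //=; exact: W1p0.
Qed.

Lemma dual_norm0 p : 1 < p ->
  @dual_norm R n m p (fun=> 0) = 0%E.
Proof.
move=> p1; apply/eqP; rewrite eq_le dual_norm_ge0// andbT.
by apply: ge_ereal_sup => _ [u _ <-]; rewrite normr0.
Qed.

Lemma dual_norm_fin p (phi : ('rV[R]_n -> 'rV[R]_m) -> R) : is_dual p phi ->
  exists2 C : R, 0 <= C & (dual_norm p phi <= C%:E)%E.
Proof.
move=> [_ [C hC]]; exists `|C| => //.
apply: ge_ereal_sup => _ [u [Wu nu] <-]; apply: (le_trans (hC u Wu)).
have n0 : (0 <= W1p_norm p u)%E by exact: poweR_ge0.
apply: (@le_trans _ _ (`|C|%:E * W1p_norm p u)%E).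
  by rewrite lee_wpmul2r// lee_fin ler_norm.
by rewrite -[leRHS]mule1 lee_wpmul2l.
Qed.

End sobolev_dual.

(** * The test functionals in time and space *)

Section box_test_functional.
Context {R : realType} {n m : nat}.
Local Notation leb := (@lebesgue_Rn R n).

(** The usual quotient [A / (A + B)] of flat functions of the squared Euclidean norm [s]: [A]
    vanishes where [s >= a], [B] where [s <= b], and [b < a] keeps the denominator positive. *)
Lemma exists_cutoff (r : R) :
  exists2 chi : 'rV[R]_n -> R, cutoff [set z | `|z| < r] chi &
    forall z, `|z| < r -> chi z = 1.
Proof.
pose s (z : 'rV[R]_n) := \sum_j z ord0 j * z ord0 j.
have sE z : s z = enorm z ^+ 2.
  rewrite sqr_enorm /s big_ord1; apply: eq_bigr => j _; by rewrite expr2.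
have hs : smooth_gen s.
  apply: smooth_gen_sum => j.
  by apply: smooth_gen_mul; exact: smooth_gen_coord.
(* [b] exceeds [s] on the closed sup-norm ball of radius [r], by comparison of the two norms; the
   gap 1 between [b] and [a] separates the plateau from the zero set. *)
pose b := ((1 * n)%:R * r) ^+ 2 + 1; pose a := b + 1.
have a0 : 0 < a by rewrite /a /b ltr_wpDl// addr_ge0// sqr_ge0.
have hb z : `|z| <= r -> s z < b.
  move=> zr; rewrite sE /b ltr_pwDr// lerXn2r// ?nnegrE ?enorm_ge0//.
    by rewrite mulr_ge0// (le_trans _ zr).
  by rewrite (le_trans (le_enorm_norm _))// ler_wpM2l.
have d0 z : 0 < flat_exp 0 (a - s z) + flat_exp 0 (s z - b).
  have [sa|sa] := ltP (s z) a.
    by rewrite ltr_pwDl ?flat_exp_ge0// flat_exp_gt0 subr_gt0.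
  rewrite ltr_wpDl ?flat_exp_ge0// flat_exp_gt0 subr_gt0.
  by rewrite (lt_le_trans _ sa)// /a ltrDl.
pose chi z := flat_exp 0 (a - s z) * (flat_exp 0 (a - s z) + flat_exp 0 (s z - b))^-1.
have chi1 z : s z < b -> chi z = 1.
  move=> sb; rewrite /chi (flat_exp_eq0 _ (x := s z - b)); last by rewrite subr_le0 ltW.
  by rewrite addr0 divff// gt_eqF// flat_exp_gt0 subr_gt0 (lt_trans sb)// /a ltrDl.
have ha : smooth_gen (fun z => flat_exp 0 (a - s z)).
  by apply: smooth_gen_flat; apply: smooth_gen_sub => //; exact: smooth_gen_cst.
exists chi; last by move=> z /ltW/hb/chi1.
split; last first.
  exists [set z | s z < b]; split => //.
    have cs : continuous s by exact: continuous_smooth_gen.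
    apply: (@open_comp _ _ s [set x | x < b]); last exact: open_lt.
    by move=> z _; exact: cs.
  move=> z zr; apply: hb; move: z zr.
  have /closure_id E : closed [set z : 'rV[R]_n | `|z| <= r].
    apply: compact_closed; last exact: compact_norm_le.
    exact: (@norm_hausdorff R 'rV[R]_n).
  rewrite -/([set z : 'rV[R]_n | `|z| <= r]).
  suff : closure [set z : 'rV[R]_n | `|z| < r] `<=` [set z | `|z| <= r] by [].
  by rewrite E; apply: closure_subset => z /= /ltW.
apply: (@smooth_gen_test_function _ _ _ (a + 1)).
  apply: smooth_gen_mul => //; apply: smooth_gen_inv.
    apply: smooth_gen_add => //.
    by apply: smooth_gen_flat; apply: smooth_gen_sub => //; exact: smooth_gen_cst.
  by move=> z; rewrite gt_eqF.
move=> z za; rewrite /chi flat_exp_eq0 ?mul0r// subr_le0 sE.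
have h : a + 1 <= enorm z by rewrite (le_trans (ltW za))// le_norm_enorm.
by nra.
Qed.

(** A field supported off the closed ball vanishes on the box, so the complement of the ball is one
    of the open sets removed from the support. *)
Lemma dual_supp_box_functional (c : R) (ab : 'rV[R]_n * 'rV[R]_n) (j : 'I_m) :
  compact (dual_supp (fun u => c * box_functional ab j u)) /\
  dual_supp (fun u => c * box_functional ab j u) `<=`
    [set z | `|z| <= `|ab.1| + `|ab.2|].
Proof.
set S := dual_supp _.
have clS : closed S.
  by rewrite /S /dual_supp closedC; apply: bigcup_open => U [].
have clB : closed [set z : 'rV[R]_n | `|z| <= `|ab.1| + `|ab.2|].
  apply: compact_closed; last exact: compact_norm_le.
  exact: (@norm_hausdorff R 'rV[R]_n).
have sub : S `<=` [set z | `|z| <= `|ab.1| + `|ab.2|].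
  rewrite /S /dual_supp => z hz; apply: contrapT => /= zn; apply: hz.
  exists (~` [set z : 'rV[R]_n | `|z| <= `|ab.1| + `|ab.2|]) => //; split.
    by rewrite openC.
  move=> u _ hu; rewrite /box_functional (_ : Rintegral _ _ _ = 0) ?mulr0//.
  rewrite /Rintegral integral0_eq// => x /norm_box xab.
  have [->|ux] := eqVneq (u x) 0; first by rewrite mxE.
  by exfalso; apply: (hu x) xab; exact: subset_closure.
by split => //; apply: (subclosed_compact clS _ sub); exact: compact_norm_le.
Qed.

(** The value [q = 1] is allowed; the time norm of the test functionals is then an essential
    supremum instead of a power integral. *)
Lemma hoelder_conjugate_cases (q : R) : 1 <= q ->
  hoelder_conjugate q%:E = +oo%E \/
  exists2 r : R, 0 < r & hoelder_conjugate q%:E = r%:E.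
Proof.
move=> q1; rewrite /hoelder_conjugate /= eqe gt_eqF ?(lt_le_trans _ q1)//.
have [->|qn1] := eqVneq q 1.
  by left; rewrite -EFinB subrr inve0 mul1e.
right; exists (q / (q - 1)).
  by rewrite divr_gt0 ?(lt_le_trans _ q1)// subr_gt0 lt_neqAle eq_sym qn1.
by rewrite -EFinB inver subr_eq0 (negbTE qn1) -EFinM.
Qed.

(** The map is simple, hence its own strong approximation. Its dual norm is bounded on a bounded
    time interval, which settles finite and infinite exponents alike. *)
Lemma bochner_box_functional (p q T : R) (A : set (time R))
    (ab : 'rV[R]_n * 'rV[R]_n) (j : 'I_m) : 1 < p -> 1 <= q -> measurable A ->
  bochner_Lp p (hoelder_conjugate q%:E) T
    (fun t u => \1_A t * box_functional ab j u).
Proof.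
move=> p1 q1 mA; have dB := is_dual_box_functional ab j p1.
split.
- by move=> t _; exact: is_dualZ.
- exists (fun=> fun t u => \1_A t * box_functional ab j u).
    move=> _; exists 1%N, (fun=> A), (fun=> box_functional ab j).
    by split => // t u; rewrite big_ord1.
  apply: aeW => t _.
  rewrite (_ : (fun k => _) = cst 0%E); first exact: cvg_cst.
  apply/funext => k; rewrite -[RHS](@dual_norm0 R n m p p1).
  by congr dual_norm; apply/funext => u; rewrite subrr.
- have [C C0 hC] := dual_norm_fin dB.
  set F := (X in Lnorm _ _ X).
  have dN (t : time R) :
      (dual_norm p (fun u => (\1_A t * box_functional ab j u)%R) <= C%:E)%E.
    rewrite indicE; case: (t \in A) => /=.
      by rewrite (_ : (fun u => _) = box_functional ab j)//; apply/funext => u; rewrite mul1r.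
    rewrite (_ : (fun u => _) = (fun=> 0)) ?dual_norm0//.
    by apply/funext => u; rewrite mul0r.
  have FC t : (`|F t| <= (C * \1_(`[0, T]) t)%:E)%E.
    rewrite indicE /F patchE; case: (_ \in _) => /=.
      by rewrite mulr1 gee0_abs ?dual_norm_ge0.
    by rewrite mulr0 normr0.
  have FC' t : (`|F t| <= C%:E)%E.
    by rewrite (le_trans (FC t))// lee_fin ler_piMr// indicE lern1 leq_b1.
  have [->|[r r0 ->]] := hoelder_conjugate_cases q1; rewrite unlock.
    case: ifPn => // _; rewrite (@le_lt_trans _ _ C%:E) ?ltry//.
    by apply/ess_sup_inf.ess_supP; exact: aeW.
  apply: poweR_lty.
  have mI : measurable (`[0, T]%classic : set (time R)).
    exact: sub_caratheodory.
  have h : (\int[dt]_(t in `[0%R, T]%classic) (C `^ r)%:E < +oo :> \bar R)%E.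
    rewrite integral_cst// lte_mul_pinfty ?lee_fin ?powR_ge0//.
    rewrite -[X in (X < _)%E]/(lebesgue_measure (`[0, T]%classic)).
    by rewrite lebesgue_measure_itv/=; case: ifP => // _; rewrite -EFinB ltry.

  apply: le_lt_trans h; rewrite [leRHS]integral_mkcond.
  apply: ge0_le_lower_integral => t _; first exact: poweR_ge0.
  have := FC t; rewrite indicE patchE; case: (_ \in _) => /=; last first.
    rewrite mulr0 => h; rewrite (_ : `|F t|%E = 0%E) ?poweR0r ?gt_eqF//.
    by apply/eqP; rewrite eq_le h abse_ge0.
  rewrite mulr1 => h; rewrite -poweR_EFin.
  by apply: gt0_ler_poweR => //; rewrite ?(ltW r0)// ?in_itv/= ?leey ?andbT// lee_fin.
Qed.

End box_test_functional.

(** * Local weak convergence tested on boxes *)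

Section local_weak_cvg_box.
Context {R : realType} {n m : nat}.
Local Notation leb := (@lebesgue_Rn R n).

Lemma local_weak_cvg_box (p q T : R) (fs : nat -> R -> 'rV[R]_n -> 'rV[R]_m)
    f (A : set (time R)) ab j : 1 < p -> 1 <= q -> measurable A ->
  local_weak_cvg p q T fs f ->
  (\int[dt]_(t in (`[0, T] : set (time R)))
    (\1_A t * \int[leb]_(x in box ab) (fs k t x - f t x) ord0 j))%R
     @[k --> \oo] --> 0.
Proof.
move=> p1 q1 mA fsf.
(* The extra 1 puts the support of the functional inside the open ball; the cutoff is 1 on this
   ball, so it disappears from the box integral. *)
pose r := `|ab.1| + `|ab.2| + 1.
have [chi [tchi [V [oV sV V1]]] chi1] := @exists_cutoff R n r.
have bd := bochner_box_functional T ab j p1 q1 mA.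
have clr : closure [set z : 'rV[R]_n | `|z| < r] `<=` [set z | `|z| <= r].
  have /closure_id E : closed [set z : 'rV[R]_n | `|z| <= r].
    apply: compact_closed; last exact: compact_norm_le.
    exact: (@norm_hausdorff R 'rV[R]_n).
  by rewrite E; apply: closure_subset => z /= /ltW.
have h1 : compact (closure [set z : 'rV[R]_n | `|z| < r]).
  exact: (subclosed_compact (@closed_closure _ _) (@compact_norm_le R n r) clr).
have h2 t : t \in `[0, T] ->
    compact (dual_supp (fun u : 'rV[R]_n -> 'rV[R]_m => \1_A t * box_functional ab j u)) /\
    dual_supp (fun u : 'rV[R]_n -> 'rV[R]_m => \1_A t * box_functional ab j u)
    `<=` [set z | `|z| < r]°.
  move=> _; have [cS sS] := dual_supp_box_functional (\1_A t) ab j.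
  split => //.
  suff /interior_id -> : open [set z : 'rV[R]_n | `|z| < r].
    by move=> z /sS /= h; rewrite (le_lt_trans h)// /r ltrDl.
  apply: (@open_comp _ _ (fun z : 'rV[R]_n => `|z|) [set x | x < r]).
    by move=> z _; exact: norm_continuous.
  exact: open_lt.
have h3 : cutoff [set z | `|z| < r] chi by split => //; exists V.
apply: cvg_trans (fsf _ _ _ bd h1 h2 h3); apply: near_eq_cvg; apply: nearW => k.
apply: eq_Rintegral => t _; congr (_ * _).
apply: eq_Rintegral => x /set_mem /norm_box xab.
by rewrite chi1 ?scale1r// (le_lt_trans xab)// /r ltrDl.
Qed.

End local_weak_cvg_box.

(** * A convex function as a countable supremum of affine functions *)

Section convex_minorants.
Context {R : realType} {d : nat}.
Implicit Types (u v y c : 'rV[R]_d).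

Definition dotp u v : R := \sum_i u ord0 i * v ord0 i.

Lemma dotpp u : dotp u u = enorm u ^+ 2.
Proof. by rewrite sqr_enorm big_ord1; apply: eq_bigr => i _; rewrite expr2. Qed.

Lemma dotpp_ge0 u : 0 <= dotp u u.
Proof. by rewrite dotpp sqr_ge0. Qed.

Lemma dotpDr u v y : dotp u (v + y) = dotp u v + dotp u y.
Proof.
by rewrite -big_split; apply: eq_bigr => i _; rewrite mxE mulrDr.
Qed.

Lemma dotpZr (s : R) u v : dotp u (s *: v) = s * dotp u v.
Proof. by rewrite mulr_sumr; apply: eq_bigr => i _; rewrite mxE mulrCA. Qed.

Lemma dotpC u v : dotp u v = dotp v u.
Proof. by apply: eq_bigr => i _; rewrite mulrC. Qed.

Lemma dotpDD (s : R) u v :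
  dotp (u + s *: v) (u + s *: v) = dotp u u + 2 * s * dotp u v + s ^+ 2 * dotp v v.
Proof.
rewrite dotpDr [dotp (u + s *: v) u]dotpC [dotp _ (s *: v)]dotpZr.
by rewrite [dotp _ v]dotpC !dotpDr !dotpZr [dotp v u]dotpC; ring.
Qed.

Lemma continuous_dotpB c : continuous (fun y => dotp (y - c) (y - c)).
Proof.
pose s (y : 'rV[R]_d) := \sum_j (y ord0 j - c ord0 j) * (y ord0 j - c ord0 j).
have hs : smooth_gen s.
  apply: smooth_gen_sum => j.
  by apply: smooth_gen_mul; apply: smooth_gen_sub;
    by [exact: smooth_gen_coord|exact: smooth_gen_cst].
rewrite (_ : (fun y => _) = s); first exact: continuous_smooth_gen.
by apply/funext => y; apply: eq_bigr => j _; rewrite !mxE.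
Qed.

Variable psi : 'rV[R]_d -> R.
Hypothesis psi0 : forall y, 0 <= psi y.
Hypothesis cpsi : continuous psi.
Hypothesis convex_psi : forall (s : R) x y, 0 <= s -> s <= 1 ->
  psi (x + s *: (y - x)) <= (1 - s) * psi x + s * psi y.

(* A minimiser [y] of the Moreau regularisation [psi + lambda |. - c|^2] is a
   point where [2 lambda (c - y)] is a subgradient of [psi]. *)
Lemma exists_subgradient_near (lambda : R) c : 0 < lambda ->
  exists2 y, lambda * dotp (c - y) (c - y) <= psi c &
    forall z, psi y + 2 * lambda * dotp (c - y) (z - y) <= psi z.
Proof.
move=> l0; pose g y := psi y + lambda * dotp (y - c) (y - c).
have cg : continuous g.
  move=> y; apply: (@continuousD _ _ _ psi
    (fun y => lambda * dotp (y - c) (y - c)) y (@cpsi y)).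
  apply: (@continuousM _ _ (fun=> lambda) (fun y => dotp (y - c) (y - c))).
    exact: cst_continuous.
  exact: continuous_dotpB.
(* Beyond distance [r >= 1] from [c] the quadratic penalty alone is at least [lambda * r], above
   [psi c = g c]; a minimiser over the ball is therefore global. *)
pose r := psi c / lambda + 1.
have r0 : 0 < r by rewrite ltr_wpDl// divr_ge0// ltW.
have cK := @compact_norm_le R d (`|c| + r).
have [y /= yK ymin] := @EVT_min_rV R d g [set z | `|z| <= `|c| + r]
  (ex_intro _ c (ler_wpDr (ltW r0) (lexx _))) cK (continuous_subspaceT cg).
have gc : g c = psi c.
  by rewrite /g subrr /dotp big1 ?mulr0 ?addr0// => i _; rewrite mxE mul0r.
have gmin z : g y <= g z.
  have [zr|zr] := leP `|z| (`|c| + r).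
    by apply: ymin; rewrite inE.
  apply: (@le_trans _ _ (g c)).
    by apply: ymin; rewrite inE /= lerDl ltW.
  rewrite gc /g ler_wpDl//.
  have h1 : r <= enorm (z - c).
    by rewrite (le_trans _ (le_norm_enorm _))//; have := lerB_dist z c; lra.
  rewrite dotpp -ler_pdivrMl// mulrC.
  have h2 : 1 <= r by rewrite lerDr divr_ge0// ltW.
  rewrite (@le_trans _ _ r)// ?lerDl//.
  by rewrite (le_trans h1)// expr2 ler_peMl ?enorm_ge0// (le_trans h2).
have symc z : dotp (z - c) (z - c) = dotp (c - z) (c - z).
  by apply: eq_bigr => i _; rewrite !mxE; ring.
exists y.
  by rewrite -symc -gc (le_trans _ (gmin c))// lerDr.
move=> z; apply/ler_addgt0Pr => e e0.
set h := z - y; set D := dotp (c - y) h.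
(* The step [s] makes the second-order term at most [e]. Minimality of [y] against [y + s *: h] and
   convexity, divided by [s], then give the subgradient inequality up to [e]. *)
have [s /andP[s0 s1] sQ] : exists2 s : R, 0 < s <= 1 & lambda * s * dotp h h <= e.
  have Q0 := dotpp_ge0 h.
  have t0 : 0 < e / (lambda * dotp h h + 1).
    by rewrite divr_gt0// ltr_wpDl// mulr_ge0// ltW.
  exists (Num.min 1 (e / (lambda * dotp h h + 1))).
    by rewrite lt_min ltr01 t0 ge_min lexx.
  rewrite mulrAC; apply: (@le_trans _ _ (lambda * dotp h h * (e / (lambda * dotp h h + 1)))).
    by rewrite ler_wpM2l ?mulr_ge0 ?(ltW l0)// ge_min lexx orbT.
  rewrite mulrA ler_pdivrMr; last by rewrite ltr_wpDl// mulr_ge0// ltW.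
  by rewrite mulrC ler_wpM2l ?lerDl// ltW.
have := gmin (y + s *: h); rewrite /g.
have -> : y + s *: h - c = (y - c) + s *: h by rewrite addrAC.
rewrite dotpDD.
have -> : dotp (y - c) h = - D.
  by rewrite /D /dotp -sumrN; apply: eq_bigr => i _; rewrite !mxE; ring.
have := convex_psi y z (ltW s0) s1; rewrite -/h => c1 c2.
have c3 : s * (psi y + 2 * lambda * D - psi z) <= s * (lambda * s * dotp h h) by nra.
by rewrite ler_pM2l// in c3; lra.
Qed.

(** The supporting affine functions are taken at minimisers for rational centres and integer
    parameters. As [psi] is nonnegative at the minimiser, a large parameter forces it close to its
    centre, so these countably many functions come within any [e] of [psi]. *)
Lemma countable_affine_minorants :
  exists P : nat -> 'rV[R]_d * R,
    (forall k y, dotp (P k).1 y + (P k).2 <= psi y) /\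
    forall y e, 0 < e -> exists k, psi y - e < dotp (P k).1 y + (P k).2.
Proof.
have l0 k : 0 < k.+1%:R :> R by rewrite ltr0n.
pose rc (i : {ffun 'I_d -> rat} * nat) : 'rV[R]_d := \row_j ratr (i.1 j).
have ex i : exists y : 'rV[R]_d,
    i.2.+1%:R * dotp (rc i - y) (rc i - y) <= psi (rc i) /\
    forall z, psi y + 2 * i.2.+1%:R * dotp (rc i - y) (z - y) <= psi z.
  by have [y h1 h2] := exists_subgradient_near (rc i) (l0 i.2); exists y.
have /choice[Y hY] := ex.
pose A i : 'rV[R]_d * R := ((2 * i.2.+1%:R) *: (rc i - Y i),
  psi (Y i) - 2 * i.2.+1%:R * dotp (rc i - Y i) (Y i)).
have AE i z : dotp (A i).1 z + (A i).2 =
    psi (Y i) + 2 * i.2.+1%:R * dotp (rc i - Y i) (z - Y i).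
  rewrite /A /= [dotp (_ *: _) _]dotpC dotpZr [dotp z _]dotpC.
  have -> : dotp (rc i - Y i) (z - Y i) = dotp (rc i - Y i) z - dotp (rc i - Y i) (Y i).
    by rewrite -[- Y i]scaleN1r dotpDr dotpZr mulN1r.
  by ring.
(* Numbers that code no index fall back to centre 0 and parameter 1, which also gives a minorant. *)
exists (fun k => A (odflt ([ffun=> 0], 0%N) (unpickle k))); split.
  by move=> k y; rewrite AE; have [_] := hY (odflt ([ffun=> 0], 0%N) (unpickle k)); exact.
move=> y e e0.
have /cvgrPdist_lt /(_ (e / 2)) := @cpsi y; rewrite divr_gt0// => /(_ isT).
move=> /nbhs_ballP[dl /= dl0 hdl].
have psie : 0 < psi y + e by rewrite ltr_wpDl.
(* The parameter [k.+1] is fixed first, large enough to bring the minimiser within [dl / 2] of any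
   centre where [psi] is below [psi y + e]. *)
pose k := Num.bound ((psi y + e) / (dl / 2) ^+ 2).
have hk : (psi y + e) < k.+1%:R * (dl / 2) ^+ 2.
  rewrite -ltr_pdivrMr ?exprn_gt0 ?divr_gt0//.
  rewrite (lt_trans (archi_boundP _))// ?ltr_nat//.
  by rewrite divr_ge0 ?sqr_ge0// ltW.
(* The centre is chosen after the parameter: the last bound on [eta] gives
   [k.+1 * |y - c|^2 <= e / 2], and the bound 1 lets [eta] majorise its own square. *)
pose eta := Num.min (dl / 2) (Num.min 1 (e / (2 * k.+1%:R * (d%:R + 1)^+2))).
have eta0 : 0 < eta.
  by rewrite /eta !lt_min divr_gt0//= ltr01 /= divr_gt0// mulr_gt0 ?mulr_gt0.
have exc j : exists q : rat, y ord0 j - eta < ratr q < y ord0 j + eta.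
  have h : y ord0 j - eta < y ord0 j + eta by rewrite ltrBlDr -addrA ltrDl addr_gt0.
  by have [q] := rat_in_itvoo h; rewrite in_itv/=; exists q.
have /choice[cq hcq] := exc.
pose i : {ffun 'I_d -> rat} * nat := ([ffun j => cq j], k).
exists (pickle i); rewrite pickleK AE [odflt _ _]/=.
set c := rc i; set ys := Y i.
have cy : `|c - y| <= eta.
  rewrite [leLHS]/Num.norm/= mx_normrE; apply/bigmax_leP; split => [|[i' j] _].
    exact: ltW.
  rewrite ord1 /= !mxE ffunE ler_norml; have /andP[h1 h2] := hcq j.
  by apply/andP; split; lra.
have [h1 h2] := hY i; rewrite -/c -/ys /= in h1 h2.
have pc : psi c < psi y + e.
  have : `|psi y - psi c| < e / 2.
    apply: hdl; rewrite -ball_normE /= distrC (le_lt_trans cy)//.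
    by rewrite gt_min ltr_pdivrMr// ltr_pMr// ltrDl ltr01.
  by rewrite ltr_norml => /andP[]; lra.
have ysc : `|ys - c| < dl / 2.
  rewrite distrC (le_lt_trans (le_norm_enorm _))// ltNge; apply/negP => h.
  have h3 : (dl / 2) ^+ 2 <= dotp (c - ys) (c - ys).
    by rewrite dotpp lerXn2r// ?nnegrE ?enorm_ge0// divr_ge0// ltW.
  have h4 : k.+1%:R * (dl / 2) ^+ 2 <= k.+1%:R * dotp (c - ys) (c - ys) by rewrite ler_pM2l.
  by move: (lt_le_trans hk h4); rewrite ltNge (le_trans h1)// ltW.
have pys : psi y - e / 2 < psi ys.
  have : `|psi y - psi ys| < e / 2.
    apply: hdl; rewrite -ball_normE /= (splitr dl).
    rewrite (le_lt_trans (ler_distD c _ _))// ler_ltD// distrC//.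
    by rewrite (le_trans cy)// ge_min lexx.
  by rewrite ltr_norml => /andP[]; lra.
have hw : k.+1%:R * dotp (y - c) (y - c) <= e / 2.
  have w1 : enorm (y - c) <= (d%:R + 1) * eta.
    rewrite (le_trans (le_enorm_norm _))// mul1n ler_pM//.
      by rewrite lerDl.
    by rewrite distrC.
  have w2 : dotp (y - c) (y - c) <= (d%:R + 1) ^+ 2 * eta.
    rewrite dotpp (@le_trans _ _ (((d%:R + 1) * eta) ^+ 2))//.
      by rewrite lerXn2r// nnegrE ?enorm_ge0// mulr_ge0 ?ltW// addr_ge0.
    rewrite exprMn ler_wpM2l ?sqr_ge0// expr2 ler_piMr ?(ltW eta0)//.
    by rewrite !ge_min lexx orbT.
  apply: (@le_trans _ _ (k.+1%:R * ((d%:R + 1) ^+ 2 * eta))).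
    by rewrite ler_wpM2l.
  have w3 : eta <= e / (2 * k.+1%:R * (d%:R + 1) ^+ 2).
    by rewrite !ge_min lexx !orbT.
  apply: (@le_trans _ _ (k.+1%:R * ((d%:R + 1) ^+ 2 * (e / (2 * k.+1%:R * (d%:R + 1) ^+ 2))))).
    by rewrite !ler_wpM2l ?sqr_ge0.
  rewrite le_eqVlt; apply/orP; left; apply/eqP; field.
  by rewrite !gt_eqF ?ltr_wpDl.
(* Half the square of [(y - c) + 2 (c - ys)]. It shows that the linear term lowers the affine
   function at [y] by at most [k.+1 * |y - c|^2 / 2]. *)
have q0 : 0 <= 2 * dotp (c - ys) (c - ys) + 2 * dotp (c - ys) (y - c)
    + dotp (y - c) (y - c) / 2.
  have := dotpp_ge0 ((y - c) + 2 *: (c - ys)); rewrite dotpDD [dotp (y - c) (c - ys)]dotpC.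
  by lra.
have -> : y - ys = (c - ys) + (y - c) by rewrite [RHS]addrC addrA subrK.
rewrite dotpDr.
have := mulr_ge0 (ltW (l0 k)) q0.
by lra.
Qed.

End convex_minorants.

Lemma cvg_bigsum {R : realType} (I : Type) (s : seq I) (u : I -> nat -> R) (l : I -> R) :
  (forall i, u i @ \oo --> l i) ->
  \sum_(i <- s) u i k @[k --> \oo] --> \sum_(i <- s) l i.
Proof.
move=> ul; elim: s => [|i s IH].
  by rewrite big_nil; under eq_fun do rewrite big_nil; exact: cvg_cst.
by rewrite big_cons; under eq_fun do rewrite big_cons; exact: cvgD.
Qed.

(** * Weak lower semicontinuity with weights *)

Section weak_lower_semicontinuity.
Context d0 (X : measurableType d0) (R : realType) (d : nat).
Variable m : {measure set X -> \bar R}.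
Variable D : set X.
Hypotheses (mD : measurable D) (mDfin : (m D < +oo)%E).
Variables (a_ : nat -> X -> 'rV[R]_d) (a : X -> 'rV[R]_d).
Hypothesis ma_ : forall k i, measurable_fun setT (fun x => a_ k x ord0 i).
Hypothesis ma : forall i, measurable_fun setT (fun x => a x ord0 i).
Hypothesis ia_ : forall k i, m.-integrable D (EFin \o (fun x => a_ k x ord0 i)).
Hypothesis ia : forall i, m.-integrable D (EFin \o (fun x => a x ord0 i)).
Hypothesis cvg_a : forall A i, measurable A -> A `<=` D ->
  (\int[m]_(x in A) a_ k x ord0 i)%R @[k --> \oo] --> (\int[m]_(x in A) a x ord0 i)%R.

Let integrable_affine (b : X -> 'rV[R]_d) (P : 'rV[R]_d * R) (A : set X) :
  measurable A -> A `<=` D ->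
  (forall i, m.-integrable D (EFin \o (fun x => b x ord0 i))) ->
  m.-integrable A (EFin \o (fun x => dotp P.1 (b x) + P.2)) /\
  (\int[m]_(x in A) (dotp P.1 (b x) + P.2) =
   \sum_i P.1 ord0 i * (\int[m]_(x in A) b x ord0 i) + P.2 * fine (m A))%R.
Proof.
move=> mA AD ib.
have mAfin : (m A < +oo)%E by apply: le_lt_trans mDfin; apply: le_measure; rewrite ?inE.
have ibA i : m.-integrable A (EFin \o (fun x => b x ord0 i)).
  exact: (integrableS mD mA AD).
have [is1 es1] : m.-integrable A (EFin \o (fun x => dotp P.1 (b x))) /\
    (\int[m]_(x in A) dotp P.1 (b x) =
      \sum_i P.1 ord0 i * (\int[m]_(x in A) b x ord0 i))%R.
  rewrite /dotp; elim: (index_enum _) => [|i s [IH1 IH2]].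
    rewrite (_ : (fun x => _) = cst 0); last by apply/funext => x; rewrite big_nil.
    rewrite big_nil Rintegral_cst// mul0r; split => //.
    by apply: measurable_bounded_integrable => //; exact: bounded_cst.
  have i1 : m.-integrable A (EFin \o (fun x => P.1 ord0 i * b x ord0 i)).
    exact: (integrableZl mA _ (ibA i)).
  have E : (fun x => \sum_(j <- i :: s) P.1 ord0 j * b x ord0 j) =
      (fun x => P.1 ord0 i * b x ord0 i + \sum_(j <- s) P.1 ord0 j * b x ord0 j).
    by apply/funext => x; rewrite big_cons.
  split; first by rewrite E; exact: (integrableD mA i1 IH1).
  by rewrite E RintegralD// IH2 big_cons RintegralZl.
have ic : m.-integrable A (EFin \o cst P.2).
  by apply: measurable_bounded_integrable => //; exact: bounded_cst.
split; first exact: (integrableD mA is1 ic).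
by rewrite RintegralD// es1 Rintegral_cst.
Qed.

Variable psi : 'rV[R]_d -> R.
Hypothesis psi0 : forall y, 0 <= psi y.
Hypothesis cpsi : continuous psi.
Variable P : nat -> 'rV[R]_d * R.
Hypothesis P_le : forall k y, dotp (P k).1 y + (P k).2 <= psi y.
Hypothesis P_sup : forall y e, 0 < e ->
  exists k, psi y - e < dotp (P k).1 y + (P k).2.

(** Starting the maximum at 0 keeps it nonnegative, as monotone convergence requires, and still
    below the nonnegative [psi]. *)
Fixpoint max_affine (N : nat) (y : 'rV[R]_d) : R :=
  if N is N'.+1 then Num.max (max_affine N' y) (dotp (P N').1 y + (P N').2) else 0.

Let max_affine_ge0 N y : 0 <= max_affine N y.
Proof. by elim: N => //= N IH; rewrite le_max IH. Qed.

Let max_affine_homo y : nondecreasing_seq (max_affine ^~ y).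
Proof. by apply/nondecreasing_seqP => N /=; rewrite le_max lexx. Qed.

Let max_affine_cvg y : max_affine ^~ y @ \oo --> psi y.
Proof.
have le N : max_affine N y <= psi y.
  by elim: N => //= N IH; rewrite ge_max IH P_le.
apply/cvgrPdist_le => e e0; have [k hk] := P_sup y e0.
exists k.+1 => // N /= kN; rewrite ger0_norm ?subr_ge0//.
have : dotp (P k).1 y + (P k).2 <= max_affine N y.
  apply: le_trans (max_affine_homo y kN).
  by rewrite /= le_max lexx orbT.
by lra.
Qed.

Let measurable_affine (b : X -> 'rV[R]_d) Q :
  (forall i, measurable_fun setT (fun x => b x ord0 i)) ->
  measurable_fun setT (fun x => dotp Q.1 (b x) + Q.2).
Proof.
move=> mb; apply: measurable_funD; last exact: measurable_cst.
by apply: measurable_sum => i; apply: measurable_funM => //; exact: measurable_cst.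
Qed.

Let measurable_max_affine N : measurable_fun setT (fun x => max_affine N (a x)).
Proof.
elim: N => [|N IH] /=; first exact: measurable_cst.
by apply: measurable_maxr => //; exact: measurable_affine.
Qed.

Let measurable_psi (b : X -> 'rV[R]_d) :
  (forall i, measurable_fun setT (fun x => b x ord0 i)) ->
  measurable_fun setT (fun x => psi (b x)).
Proof.
move=> mb; apply: (measurableT_comp (continuous_measurable_mx cpsi)).
exact: measurable_rV.
Qed.

(** Induction on [N]: [A] is split by whether the new affine function exceeds the previous maximum
    at the limit [a]. Where it does, affine integrals converge; on the rest the induction hypothesis
    applies, hence the quantification over [A]. The pieces depend on [a] alone, so they stay fixed
    as [k] varies. *)
Let max_affine_lsc N (A : set X) (e : R) : measurable A -> A `<=` D -> 0 < e ->
  \forall k \near \oo, (\int[m]_(x in A) (max_affine N (a x))%:E <=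
    \int[m]_(x in A) (psi (a_ k x))%:E + e%:E)%E.
Proof.
elim: N A e => [|N IH] A e mA AD e0.
  apply: nearW => k; rewrite integral0 adde_ge0 ?lee_fin ?(ltW e0)//.
  by apply: integral_ge0 => x _; rewrite lee_fin.
have e20 : 0 < e / 2 by rewrite divr_gt0.
pose l y := dotp (P N).1 y + (P N).2.
pose B := [set x | l (a x) <= max_affine N (a x)].
have mB : measurable B.
  rewrite -[B]setTI; apply: measurable_fun_ler => //.
  exact: measurable_affine.
have mAB : measurable (A `&` B) by exact: measurableI.
have mAnB : measurable (A `&` ~` B) by apply: measurableI => //; exact: measurableC.
have ABU : A = (A `&` B) `|` (A `&` ~` B) by rewrite -setIUr setUv setIT.
have dAB : [disjoint A `&` B & A `&` ~` B].
  by rewrite disj_set2E; apply/eqP/seteqP; split => // x [[_ ?] [_ ?]]; contradiction.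
have subAnB : A `&` ~` B `<=` D by move=> x [/AD].
have [ila Ela] := integrable_affine (P N) mAnB subAnB ia.
have hl : \forall k \near \oo, (\int[m]_(x in A `&` ~` B) (l (a x))%:E <=
    \int[m]_(x in A `&` ~` B) (psi (a_ k x))%:E + (e / 2)%:E)%E.
  have cl : (\int[m]_(x in A `&` ~` B) l (a_ k x))%R @[k --> \oo] -->
      (\int[m]_(x in A `&` ~` B) l (a x))%R.
    rewrite Ela; under eq_fun do rewrite (integrable_affine (P N) mAnB subAnB (ia_ _)).2.
    apply: cvgD; last exact: cvg_cst.
    apply: cvg_bigsum => i; apply: cvgM; first exact: cvg_cst.
    exact: cvg_a.
  have /cvgrPdist_le /(_ _ e20) := cl; apply: filterS => k.
  rewrite ler_norml => /andP[_ h].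
  have [ilk _] := integrable_affine (P N) mAnB subAnB (ia_ k).
  apply: (@le_trans _ _ ((\int[m]_(x in A `&` ~` B) l (a_ k x))%:E + (e / 2)%:E)%E).
    rewrite -[leLHS]fineK; last exact: integrable_fin_num ila.
    rewrite -EFinD lee_fin -lerBlDl; exact: h.
  rewrite leeD2r// /Rintegral fineK; last exact: integrable_fin_num ilk.
  by apply: le_lower_integral => x _; rewrite lee_fin P_le.
have := IH (A `&` B) _ mAB (subIset (or_introl AD)) e20.
apply: filterS2 hl => k h1 h2.
have mmA C : measurable_fun C (fun x => (max_affine N.+1 (a x))%:E).
  by apply/measurable_EFinP; apply: measurable_funTS; exact: measurable_max_affine.
have mpA C : measurable_fun C (fun x => (psi (a_ k x))%:E).
  by apply/measurable_EFinP; apply: measurable_funTS; exact: measurable_psi.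
rewrite [X in (integral _ X _ <= integral _ X _ + _)%E]ABU.
rewrite !ge0_integral_setU//.
rewrite [X in (X + _ <= _)%E](_ : _ =
    \int[m]_(x in A `&` B) (max_affine N (a x))%:E)%E; last first.
  apply: eq_integral => x /set_mem[_ Bx]; congr EFin.
  exact: max_l.
rewrite [X in (_ + X <= _)%E](_ : _ =
    \int[m]_(x in A `&` ~` B) (l (a x))%:E)%E; last first.
  apply: eq_integral => x /set_mem[_ /negP]; rewrite -ltNge => Bx; congr EFin.
  exact/max_r/ltW.
- by apply: (le_trans (leeD h2 h1)); rewrite addeACA -EFinD -splitr.
- by move=> x _; rewrite lee_fin.
- by move=> x _; rewrite lee_fin; exact: (max_affine_ge0 N.+1).
Qed.

Let psi_lsc (A : set X) (e : R) : measurable A -> A `<=` D -> 0 < e ->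
  (\int[m]_(x in D) (psi (a x))%:E < +oo)%E ->
  \forall k \near \oo, (\int[m]_(x in A) (psi (a x))%:E <=
    \int[m]_(x in A) (psi (a_ k x))%:E + e%:E)%E.
Proof.
move=> mA AD e0 foo; have e20 : 0 < e / 2 by rewrite divr_gt0.
have mpA : measurable_fun A (fun x => (psi (a x))%:E).
  by apply/measurable_EFinP; apply: measurable_funTS; exact: measurable_psi.
have fin : (\int[m]_(x in A) (psi (a x))%:E)%E \is a fin_num.
  rewrite ge0_fin_numE ?integral_ge0//; last by move=> x _; rewrite lee_fin.
  apply: le_lt_trans foo; apply: subset_lower_integral => // x _.
  by rewrite lee_fin.
have cv : (fun N => \int[m]_(x in A) (max_affine N (a x))%:E)%E @ \oo -->
    (\int[m]_(x in A) (psi (a x))%:E)%E.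
  rewrite [X in _ --> X](_ : _ =
      \int[m]_(x in A) limn (fun N => (max_affine N (a x))%:E))%E; last first.
    apply: eq_integral => x _; apply/esym/cvg_lim => //.
    by apply: cvg_EFin; [exact: nearW|exact: max_affine_cvg].
  apply: cvg_monotone_convergence => //.
  - move=> N; apply/measurable_EFinP; apply: measurable_funTS.
    exact: measurable_max_affine.
  - by move=> N x _; rewrite lee_fin max_affine_ge0.
  - by move=> x _ N M NM; rewrite lee_fin; exact: max_affine_homo.
have [N hN] : exists N, (\int[m]_(x in A) (psi (a x))%:E - (e / 2)%:E <=
    \int[m]_(x in A) (max_affine N (a x))%:E)%E.
  apply: contrapT => /forallNP h.
  have : (\int[m]_(x in A) (psi (a x))%:E <=
      \int[m]_(x in A) (psi (a x))%:E - (e / 2)%:E)%E.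
    rewrite -[X in (X <= _)%E](cvg_lim _ cv)//; apply: lime_le.
      by apply/cvg_ex; eexists; exact: cv.
    by apply: nearW => N; have /negP := h N; rewrite -ltNge => /ltW.
  rewrite -(fineK fin) -EFinB lee_fin; lra.
have := max_affine_lsc N mA AD e20; apply: filterS => k hk.
move: hN; rewrite leeBlDr// => hN; apply: (le_trans hN).
by rewrite [in leRHS](splitr e) EFinD addeA leeD2r.
Qed.

(** The statement for sets is applied to [n] superlevel sets of [w], each with factor [1 / n], for a
    total error [e / 2]. Rounding [w] down is free on the side of [a_ k]; on the side of [a] it
    costs at most [I / n <= e / 2], where [I] is the finite integral of [psi (a x)]. *)
Lemma weighted_weak_lsc (w : X -> R) (e : R) : measurable_fun setT w ->
  (forall x, 0 <= w x <= 1) -> 0 < e ->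
  (\int[m]_(x in D) (psi (a x))%:E < +oo)%E ->
  \forall k \near \oo, (\int[m]_(x in D) (w x * psi (a x))%:E <=
    \int[m]_(x in D) (w x * psi (a_ k x))%:E + e%:E)%E.
Proof.
move=> mw w01 e0 foo; have e20 : 0 < e / 2 by rewrite divr_gt0.
have fin : (\int[m]_(x in D) (psi (a x))%:E)%E \is a fin_num.
  by rewrite ge0_fin_numE// integral_ge0// => x _; rewrite lee_fin.
set I := fine (\int[m]_(x in D) (psi (a x))%:E)%E.
have I0 : 0 <= I by rewrite fine_ge0// integral_ge0// => x _; rewrite lee_fin.
pose n := (Num.bound (I / (e / 2))).+1.
have n0 : 0 < n%:R :> R by rewrite ltr0n.
have In : I / n%:R <= e / 2.
  rewrite ler_pdivrMr// mulrC -ler_pdivrMr//.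
  have q0 : 0 <= I / (e / 2) by rewrite divr_ge0 ?(ltW e20).
  by rewrite (le_trans (ltW (archi_boundP q0)))// ler_nat.
pose B (i : 'I_n) := [set x | i.+1%:R / n%:R <= w x].
have mB i : measurable (B i).
  by rewrite -[B i]setTI; apply: measurable_fun_ler => //; exact: measurable_cst.
pose s x := n%:R^-1 * \sum_(i < n) (\1_(B i) x : R).
(* Layer cake: [s] is [w] rounded down to a multiple of [1 / n]. *)
have sw x : s x <= w x /\ w x <= s x + n%:R^-1.
  have /andP[w0 w1] := w01 x.
  pose k := Num.truncn (w x * n%:R).
  have wn0 : 0 <= w x * n%:R by rewrite mulr_ge0// ltW.
  have /andP[k1 k2] := truncn_itv wn0; rewrite -/k in k1 k2.
  have kn : (k <= n)%N.
    rewrite -(ler_nat R) (le_trans k1)// ler_piMl// ltW//.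
  have -> : s x = k%:R / n%:R.
    rewrite /s mulrC; congr (_ / _).
    have E (i : 'I_n) : \1_(B i) x = (i < k)%:R :> R.
      rewrite indicE; congr (nat_of_bool _)%:R; apply/idP/idP.
        rewrite inE /B /= ler_pdivrMr// => h.
        rewrite -ltnS -(ltr_nat R) (le_lt_trans h)//.
      move=> ik; rewrite inE /B /= ler_pdivrMr// (le_trans _ k1)// ler_nat//.
    rewrite (eq_bigr _ (fun i _ => E i)) -natr_sum; congr _%:R.
    have -> : (\sum_(i < n) (i < k) = \sum_(i < n | (i < k)%N) 1)%N.
      by rewrite [RHS]big_mkcond; apply: eq_bigr => i _; case: (i < k)%N.
    by rewrite -(big_ord_widen n (fun=> 1%N) kn) sum1_card card_ord.
  split; first by rewrite ler_pdivrMr.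
  by rewrite -[X in _ + X]mul1r -mulrDl ler_pdivlMr// natr1 ltW.
have is_ (b : X -> 'rV[R]_d) :
    (forall i, measurable_fun setT (fun x => b x ord0 i)) ->
    (\int[m]_(x in D) (s x * psi (b x))%:E =
      (n%:R^-1)%:E * \sum_(i < n) \int[m]_(x in B i `&` D) (psi (b x))%:E)%E.
  move=> mb; have mpb : measurable_fun setT (fun x => psi (b x)).
    exact: measurable_psi.
  transitivity (\int[m]_(x in D) ((n%:R^-1)%:E *
      \sum_(i < n) (\1_(B i) x * psi (b x))%:E))%E.
    apply: eq_integral => x _; rewrite sumEFin -EFinM; congr EFin.
    by rewrite /s -mulrA mulr_suml.
  rewrite ge0_integralZl//; last 2 first.
  - apply: emeasurable_sum => i; apply/measurable_EFinP; apply: measurable_funTS.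
    by apply: measurable_funM => //; exact: measurable_indic.
  - by move=> x _; apply: sume_ge0 => i _; rewrite lee_fin mulr_ge0// indicE.
  congr (_ * _)%E; rewrite ge0_integral_sum//; last 2 first.
  - move=> i; apply/measurable_EFinP; apply: measurable_funTS.
    by apply: measurable_funM => //; exact: measurable_indic.
  - by move=> i x _; rewrite lee_fin mulr_ge0// indicE.
  apply: eq_bigr => i _; rewrite integral_mkcondl; apply: eq_integral => x _.
  by rewrite patchE indicE; case: (x \in B i); rewrite ?mul1r ?mul0r.
have near_i : \forall k \near \oo, forall i : 'I_n,
    (\int[m]_(x in B i `&` D) (psi (a x))%:E <=
     \int[m]_(x in B i `&` D) (psi (a_ k x))%:E + (e / 2)%:E)%E.
  apply: filter_forall => i; apply: psi_lsc => //; exact: measurableI.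
apply: filterS near_i => k hk.
apply: (@le_trans _ _ (\int[m]_(x in D) ((s x * psi (a x))%:E +
    (n%:R^-1)%:E * (psi (a x))%:E))%E).
  apply: ge0_le_lower_integral => x _.
    by rewrite lee_fin mulr_ge0//; have /andP[] := w01 x.
  by rewrite -EFinM -EFinD lee_fin -mulrDl ler_wpM2r//; have [] := sw x.
have s0 x : 0 <= s x by rewrite mulr_ge0 ?invr_ge0// sumr_ge0// => i _; rewrite indicE.
have ms : measurable_fun setT s.
  apply: measurable_funM; first exact: measurable_cst.
  by apply: measurable_sum => i; exact: measurable_indic.
have mpa : measurable_fun setT (fun x => psi (a x)) by exact: measurable_psi.
rewrite ge0_integralD//; last 4 first.
- by move=> x _; rewrite lee_fin mulr_ge0.
- by apply/measurable_EFinP; apply: measurable_funTS; exact: measurable_funM.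
- by move=> x _; rewrite -EFinM lee_fin mulr_ge0.
- rewrite (_ : (fun x => _) = (fun x => (n%:R^-1 * psi (a x))%:E))//.
  apply/measurable_EFinP; apply: measurable_funTS; apply: measurable_funM => //.
rewrite ge0_integralZl//; last 2 first.
- by apply/measurable_EFinP; apply: measurable_funTS.
- by move=> x _; rewrite lee_fin.
rewrite is_// -(fineK fin) -/I -EFinM [(_ * I)%R]mulrC.
rewrite [in leRHS](splitr e) EFinD addeA; apply: leeD; last by rewrite lee_fin.
apply: (@le_trans _ _ ((n%:R^-1)%:E * \sum_(i < n)
   (\int[m]_(x in B i `&` D) (psi (a_ k x))%:E + (e / 2)%:E))%E).
  by rewrite lee_wpmul2l ?lee_fin ?invr_ge0//; apply: lee_sum => i _; exact: hk.
rewrite big_split /= sumEFin sumr_const card_ord ge0_muleDr; last 2 first.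
- by apply: sume_ge0 => i _; apply: integral_ge0 => x _; rewrite lee_fin.
- by rewrite lee_fin mulrn_wge0// ltW.
apply: leeD; last first.
  by rewrite -EFinM lee_fin -[X in _ * X]mulr_natl mulKf// gt_eqF.
rewrite -is_//; apply: ge0_le_lower_integral => x _; first by rewrite lee_fin mulr_ge0.
by rewrite lee_fin ler_wpM2r//; have [] := sw x.
Qed.

End weak_lower_semicontinuity.

(** * Bounds on the controls and weak convergence at fixed points *)

Section admissible_controls.
Context {R : realType}.

Lemma measurable_time (A : set R) :
  measurable (A : set (measurableTypeR R)) -> measurable (A : set (time R)).
Proof. exact: sub_caratheodory. Qed.

Lemma continuous_measurable_time (g : R -> R) (D : set (time R)) :
  continuous g -> measurable_fun D g.
Proof.
move=> cg; apply: measurable_funTS => _ B mB; rewrite setTI.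
apply: measurable_time; rewrite -[X in measurable X]setTI.
exact: continuous_measurable_fun.
Qed.

Lemma measurable_segment (T : R) : measurable (`[0, T]%classic : set (time R)).
Proof. by apply: measurable_time; exact: measurable_itv. Qed.

Lemma dt_segment_fin (T : R) : (dt (`[0%R, T]%classic : set (time R)) < +oo)%E.
Proof.
rewrite -[X in (X < _)%E]/(lebesgue_measure (`[0, T]%classic)).
by rewrite lebesgue_measure_itv/=; case: ifP => // _; rewrite -EFinB ltry.
Qed.

Context {n m : nat}.
Variables (T q : R) (ell : R -> R).
Hypotheses (q1 : 1 <= q) (ellq : in_Lq q T ell).
Local Notation I := (`[0, T]%classic : set (time R)).

Let mI : measurable I. Proof. exact: measurable_segment. Qed.

(** The bound on [|f(t, 0)| + Lip] at a single time, with the two summands separated and stated in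
    real numbers. *)
Definition growth (g : 'rV[R]_n -> 'rV[R]_m) (l : R) : Prop :=
  [/\ 0 <= l, enorm (g 0) <= l &
      forall x y, enorm (g x - g y) <= l * enorm (x - y)].

Lemma admissible_growth (f : R -> 'rV[R]_n -> 'rV[R]_m) : admissible T ell f ->
  {ae dt, forall t : R, t \in `[0, T] -> growth (f t) (ell t)}.
Proof.
move=> [_ [N [mN N0 hN]]]; exists N; split => // t /= ht; apply: hN => /= h.
apply: ht => tT; have [_ hL] := h tT.
have L0 : (0 <= Lip enorm (f t) setT)%E.
  by apply: ereal_sup_ubound; exists 0, 0; split => //; rewrite !subrr !enorm0 mul0r.
have f0 : (0%:E <= (enorm (f t 0))%:E)%E by rewrite lee_fin enorm_ge0.
have fl : (Lip enorm (f t) setT <= (ell t)%:E)%E.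
  by apply: le_trans hL; rewrite leeDr.
split.
- by rewrite -lee_fin (le_trans L0).
- by rewrite -lee_fin; apply: le_trans hL; rewrite leeDl.
move=> x y; have [->|xy] := eqVneq x y.
  by rewrite !subrr !enorm0 mulr0.
have exy : 0 < enorm (x - y).
  rewrite (lt_le_trans _ (le_norm_enorm _))// normr_gt0 subr_eq0//.
rewrite -ler_pdivrMr// -lee_fin; apply: le_trans fl.
by apply: ereal_sup_ubound; exists x, y.
Qed.

Lemma growth_le g l z : growth g l -> enorm (g z) <= 2 * l * (1 + enorm z).
Proof.
move=> [l0 g0 gL]; have := gL z 0; rewrite subr0 => h.
rewrite -[g z](subrK (g 0)) (le_trans (enormD_le _ _))//.
by nra.
Qed.

Lemma integrable_ellq : dt.-integrable I (EFin \o (fun t => `|ell t| `^ q)).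
Proof.
case: ellq => mell fin; apply/integrableP; split.
  apply/measurable_EFinP; apply: (measurableT_comp (measurable_powR q)).
  exact: measurableT_comp.
apply: le_lt_trans fin; apply: le_lower_integral => t _.
by rewrite lee_fin ger0_norm// powR_ge0.
Qed.

(** On a bounded interval [|ell| <= 1 + |ell|^q], since [q >= 1]. *)
Lemma integrable_ell : dt.-integrable I (EFin \o ell).
Proof.
case: (ellq) => mell _.
have i1 : dt.-integrable I (EFin \o (fun=> 1 : R)).
  apply: measurable_bounded_integrable => //; first exact: dt_segment_fin.
  exact: bounded_cst.
apply: (le_integrable mI _ _ (integrableD mI i1 integrable_ellq)).
  exact/measurable_EFinP.
move=> t _; rewrite /= lee_fin [leRHS]ger0_norm ?addr_ge0 ?powR_ge0//.
have [l1|l1] := leP `|ell t| 1; first by rewrite (le_trans l1)// lerDl powR_ge0.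
rewrite (@le_trans _ _ (`|ell t| `^ q))// ?lerDr//.
by rewrite -[leLHS]powRr1// ler_powR// ltW.
Qed.

Lemma integrable_control (f : R -> 'rV[R]_n -> 'rV[R]_m) z j : admissible T ell f ->
  dt.-integrable I (EFin \o (fun t => f t z ord0 j)).
Proof.
move=> adf; have [[mf _] _] := adf.
have mfz : measurable_fun I (fun t => f t z ord0 j).
  exact: (measurableT_comp (measurable_entry _ _) (mf z)).
apply/integrableP; split; first exact/measurable_EFinP.
have [N [mN N0 hN]] := admissible_growth adf.
have ie := integrableZl mI (2 * (1 + enorm z)) integrable_ell.
apply: (@le_lt_trans _ _ (\int[dt]_(t in I)
    `|(2 * (1 + enorm z))%:E * (ell t)%:E|)%E).
  apply: (le_lower_integral_ae mN N0) => t [tI tN].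
  rewrite /= lee_fin.
  have gr : growth (f t) (ell t).
    by apply: contrapT => h; apply: tN; apply: hN => /= /(_ tI).
  rewrite (le_trans (le_entry_enorm _ _ _))// (le_trans (growth_le z gr))//.
  by rewrite mulrAC; exact: ler_norm.
by case/integrableP: ie.
Qed.

(** Within the cube a point is at Euclidean distance at most [n * eta] from [z], and each of the two
    controls varies by [ell t] times this. The integral is squeezed between those of two constants,
    which takes nothing but monotonicity. *)
Lemma admissible_box_integral (f g : R -> 'rV[R]_n -> 'rV[R]_m) z (eta V : R) B
    j t : 0 < eta -> B = box (z - const_mx eta, z + const_mx eta) ->
  lebesgue_Rn n B = V%:E ->
  growth (f t) (ell t) -> growth (g t) (ell t) ->
  `|(\int[lebesgue_Rn n]_(x in B) (f t x - g t x) ord0 j)%R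
      - V * (f t z - g t z) ord0 j| <= V * (2 * n%:R * eta * ell t).
Proof.
move=> eta0 BE VE [l0 _ fL] [_ _ gL].
have mB : measurable B by rewrite BE; exact: measurable_box.
set c := (f t z - g t z) ord0 j; set dl := 2 * n%:R * eta * ell t.
have bnd x : B x -> `|(f t x - g t x) ord0 j - c| <= dl.
  move=> Bx; have xz : enorm (x - z) <= n%:R * eta.
    rewrite (le_trans (le_enorm_norm _))// mul1n ler_wpM2l//.
    rewrite [leLHS]/Num.norm/= mx_normrE; apply/bigmax_leP; split => [|[i k] _].
      exact: ltW.
    rewrite ord1 /=; move: Bx; rewrite BE => /(_ k); rewrite /= !mxE => /andP[h1 h2].
    by rewrite ler_norml; apply/andP; split; lra.
  have h1 := le_trans (le_entry_enorm (f t x - f t z) ord0 j) (fL x z).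
  have h2 := le_trans (le_entry_enorm (g t x - g t z) ord0 j) (gL x z).
  have E : (f t x - g t x) ord0 j - c =
      (f t x - f t z) ord0 j - (g t x - g t z) ord0 j by rewrite /c !mxE; ring.
  rewrite E (le_trans (ler_normB _ _))// (le_trans (lerD h1 h2))//.
  by rewrite /dl; nra.
have IC a : (\int[lebesgue_Rn n]_(x in B) a%:E = (V * a)%:E)%E.
  by rewrite integral_cst// EFinM muleC; congr (_ * _)%E; exact: VE.
have ub : (\int[lebesgue_Rn n]_(x in B) ((f t x - g t x) ord0 j)%:E <=
    (V * (c + dl))%:E)%E.
  apply: (@le_trans _ _ (\int[lebesgue_Rn n]_(x in B) (c + dl)%:E)%E).
    apply: le_lower_integral => x Bx; rewrite lee_fin.
    by have := bnd x Bx; rewrite ler_norml => /andP[]; lra.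
  by rewrite IC.
have lb : ((V * (c - dl))%:E <=
    \int[lebesgue_Rn n]_(x in B) ((f t x - g t x) ord0 j)%:E)%E.
  apply: (@le_trans _ _ (\int[lebesgue_Rn n]_(x in B) (c - dl)%:E)%E).
    by rewrite IC.
  apply: le_lower_integral => x Bx; rewrite lee_fin.
  by have := bnd x Bx; rewrite ler_norml => /andP[]; lra.
have fin : (\int[lebesgue_Rn n]_(x in B) ((f t x - g t x) ord0 j)%:E)%E \is a fin_num.
  by rewrite fin_numElt (lt_le_trans _ lb) ?ltNyr// (le_lt_trans ub)// ltry.
rewrite -(fineK fin) !lee_fin in ub lb.
by rewrite ler_norml /Rintegral; apply/andP; split; lra.
Qed.

Lemma eval_weak_cvg (p : R) (fs : nat -> R -> 'rV[R]_n -> 'rV[R]_m) f z A j :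
  1 < p -> (forall k, admissible T ell (fs k)) -> admissible T ell f ->
  local_weak_cvg p q T fs f -> measurable A -> A `<=` I ->
  (\int[dt]_(t in A) fs k t z ord0 j)%R @[k --> \oo] -->
    (\int[dt]_(t in A) f t z ord0 j)%R.
Proof.
have lin (x g k w : R) : `|x| <= w -> x <= g + k -> g - k <= x -> k <= w -> `|g| <= w + w.
  by rewrite !ler_norml => /andP[? ?] ? ? ?; apply/andP; split; lra.
move=> p1 adfs adf fsf mA AI; apply/cvgrPdist_le => e e0.
pose Lam := (\int[dt]_(t in I) `|ell t|)%R.
have Lam0 : 0 <= Lam by apply: Rintegral_ge0.
have iabs : dt.-integrable I (EFin \o (fun t => `|ell t|)).
  exact: (integrable_norm integrable_ell).
(* Replacing box averages by centre values costs [V * 2 n eta * Lam] after integration in time; this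
   [eta] keeps it below [V * e / 2], and the 1 keeps the divisor positive. *)
pose eta := e / 2 / (2 * n%:R * Lam + 1).
have d0 : 0 < 2 * n%:R * Lam + 1 by rewrite ltr_wpDl// !mulr_ge0.
have eta0 : 0 < eta by rewrite !divr_gt0.
pose B := box (z - const_mx eta, z + const_mx eta).
pose V := fine (lebesgue_Rn n B).
have VE : lebesgue_Rn n B = V%:E.
  by rewrite fineK// ge0_fin_numE// lebesgue_Rn_box_fin.
have V0 : 0 < V.
  rewrite -lte_fin -VE; apply: lebesgue_Rn_box_gt0 => i /=.
  by rewrite !mxE ltrBlDr -addrA ltrDl addr_gt0.
have Ve0 : 0 < V * (e / 2) by rewrite mulr_gt0// divr_gt0.
have := local_weak_cvg_box (z - const_mx eta, z + const_mx eta) j p1 q1 mA fsf.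
rewrite -/B => /cvgrPdist_le /(_ _ Ve0); apply: filterS => k.
rewrite sub0r normrN => hk.
have iA g : dt.-integrable I g -> dt.-integrable A g by exact: integrableS.
have ifk := iA _ (integrable_control z j (adfs k)).
have if_ := iA _ (integrable_control z j adf).
have ilA := iA _ iabs.
set X := (X in `|X| <= _) in hk.
pose c := V * (2 * n%:R * eta).
have iB : dt.-integrable A (EFin \o (fun t => fs k t z ord0 j - f t z ord0 j)).
  exact: (integrableB mA ifk if_).
have iVB : dt.-integrable A (EFin \o (fun t => V * (fs k t z ord0 j - f t z ord0 j))).
  exact: (integrableZl mA V iB).
have icl : dt.-integrable A (EFin \o (fun t => c * `|ell t|)).
  exact: (integrableZl mA c ilA).
have [N [mN N0 hN]] := admissible_growth adf.
have [N' [mN' N0' hN']] := admissible_growth (adfs k).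
have NN0 : dt (N `|` N') = 0%E.
  apply: measure_negligible; first exact: measurableU.
  apply: negligibleU; first by exists N; split.
  by exists N'; split.
have bnd t : (A `\` (N `|` N')) t ->
    `|(\int[lebesgue_Rn n]_(x in B) (fs k t x - f t x) ord0 j)%R
      - V * (fs k t z ord0 j - f t z ord0 j)| <= c * `|ell t|.
  move=> [tA /not_orP[tN tN']].
  have g1 : growth (f t) (ell t).
    by apply: contrapT => h; apply: tN; apply: hN => /= /(_ (AI _ tA)).
  have g2 : growth (fs k t) (ell t).
    by apply: contrapT => h; apply: tN'; apply: hN' => /= /(_ (AI _ tA)).
  have := admissible_box_integral j eta0 erefl VE g2 g1; rewrite !mxE => h.
  apply: (le_trans h); rewrite /c -[leRHS]mulrA; apply: ler_wpM2l; first exact: ltW.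
  apply: ler_wpM2l; last exact: ler_norm.
  by rewrite mulr_ge0 ?(ltW eta0)// mulr_ge0.
have XE : X = fine (\int[dt]_(t in A)
    ((\int[lebesgue_Rn n]_(x in B) (fs k t x - f t x) ord0 j)%R)%:E)%E.
  rewrite /X /Rintegral; congr fine.
  rewrite [RHS]integral_mkcond [LHS]integral_mkcond; apply: eq_integral => t _.
  rewrite !patchE indicE; case: ifPn => [tI|tI].
    by case: (t \in A); rewrite ?mul1r ?mul0r.
  by case: ifPn => // /set_mem /AI /mem_set tI'; rewrite tI' in tI.
pose G := (\int[dt]_(t in A) (V * (fs k t z ord0 j - f t z ord0 j)))%R.
pose K := (\int[dt]_(t in A) (c * `|ell t|))%R.
have GE : G%:E = (\int[dt]_(t in A) (V * (fs k t z ord0 j - f t z ord0 j))%:E)%E.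
  by rewrite /G /Rintegral fineK//; exact: integrable_fin_num iVB.
have KE : K%:E = (\int[dt]_(t in A) (c * `|ell t|)%:E)%E.
  by rewrite /K /Rintegral fineK//; exact: integrable_fin_num icl.
have mNN : measurable (N `|` N') by exact: measurableU.
(* Measurability in time of the box integral is not established, so [X] is squeezed between [G - K]
   and [G + K] instead of being split by linearity. *)
have ub : (\int[dt]_(t in A) ((\int[lebesgue_Rn n]_(x in B) (fs k t x - f t x) ord0 j)%R)%:E
    <= (G + K)%:E)%E.
  rewrite EFinD GE KE -integralD//.
  apply: (le_lower_integral_ae mNN NN0) => t /bnd; rewrite ler_norml => /andP[_ h].
  by rewrite -EFinD lee_fin -lerBlDl.
have lb : ((G - K)%:E <=
    \int[dt]_(t in A) ((\int[lebesgue_Rn n]_(x in B) (fs k t x - f t x) ord0 j)%R)%:E)%E.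
  rewrite EFinB GE KE -integralB//.
  apply: (le_lower_integral_ae mNN NN0) => t /bnd; rewrite ler_norml => /andP[h _].
  by move: h; rewrite -EFinB lee_fin lerBrDr addrC.
have Xfin : (\int[dt]_(t in A) ((\int[lebesgue_Rn n]_(x in B)
    (fs k t x - f t x) ord0 j)%R)%:E)%E \is a fin_num.
  by rewrite fin_numElt (lt_le_trans _ lb) ?ltNyr// (le_lt_trans ub)// ltry.
rewrite -(fineK Xfin) -XE !lee_fin in ub lb.
have KL : K <= V * (e / 2).
  have -> : K = c * (\int[dt]_(t in A) `|ell t|)%R by rewrite /K RintegralZl.
  have h1 : (\int[dt]_(t in A) `|ell t|)%R <= Lam.
    rewrite /Lam /Rintegral fine_le//.
    - exact: integrable_fin_num ilA.
    - exact: integrable_fin_num iabs.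
    - exact: subset_lower_integral.
  have c0 : 0 <= c by rewrite mulr_ge0 ?(ltW V0)// mulr_ge0 ?(ltW eta0)// mulr_ge0.
  rewrite (le_trans (ler_wpM2l c0 h1))// /c -[leLHS]mulrA ler_wpM2l ?(ltW V0)//.
  have -> : 2 * n%:R * eta * Lam =
      e / 2 * ((2 * n%:R * Lam) / (2 * n%:R * Lam + 1)) by rewrite /eta; field; rewrite gt_eqF.
  by rewrite ler_piMr ?divr_ge0 ?(ltW e0)// ler_pdivrMr// mul1r lerDl.
have GV : G = V * ((\int[dt]_(t in A) fs k t z ord0 j)%R - (\int[dt]_(t in A) f t z ord0 j)%R).
  by rewrite /G RintegralZl// RintegralB.
rewrite distrC -(ler_pM2l V0) -{1}(gtr0_norm V0) -normrM -GV.
by rewrite [e in leRHS]splitr mulrDr (lin _ _ _ _ hk ub lb KL).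
Qed.

End admissible_controls.

(** * A continuous partition of unity with small supports *)

Section partition_of_unity.
Context {R : realType} {n : nat}.
Implicit Types z c : 'rV[R]_n.

Definition hat (dl : R) c z : R := Num.max 0 (Num.min 1 (2 - 2 / dl * `|z - c|)).

Lemma continuous_hat dl c : continuous (hat dl c).
Proof.
have h : continuous (fun z : 'rV[R]_n => 2 - 2 / dl * `|z - c|).
  have hn : continuous (fun z : 'rV[R]_n => `|z - c|).
    move=> z; apply: (@continuous_comp _ _ _ (fun z : 'rV[R]_n => z - c)
      (@Num.norm _ 'rV[R]_n)); last exact: norm_continuous.
    by apply: (@continuousB _ _ _ (id : 'rV[R]_n -> 'rV[R]_n) (fun=> c) z);
      [exact: cvg_id|exact: cst_continuous].
  have hm : continuous (fun z : 'rV[R]_n => 2 / dl * `|z - c|).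
    by move=> z; apply: (@continuousM _ _ (fun=> 2 / dl) (fun z : 'rV[R]_n => `|z - c|) z);
      [exact: cst_continuous|exact: hn].
  move=> z; apply: (@continuousB _ R^o _ (fun=> 2)
    (fun z : 'rV[R]_n => 2 / dl * `|z - c|) z); first exact: cst_continuous.
  exact: hm.
rewrite -[hat dl c]/((fun=> 0) \max ((fun=> 1) \min (fun z => 2 - 2 / dl * `|z - c|))).
move=> z; apply: continuous_max; first exact: cst_continuous.
apply: continuous_min; [exact: cst_continuous|exact: h].
Qed.

Lemma hat01 dl c z : 0 <= hat dl c z <= 1.
Proof. by rewrite /hat le_max lexx ge_max ler01 ge_min lexx. Qed.

Lemma hat_eq0 dl c z : 0 < dl -> dl <= `|z - c| -> hat dl c z = 0.
Proof.
move=> d0 h; rewrite /hat; apply/max_l; rewrite ge_min; apply/orP; right.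
by rewrite subr_le0 mulrAC ler_pdivlMr// ler_wpM2l.
Qed.

Lemma hat_eq1 dl c z : 0 < dl -> `|z - c| <= dl / 2 -> hat dl c z = 1.
Proof.
move=> d0 h; rewrite /hat min_l ?max_r// lerBrDr -lerBrDl.
have -> : 2 - 1 = 2 / dl * (dl / 2) :> R by field; rewrite gt_eqF.
by rewrite ler_wpM2l// divr_ge0// ltW.
Qed.

Fixpoint max_hat dl (cs : nat -> 'rV[R]_n) (N : nat) z : R :=
  if N is N'.+1 then Num.max (max_hat dl cs N' z) (hat dl (cs N') z) else 0.

Lemma continuous_max_hat dl cs N : continuous (max_hat dl cs N).
Proof.
elim: N => [|N IH] /= z; first exact: cst_continuous.
by apply: (@continuous_max _ _ (max_hat dl cs N)); [exact: IH|exact: continuous_hat].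
Qed.

Lemma max_hat01 dl cs N z : 0 <= max_hat dl cs N z <= 1.
Proof.
elim: N => [|N /andP[h1 h2]] /=; first by rewrite lexx ler01.
by have /andP[h3 h4] := hat01 dl (cs N) z; rewrite le_max h1 ge_max h2.
Qed.

(* The increments of the running maximum of hat functions form the partition. *)
Definition pou dl cs N z : R := max_hat dl cs N.+1 z - max_hat dl cs N z.

Lemma continuous_pou dl cs N : continuous (pou dl cs N).
Proof.
move=> z; apply: (@continuousB _ _ _ (max_hat dl cs N.+1) (max_hat dl cs N));
  exact: continuous_max_hat.
Qed.

Lemma pou_ge0 dl cs N z : 0 <= pou dl cs N z.
Proof. by rewrite subr_ge0 /= le_max lexx. Qed.

Lemma pou_le1 dl cs N z : pou dl cs N z <= 1.
Proof.
have /andP[_ h1] := max_hat01 dl cs N.+1 z; have /andP[h2 _] := max_hat01 dl cs N z.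
by rewrite /pou; lra.
Qed.

Lemma pou_supp dl cs N z : 0 < dl -> pou dl cs N z != 0 -> `|z - cs N| < dl.
Proof.
move=> d0; apply: contraNT; rewrite -leNgt => /(hat_eq0 d0) h.
have /andP[h1 _] := max_hat01 dl cs N z.
by rewrite /pou /= h max_l// subrr.
Qed.

Lemma sum_pou dl cs N z : \sum_(i < N) pou dl cs i z = max_hat dl cs N z.
Proof.
rewrite -(big_mkord xpredT (fun i => pou dl cs i z)) telescope_sumr//.
by rewrite /= subr0.
Qed.

Lemma sum_pou_le1 dl cs N z : \sum_(i < N) pou dl cs i z <= 1.
Proof. by rewrite sum_pou; have /andP[] := max_hat01 dl cs N z. Qed.

(** The centres come from a finite subcover by balls of radius [dl / 2], on which the hats equal 1,
    so the running maximum reaches 1 on [K]. The default of [nth] concerns only indices beyond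
    [N]. *)
Lemma exists_pou (K : set 'rV[R]_n) (dl : R) : compact K -> 0 < dl ->
  exists (cs : nat -> 'rV[R]_n) (N : nat), (forall i, (i < N)%N -> K (cs i)) /\
    forall z, K z -> \sum_(i < N) pou dl cs i z = 1.
Proof.
rewrite compact_cover => cK d0; have d20 : 0 < dl / 2 by rewrite divr_gt0.
have ob c : K c -> open (ball c (dl / 2)) by move=> _; exact: ball_open.
have Kb : K `<=` cover K (fun c => ball c (dl / 2)).
  by move=> z Kz; exists z => //; exact: ballxx.
have [D' DK KD] := cK _ _ _ ob Kb.
pose s := finmap.enum_fset D'.
exists (nth 0 s), (size s); split.
  by move=> i iN; have /DK := mem_nth 0 iN; rewrite inE.
move=> z /KD[c /= cD]; rewrite -ball_normE /= distrC => zc.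
rewrite sum_pou; apply/eqP; rewrite eq_le; have /andP[_ ->] := max_hat01 dl (nth 0 s) (size s) z.
have cs : (index c s < size s)%N by rewrite index_mem.
have mono N M : (N <= M)%N -> max_hat dl (nth 0 s) N z <= max_hat dl (nth 0 s) M z.
  move=> NM; apply: (@homo_leq _ (max_hat dl (nth 0 s) ^~ z) (fun x y => x <= y)) => //.
  - by move=> ? ? ?; exact: le_trans.
  - by move=> k; rewrite /= le_max lexx.
rewrite /= (le_trans _ (mono _ _ cs))//= nth_index// (hat_eq1 d0 (ltW zc)).
by rewrite le_max lexx orbT.
Qed.

Variables (c : nat -> 'rV[R]_n) (N : nat) (dl : R) (g : 'rV[R]_n -> R) (e : R).
Hypotheses (dl0 : 0 < dl) (cg : continuous g) (g0 : forall z, 0 <= g z) (e0 : 0 <= e).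
Hypothesis ge : forall i z, (i < N)%N -> `|z - c i| < dl -> `|g z - g (c i)| <= e.

Let pouM i z : (i < N)%N ->
  pou dl c i z * (g (c i) - e) <= pou dl c i z * g z <= pou dl c i z * (g (c i) + e).
Proof.
move=> iN; have [->|h] := eqVneq (pou dl c i z) 0; first by rewrite !mul0r lexx.
have := ge iN (pou_supp dl0 h); rewrite ler_norml => /andP[h1 h2].
by rewrite !ler_wpM2l ?pou_ge0//; lra.
Qed.

Let sum_pou_integral (nu : probability 'rV[R]_n R) :
  (\int[nu]_z (\sum_(i < N) pou dl c i z * g (c i))%:E)%E =
  (\sum_(i < N) (\int[nu]_z pou dl c i z)%R * g (c i))%:E.
Proof.
have mp i : measurable_fun setT (pou dl c i).
  by apply: continuous_measurable_mx => z; exact: continuous_pou.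
under eq_integral do rewrite -sumEFin.
rewrite ge0_integral_sum//; last 2 first.
- move=> i; apply/measurable_EFinP; apply: measurable_funM => //.
- by move=> i z _; rewrite lee_fin mulr_ge0// pou_ge0.
rewrite -sumEFin; apply: eq_bigr => i _.
under eq_integral do rewrite EFinM.
rewrite ge0_integralZr//; last 3 first.
- exact/measurable_EFinP.
- by move=> z _; rewrite lee_fin pou_ge0.
- by rewrite lee_fin.
rewrite EFinM /Rintegral fineK//.
apply: integrable_fin_num => //.
apply: (@integrable_bounded_probability _ _ _ _ _ 1) => // z.
by rewrite ger0_norm ?pou_ge0// pou_le1.
Qed.

(** The partial sums are at most one everywhere, so this direction serves the particle measures
    wherever they are supported. The reverse direction wants sums equal to one on a set carrying
    [nu], and serves the limit measures. *)
Lemma pou_integral_le (nu : probability 'rV[R]_n R) :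
  ((\sum_(i < N) (\int[nu]_z pou dl c i z)%R * g (c i))%:E <=
    \int[nu]_z (g z)%:E + e%:E)%E.
Proof.
rewrite -sum_pou_integral.
have E1 : (\int[nu]_z (cst e%:E) z = e%:E)%E.
  by rewrite integral_cst//; have := probability_setT nu => /= ->; rewrite mule1.
rewrite -[X in (_ <= _ + X)%E]E1 -ge0_integralD//; last 2 first.
- by move=> z _; rewrite lee_fin.
- by apply/measurable_EFinP; exact: continuous_measurable_mx.
apply: ge0_le_lower_integral => z _.
  by rewrite lee_fin sumr_ge0// => i _; rewrite mulr_ge0// pou_ge0.
rewrite /= -EFinD lee_fin.
apply: (@le_trans _ _ (\sum_(i < N) pou dl c i z * (g z + e))).
  apply: ler_sum => i _; have /andP[h _] := pouM z (ltn_ord i).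
  by rewrite mulrDr -lerBlDr -mulrBr.
by rewrite -mulr_suml ler_piMl ?addr_ge0// sum_pou_le1.
Qed.

Lemma pou_integral_ge (nu : probability 'rV[R]_n R) (K : set 'rV[R]_n) :
  measurable K -> nu (~` K) = 0%E -> (forall z, K z -> \sum_(i < N) pou dl c i z = 1) ->
  (\int[nu]_z (g z)%:E <=
   (\sum_(i < N) (\int[nu]_z pou dl c i z)%R * g (c i))%:E + e%:E)%E.
Proof.
move=> mK nuK sK; rewrite -sum_pou_integral.
have E1 : (\int[nu]_z (cst e%:E) z = e%:E)%E.
  by rewrite integral_cst//; have := probability_setT nu => /= ->; rewrite mule1.
rewrite -[X in (_ <= _ + X)%E]E1 -ge0_integralD//; last 2 first.
- by move=> z _; rewrite lee_fin sumr_ge0// => i _; rewrite mulr_ge0// pou_ge0.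
- apply/measurable_EFinP; apply: measurable_sum => i; apply: measurable_funM => //.
  by apply: continuous_measurable_mx => z; exact: continuous_pou.
apply: (le_lower_integral_ae (measurableC mK) nuK) => z [_ /= /contrapT Kz].
rewrite -EFinD lee_fin.
rewrite -[g z]mul1r -[X in _ + X]mul1r -{1 2}(sK z Kz) !mulr_suml -big_split /=.
apply: ler_sum => i _; have /andP[_ h] := pouM z (ltn_ord i).
by rewrite -mulrDr.
Qed.

End partition_of_unity.

(** * Empirical measures and the Lagrangian cost *)

Section empirical_measures.
Context {R : realType} {n : nat}.
Local Notation rV := 'rV[R]_n.

Lemma ge0_empirical_integral (N : nat) (z : 'I_N.+1 -> rV) (g : rV -> R) :
  measurable_fun setT g -> (forall x, 0 <= g x) ->
  (\int[empirical z]_x (g x)%:E = (N.+1%:R^-1 * \sum_i g (z i))%:E)%E.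
Proof.
move=> mg g0; have mgE : measurable_fun setT (EFin \o g) by exact/measurable_EFinP.
rewrite -[LHS]/(\int[mscale ((N.+1%:R : R)^-1)%:nng%R
  (msum (fun i => dirac (z (inord i)) : {measure set rV -> \bar R}) N.+1)]_x (g x)%:E)%E.
rewrite ge0_integral_mscale//; last by move=> x _; rewrite lee_fin.
rewrite EFinM; congr (_ * _)%E.
rewrite ge0_integral_measure_sum//; last by move=> x _; rewrite lee_fin.
rewrite -sumEFin; apply: eq_bigr => i _.
by rewrite integral_dirac// diracT mul1e inord_val.
Qed.

(** Shifting [g] by its bound [M] reduces the formula to the nonnegative case. *)
Lemma empirical_Rintegral (N : nat) (z : 'I_N.+1 -> rV) (g : rV -> R) (M : R) :
  measurable_fun setT g -> (forall x, `|g x| <= M) ->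
  (\int[empirical z]_x g x)%R = N.+1%:R^-1 * \sum_i g (z i).
Proof.
move=> mg gM.
have ig := integrable_bounded_probability (empirical z) mg gM.
have mc : measurable_fun setT (fun _ : rV => M) by exact: measurable_cst.
have ic : (empirical z).-integrable setT (EFin \o (fun _ : rV => M)).
  by apply: (@integrable_bounded_probability _ _ _ _ _ `|M|) => // x.
have Ec : (\int[empirical z]_x M)%R = M.
  rewrite Rintegral_cst//; have := probability_setT (empirical z) => /= ->.
  by rewrite mulr1.
have Eg : (\int[empirical z]_x (g x + M))%R = N.+1%:R^-1 * \sum_i (g (z i) + M).
  rewrite /Rintegral ge0_empirical_integral//.
    by apply: measurable_funD.
  by move=> x; have := gM x; rewrite ler_norml => /andP[]; lra.
have := Eg; rewrite RintegralD// Ec big_split /= sumr_const card_ord mulrDr.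
by rewrite -[M *+ _]mulr_natl mulKf ?pnatr_eq0// => /addIr.
Qed.

Lemma P1_empirical (N : nat) (z : 'I_N.+1 -> rV) : P1 (empirical z).
Proof.
rewrite /P1 ge0_empirical_integral ?ltry//; first exact: measurable_enorm.
by move=> x; exact: enorm_ge0.
Qed.

Lemma empirical_narrow_cvg (N : nat) (z_ : nat -> 'I_N.+1 -> rV) z :
  (forall i, z_ ^~ i @ \oo --> z i) ->
  narrow_cvg (fun k => empirical (z_ k)) (empirical z).
Proof.
move=> zz g cg [M gM].
have mg : measurable_fun setT g by exact: continuous_measurable_mx.
rewrite (empirical_Rintegral _ mg gM).
under eq_fun do rewrite (empirical_Rintegral _ mg gM).
apply: cvgM; first exact: cvg_cst.
apply: cvg_bigsum => i.
exact: (@continuous_cvg _ _ _ _ _ _ _ _ (cg (z i)) (zz i)).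
Qed.

Variable L : rV -> probability rV R -> R.
Hypothesis L0 : forall z nu, P1 nu -> 0 <= L z nu.
Hypothesis cL : forall nu, P1 nu -> continuous (L ^~ nu).
Hypothesis unifL : forall (nus : nat -> probability rV R) nu,
  (forall j, P1 (nus j)) -> P1 nu -> narrow_cvg nus nu ->
  forall K : set rV, compact K -> forall e : R, 0 < e ->
    \forall j \near \oo, forall z, K z -> `|L z (nus j) - L z nu| < e.

(** Here the points move together with the measure: they eventually stay in a compact ball, on which
    [L] converges uniformly in its measure argument, and continuity in space does the rest. *)
Lemma cvg_empirical_cost (N : nat) (z_ : nat -> 'I_N.+1 -> rV) z :
  (forall i, z_ ^~ i @ \oo --> z i) ->
  N.+1%:R^-1 * \sum_i L (z_ k i) (empirical (z_ k)) @[k --> \oo] -->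
    N.+1%:R^-1 * \sum_i L (z i) (empirical z).
Proof.
move=> zz; apply: cvgM; first exact: cvg_cst.
apply: cvg_bigsum => i; apply/cvgrPdist_lt => e e0.
have e20 : 0 < e / 2 by rewrite divr_gt0.
have nc := empirical_narrow_cvg zz.
have := unifL (fun k => P1_empirical (z_ k)) (P1_empirical z) nc
  (@compact_norm_le R n (`|z i| + 1)) e20.
have c1 : L (z_ k i) (empirical z) @[k --> \oo] --> L (z i) (empirical z).
  exact: (cvg_comp _ _ (zz i) (@cL _ (P1_empirical z) (z i))).
have /cvgrPdist_lt /(_ _ e20) := c1.
have /cvgrPdist_lt /(_ _ ltr01) := zz i.
apply: filterS3 => k h1 h2 h3.
have zK : `|z_ k i| <= `|z i| + 1.
  have := lerB_dist (z_ k i) (z i); rewrite distrC; lra.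
have := h3 _ zK; rewrite distrC => h4.
rewrite (splitr e) (le_lt_trans (ler_distD (L (z_ k i) (empirical z)) _ _))//.
by rewrite ltrD.
Qed.

(** [L] may be unbounded and the measures [mus k] may charge points far away. The truncation [g] of
    [L(., mu)] is bounded and continuous, agrees with it [mu]-almost everywhere, and stays below
    [L(., mus k) + e / 2]: by uniform convergence on [K], and off [K] because [g] vanishes there and
    [L] is nonnegative. *)
Lemma cost_lsc (mus : nat -> probability rV R) mu (r : R) :
  (forall k, P1 (mus k)) -> P1 mu -> mu (~` [set z | `|z| <= r]) = 0%E ->
  narrow_cvg mus mu ->
  (\int[mu]_z (L z mu)%:E <= limn_einf (fun k => \int[mus k]_z (L z (mus k))%:E))%E.
Proof.
move=> P1s P1mu murr nc.
have r10 : 0 < (`|r| + 1) *+ 2 :> R by rewrite pmulrn_lgt0// ltr_wpDl.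
pose chi := @hat R n ((`|r| + 1) *+ 2) 0.
have chi1 z : `|z| <= r -> chi z = 1.
  move=> zr; apply: hat_eq1 => //; rewrite subr0 -[_ *+ 2]mulr_natr mulfK ?pnatr_eq0//.
  by rewrite (le_trans zr)// (le_trans (ler_norm _))// lerDl.
pose K := [set z : rV | `|z| <= (`|r| + 1) *+ 2].
have chi0 z : ~ K z -> chi z = 0.
  move=> /negP; rewrite -ltNge => zr; apply: hat_eq0 => //.
  by rewrite subr0 ltW.
have chi01 z : 0 <= chi z <= 1 by exact: hat01.
pose g z := chi z * L z mu.
have cchi : continuous chi by move=> z; exact: continuous_hat.
have cLmu := @cL _ P1mu.
have cg : continuous g.
  by move=> z; apply: (@continuousM _ _ chi (L ^~ mu)); [exact: cchi|exact: cLmu].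
have cK : compact K by exact: compact_norm_le.
have [M gM] : exists M, forall z, `|g z| <= M.
  have /compact_bounded[M0 [_ hM]] := continuous_compact (continuous_subspaceT cg) cK.
  exists (`|M0| + 1) => z; have [Kz|Kz] := pselect (K z).
    apply: (hM (`|M0| + 1)); last by exists z.
    by rewrite (le_lt_trans (ler_norm _))// ltrDl.
  by rewrite /g chi0// mul0r normr0 addr_ge0.
have mg : measurable_fun setT g by exact: continuous_measurable_mx.
have g0 z : 0 <= g z by rewrite mulr_ge0 ?L0//; have /andP[] := chi01 z.
have mK : measurable [set z : rV | `|z| <= r].
  by apply: measurable_compact_rV; exact: compact_norm_le.
have le1 : (\int[mu]_z (L z mu)%:E <= \int[mu]_z (g z)%:E)%E.
  apply: (le_lower_integral_ae (measurableC mK) murr) => z [_ /= /contrapT zr].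
  by rewrite /g chi1// mul1r.
apply: (le_trans le1).
have ig := integrable_bounded_probability mu mg gM.
have -> : (\int[mu]_z (g z)%:E = ((\int[mu]_z g z)%R)%:E)%E.
  by rewrite /Rintegral fineK//; exact: integrable_fin_num ig.
apply/lee_addgt0Pr => e e0; rewrite -leeBlDr//.
have e20 : 0 < e / 2 by rewrite divr_gt0.
apply: near_le_limn_einf.
have /cvgrPdist_le /(_ _ e20) := nc g cg (ex_intro _ M gM).
have := unifL P1s P1mu nc cK e20.
apply: filterS2 => k h1 h2.
have igk := integrable_bounded_probability (mus k) mg gM.
apply: (@le_trans _ _ (((\int[mus k]_z g z)%R)%:E - (e / 2)%:E)%E).
  rewrite -!EFinB lee_fin; move: h2; rewrite ler_norml => /andP[]; lra.
rewrite leeBlDr//.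
have E1 : (\int[mus k]_z (cst (e / 2)%:E) z = (e / 2)%:E)%E.
  by rewrite integral_cst//; have := probability_setT (mus k) => /= ->; rewrite mule1.
rewrite -[X in (_ <= _ + X)%E]E1 -ge0_integralD//; last 3 first.
- by move=> z _; rewrite lee_fin L0.
- apply/measurable_EFinP; apply: continuous_measurable_mx; exact: cL.
- by move=> z _; rewrite lee_fin ltW.
rewrite /Rintegral fineK; last exact: integrable_fin_num igk.
apply: ge0_le_lower_integral => z _; rewrite lee_fin//.
have Lk0 := L0 z (P1s k); have [Kz|Kz] := pselect (K z); last first.
  by rewrite /g chi0// mul0r addr_ge0// ltW.
have := h1 z Kz; rewrite ltr_norml => /andP[h3 _].
have /andP[c0 c1] := chi01 z; have Lmu0 := L0 z P1mu.
by rewrite /g (@le_trans _ _ (L z mu)) ?ler_piMl//; lra.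
Qed.

End empirical_measures.

(** * From continuity on the time interval to continuity on the line *)

Section clamp.
Context {R : realType}.
Variable T : R.
Hypothesis T0 : 0 < T.

(* Composition with [clamp] turns continuity on [[0, T]] into continuity on the
   line, and thus gives measurability in time. *)
Definition clamp (t : R) : R := Num.max 0 (Num.min t T).

Lemma clamp_in t : clamp t \in `[0, T].
Proof. by rewrite in_itv/= /clamp le_max lexx ge_max (ltW T0) ge_min lexx orbT. Qed.

Lemma clamp_id t : t \in `[0, T] -> clamp t = t.
Proof. by rewrite in_itv/= => /andP[t0 tT]; rewrite /clamp min_l// max_r. Qed.

Lemma clamp_dist s t : `|clamp s - clamp t| <= `|s - t|.
Proof.
have h x y : x <= y -> 0 <= clamp y - clamp x <= y - x.
  move=> xy; rewrite /clamp.
  have [h1|h1] := leP x T; have [h2|h2] := leP y T;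
  have [h3|h3] := leP 0 x; have [h4|h4] := leP 0 y; have T0' := T0;
  rewrite ?(max_r h3) ?(max_l (ltW h3)) ?(max_r h4) ?(max_l (ltW h4)) ?(max_r (ltW T0));
  apply/andP; split; lra.
have [st|st] := leP s t.
  have /andP[h1 h2] := h _ _ st.
  by rewrite distrC (distrC s) !ger0_norm// subr_ge0.
have /andP[h1 h2] := h _ _ (ltW st).
by rewrite !ger0_norm// subr_ge0 ltW.
Qed.

Lemma continuous_clamp_comp (V : normedModType R) (g : R -> V) :
  (forall t, t \in `[0, T] -> forall e, 0 < e -> exists2 delta : R, 0 < delta &
    forall s, s \in `[0, T] -> `|s - t| < delta -> `|g s - g t| < e) ->
  continuous (g \o clamp).
Proof.
move=> hg t; apply/cvgrPdist_lt => e e0.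
have [dl dl0 h] := hg _ (clamp_in t) e e0.
exists dl => //= s ts; rewrite distrC; apply: h; first exact: clamp_in.
by rewrite (le_lt_trans (clamp_dist _ _))// distrC.
Qed.

Lemma abs_continuous_clamp n (g : R -> 'rV[R]_n) :
  abs_continuous T g -> continuous (g \o clamp).
Proof.
move=> acg; apply: continuous_clamp_comp => t tT e e0.
have [dl dl0 h] := acg e e0; exists dl => // s sT std.
wlog ts : s t sT tT std / t <= s.
  move=> H; have [ts|/ltW st] := leP t s; first exact: H.
  by rewrite distrC; apply: H => //; rewrite distrC.
have := h 1%N (fun=> t) (fun=> s).
rewrite !big_ord1 => H; apply: (le_lt_trans (le_norm_enorm _)); apply: H.
- move=> _; move: tT sT; rewrite !in_itv/= => /andP[-> _] /andP[_ ->].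
  by split.
- by move=> i j; rewrite !ord1 eqxx.
- by rewrite (le_lt_trans (ler_norm _)).
Qed.

End clamp.

Lemma continuous_rVP {R : realType} {n : nat} (g : 'rV[R]_n -> R) :
  (forall y e, 0 < e -> exists2 r : R, 0 < r &
    forall x, `|y - x| < r -> `|g y - g x| < e) -> continuous g.
Proof.
move=> h y; apply: (proj2 (@cvgrPdist_lt _ _ _ _ (nbhs_filter y) g (g y))) => e e0.
have [r r0 hr] := h y e e0; apply/nbhs_ballP; exists r => //= x.
by rewrite -ball_normE; exact: hr.
Qed.

(** * Growth and Lipschitz bounds for the control cost *)

Section running_cost.
Context {R : realType} {n d : nat}.
Variables (q Cpsi : R) (psi : 'rV[R]_d -> R).
Hypothesis Cpsi0 : 0 <= Cpsi.
Hypothesis Lip_psi : forall r : R, 0 < r ->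
  (Lip Num.norm psi (eball 0 r) <= (Cpsi * r `^ (q - 1))%:E)%E.

Lemma psi_lip r x y : enorm x < r -> enorm y < r ->
  `|psi x - psi y| <= Cpsi * r `^ (q - 1) * enorm (x - y).
Proof.
move=> xr yr; have r0 : 0 < r by rewrite (le_lt_trans (enorm_ge0 x)).
have [->|xy] := eqVneq x y; first by rewrite !subrr enorm0 normr0 mulr0.
have exy : 0 < enorm (x - y).
  by rewrite (lt_le_trans _ (le_norm_enorm _))// normr_gt0 subr_eq0.
rewrite -ler_pdivrMr// -lee_fin; apply: le_trans (Lip_psi r0).
by apply: ereal_sup_ubound; exists x, y; rewrite /eball /= !subr0.
Qed.

Lemma continuous_psi : continuous psi.
Proof.
(* A ball of this radius contains [y] and every [x] within sup distance 1 of it; [d] comes from the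
   norm comparison and 2 from the weak triangle inequality. *)
apply: continuous_rVP => y e e0; pose r := 2 * (d%:R + enorm y) + 1.
have ynn := enorm_ge0 y.
have yr : enorm y < r by rewrite /r; have : 0 <= d%:R :> R by []; lra.
pose c := Cpsi * r `^ (q - 1) * d%:R.
have c0 : 0 <= c by rewrite !mulr_ge0// powR_ge0.
exists (Num.min 1 (e / (c + 1))); first by rewrite lt_min ltr01 divr_gt0// ltr_wpDl.
move=> x; rewrite lt_min => /andP[xy1 xy2].
have exy : enorm (y - x) <= d%:R * `|y - x|.
  by have := le_enorm_norm (y - x); rewrite mul1n.
have xr : enorm x < r.
  have -> : x = - (y - x) + y by rewrite opprB subrK.
  apply: (le_lt_trans (enormD_le _ _)); rewrite enormN /r.
  have : d%:R * `|y - x| <= d%:R by rewrite ler_piMr// ltW.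
  lra.
apply: (le_lt_trans (psi_lip yr xr)).
apply: (@le_lt_trans _ _ (c * `|y - x|)).
  by rewrite /c -[leRHS]mulrA ler_wpM2l// mulr_ge0// powR_ge0.
apply: (@le_lt_trans _ _ ((c + 1) * `|y - x|)); first by rewrite ler_wpM2r// lerDl.
by rewrite mulrC -ltr_pdivlMr// ltr_wpDl.
Qed.

(** [g] sends the ball of radius [r] into one of radius proportional to [l], where [psi] has
    Lipschitz constant of order [l^(q - 1)]; the Lipschitz constant of [g] supplies the last factor
    of [l^q]. The extra 1 makes the inclusion strict. *)
Lemma psi_growth_lip (g : 'rV[R]_n -> 'rV[R]_d) l r y z : growth g l ->
  enorm y <= r -> enorm z <= r ->
  `|psi (g z) - psi (g y)| <=
    Cpsi * (2 * (1 + r) + 1) `^ (q - 1) * l `^ q * enorm (z - y).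
Proof.
move=> gr yr zr; have [l0 _ gL] := gr.
have r0 : 0 <= r by apply: le_trans yr; exact: enorm_ge0.
have c0 : 0 < 2 * (1 + r) + 1 by lra.
(* For [l = 0] the target ball has radius 0 and is empty, but then [g] is constant. *)
have [l00|lpos] := eqVneq l 0.
  have -> : g z = g y.
    apply/eqP; rewrite -subr_eq0 -normr_le0 (le_trans (le_norm_enorm _))//.
    by have := gL z y; rewrite l00 mul0r.
  by rewrite subrr normr0 !mulr_ge0 ?powR_ge0 ?enorm_ge0.
have lp : 0 < l by rewrite lt_neqAle eq_sym lpos.
have bnd u : enorm u <= r -> enorm (g u) < (2 * (1 + r) + 1) * l.
  move=> ur; apply: (le_lt_trans (growth_le u gr)); nra.
apply: (le_trans (psi_lip (bnd _ zr) (bnd _ yr))).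
rewrite powRM ?(ltW c0)// -!mulrA ler_wpM2l// ler_wpM2l ?powR_ge0//.
have -> : l `^ q = l `^ (q - 1) * l.
  rewrite -{3}[l]powRr1// -powRD ?subrK// lpos implybT//.
by rewrite -mulrA ler_wpM2l ?powR_ge0.
Qed.

Lemma psi_growth_le (g : 'rV[R]_n -> 'rV[R]_d) l r z : growth g l ->
  enorm z <= r -> psi (g z) <= psi 0 + Cpsi * (2 * (1 + r) + 1) `^ q * l `^ q.
Proof.
move=> gr zr; have [l0 _ gL] := gr.
have r0 : 0 <= r by apply: le_trans zr; exact: enorm_ge0.
have c0 : 0 < 2 * (1 + r) + 1 by lra.
have gz := growth_le z gr.
have [l00|lpos] := eqVneq l 0.
  have -> : g z = 0.
    apply/eqP; rewrite -normr_le0 (le_trans (le_norm_enorm _))//.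
    by move: gz; rewrite l00 mulr0 mul0r.
  by rewrite lerDl !mulr_ge0 ?powR_ge0.
have lp : 0 < l by rewrite lt_neqAle eq_sym lpos.
have cl0 : 0 < (2 * (1 + r) + 1) * l by rewrite mulr_gt0.
have bnd : enorm (g z) < (2 * (1 + r) + 1) * l by apply: (le_lt_trans gz); nra.
have b0 : enorm (0 : 'rV[R]_d) < (2 * (1 + r) + 1) * l by rewrite enorm0.
have := psi_lip bnd b0; rewrite subr0 -lerBlDl => h.
apply: (le_trans (ler_norm _)); apply: (le_trans h).
rewrite -[leRHS]mulrA -powRM ?(ltW c0)// -[leLHS]mulrA ler_wpM2l//.
set s := _ * l in cl0 bnd *.
have -> : s `^ q = s `^ (q - 1) * s.
  by rewrite -{3}[s]powRr1 ?ltW// -powRD ?subrK// (gt_eqF cl0) implybT.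
by rewrite ler_wpM2l ?powR_ge0// ltW.
Qed.

End running_cost.

Lemma convex_function_segment {R : realType} {d : nat} (psi : 'rV[R]_d -> R) :
  convex_function setT psi -> forall (s : R) x y, 0 <= s -> s <= 1 ->
  psi (x + s *: (y - x)) <= (1 - s) * psi x + s * psi y.
Proof.
move=> cpsi s x y s0 s1.
have := cpsi (Itv01 s0 s1) y x; rewrite !in_setT => /(_ isT isT).
rewrite convRE /= => h; rewrite [leRHS]addrC; apply: (le_trans _ h).
by rewrite le_eqVlt; apply/orP; left; apply/eqP; congr psi;
  rewrite /conv /= scalerBr scalerBl scale1r addrCA.
Qed.

(** * Lower semicontinuity of the total cost *)

Section total_cost.
Context {R : realType} {n d : nat}.
Variables (T q Cpsi : R) (ell : R -> R) (psi : 'rV[R]_d -> R).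
Hypotheses (T0 : 0 < T) (q1 : 1 <= q) (ellq : in_Lq q T ell).
Hypotheses (psi0 : forall y, 0 <= psi y) (convex_psi : convex_function setT psi).
Hypothesis Cpsi0 : 0 <= Cpsi.
Hypothesis Lip_psi : forall r : R, 0 < r ->
  (Lip Num.norm psi (eball 0 r) <= (Cpsi * r `^ (q - 1))%:E)%E.
Local Notation I := (`[0, T]%classic : set (time R)).

Let mI : measurable I. Proof. exact: measurable_segment. Qed.

Let cpsi : continuous psi. Proof. exact: continuous_psi Cpsi0 Lip_psi. Qed.

Lemma measurable_psi_control (g : R -> 'rV[R]_n -> 'rV[R]_d) z : admissible T ell g ->
  measurable_fun I (fun t => psi (g t z)).
Proof.
move=> [[mg _] _]; apply: (measurableT_comp (continuous_measurable_mx cpsi)).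
exact: mg.
Qed.

Lemma psi_control_fin (g : R -> 'rV[R]_n -> 'rV[R]_d) z : admissible T ell g ->
  (\int[dt]_(t in I) (psi (g t z))%:E < +oo)%E.
Proof.
move=> adg; have [N [mN N0 hN]] := admissible_growth adg.
pose C := Cpsi * (2 * (1 + enorm z) + 1) `^ q.
have C0 : 0 <= C by rewrite mulr_ge0// powR_ge0.
have i0 : dt.-integrable I (EFin \o (fun=> psi 0)).
  apply: measurable_bounded_integrable => //; first exact: dt_segment_fin.
  exact: bounded_cst.
have i1 : dt.-integrable I (EFin \o (fun t => psi 0 + C * `|ell t| `^ q)).
  exact: (integrableD mI i0 (integrableZl mI C (integrable_ellq ellq))).
apply: (@le_lt_trans _ _ (\int[dt]_(t in I) (psi 0 + C * `|ell t| `^ q)%:E)%E).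
  apply: (le_lower_integral_ae mN N0) => t [tI tN].
  have gr : growth (g t) (ell t).
    by apply: contrapT => h; apply: tN; apply: hN => /= /(_ tI).
  have [l0 _ _] := gr; rewrite lee_fin (ger0_norm l0).
  exact: (psi_growth_le Cpsi0 Lip_psi gr (lexx _)).
by have := integrable_fin_num mI i1; rewrite fin_numElt => /andP[].
Qed.

Lemma control_weak_lsc (fs : nat -> R -> 'rV[R]_n -> 'rV[R]_d) f z (w : R -> R) (e : R) :
  (forall k, admissible T ell (fs k)) -> admissible T ell f ->
  (forall A j, measurable A -> A `<=` I ->
    (\int[dt]_(t in A) fs k t z ord0 j)%R @[k --> \oo] -->
      (\int[dt]_(t in A) f t z ord0 j)%R) ->
  continuous w -> (forall t, 0 <= w t <= 1) -> 0 < e ->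
  \forall k \near \oo, (\int[dt]_(t in I) (w t * psi (f t z))%:E <=
    \int[dt]_(t in I) (w t * psi (fs k t z))%:E + e%:E)%E.
Proof.
move=> adfs adf fsf cw w01 e0.
have [P [P_le P_sup]] := countable_affine_minorants psi0 cpsi
  (convex_function_segment convex_psi).
(* Controls are measurable only on [[0, T]]; extension by zero gives the measurability on the whole
   line that the abstract result asks for. *)
pose ext (g : R -> 'rV[R]_n -> 'rV[R]_d) (t : time R) := if t \in I then g t z else 0.
have extE g t : I t -> ext g t = g t z by move=> It; rewrite /ext mem_set.
have mext g i : admissible T ell g -> measurable_fun setT (fun t => ext g t ord0 i).
  move=> [[mg _] _].
  rewrite (_ : (fun t => _) = (fun t => g t z ord0 i) \_ I).
    apply/(measurable_restrictT _ mI).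
    exact: (measurableT_comp (measurable_entry _ _) (mg z)).
  by apply/funext => t; rewrite patchE /ext; case: ifP => //; rewrite mxE.
have iext g i : admissible T ell g ->
    dt.-integrable I (EFin \o (fun t => ext g t ord0 i)).
  move=> adg; apply: eq_integrable (integrable_control q1 ellq z i adg) => //.
  by move=> t /set_mem It /=; rewrite extE.
have cext A i : measurable A -> A `<=` I ->
    (\int[dt]_(t in A) ext (fs k) t ord0 i)%R @[k --> \oo] -->
      (\int[dt]_(t in A) ext f t ord0 i)%R.
  move=> mA AI; have E g : (\int[dt]_(t in A) ext g t ord0 i)%R =
      (\int[dt]_(t in A) g t z ord0 i)%R.
    by apply: eq_Rintegral => t /set_mem/AI/extE ->.
  rewrite E; under eq_fun do rewrite E; exact: fsf.
have fin : (\int[dt]_(t in I) (psi (ext f t))%:E < +oo)%E.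
  rewrite (eq_integral (fun t : time R => (psi (f t z))%:E)).
    exact: psi_control_fin.
  by move=> t /set_mem/extE ->.
have := weighted_weak_lsc mI (dt_segment_fin T) (fun k i => mext _ i (adfs k))
  (fun i => mext _ i adf) (fun k i => iext _ i (adfs k)) (fun i => iext _ i adf)
  cext psi0 cpsi P_le P_sup (continuous_measurable_time cw) w01 e0 fin.
apply: filterS => k.
rewrite (eq_integral (fun t : time R => (w t * psi (f t z))%:E)); last first.
  by move=> t /set_mem/extE ->.
rewrite [X in (_ <= X + _)%E](eq_integral (fun t : time R => (w t * psi (fs k t z))%:E))//.
by move=> t /set_mem/extE ->.
Qed.

Variable L : 'rV[R]_n -> probability 'rV[R]_n R -> R.
Hypothesis L0 : forall z nu, P1 nu -> 0 <= L z nu.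
Hypothesis cL : forall nu, P1 nu -> continuous (L ^~ nu).
Hypothesis unifL : forall (nus : nat -> probability 'rV[R]_n R) nu,
  (forall j, P1 (nus j)) -> P1 nu -> narrow_cvg nus nu ->
  forall K : set 'rV[R]_n, compact K -> forall e : R, 0 < e ->
    \forall j \near \oo, forall z, K z -> `|L z (nus j) - L z nu| < e.

Variable r : R.
Let K : set 'rV[R]_n := [set z | `|z| <= r].
(** The Euclidean radius of the sup-norm ball of radius [|r| + 1], which contains every point within
    [dl <= 1] of a centre. [C1] and [C2] are the Lipschitz and growth constants of the control cost
    at this radius. *)
Let rho : R := n%:R * (`|r| + 1).
Let C1 := Cpsi * (2 * (1 + rho) + 1) `^ (q - 1).
Let C2 := Cpsi * (2 * (1 + rho) + 1) `^ q.

Let cK : compact K. Proof. exact: compact_norm_le. Qed.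
Let C10 : 0 <= C1. Proof. by rewrite mulr_ge0// powR_ge0. Qed.
Let C20 : 0 <= C2. Proof. by rewrite mulr_ge0// powR_ge0. Qed.

(** * The cost at a fixed time *)

Section pointwise.
Variables (c : nat -> 'rV[R]_n) (N : nat) (dl : R).
Hypotheses (cen : forall i, (i < N)%N -> K (c i)) (dl0 : 0 < dl) (dl1 : dl <= 1).
Variables (g : 'rV[R]_n -> 'rV[R]_d) (l : R).
Hypotheses (cg : continuous g) (gl : growth g l).
Variable nu : probability 'rV[R]_n R.
Hypothesis P1nu : P1 nu.

Let cpsig : continuous (psi \o g).
Proof. by move=> z; apply: continuous_comp; [exact: cg|exact: cpsi]. Qed.

Let le_rho (z : 'rV[R]_n) : `|z| <= `|r| + 1 -> enorm z <= rho.
Proof.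
by move=> zr; rewrite (le_trans (le_enorm_norm z))// mul1n ler_wpM2l.
Qed.

Let cen_rho i : (i < N)%N -> enorm (c i) <= rho.
Proof.
move=> /cen ci; apply: le_rho; rewrite (le_trans ci)//.
by rewrite (le_trans (ler_norm r))// lerDl.
Qed.

Let osc i z : (i < N)%N -> `|z - c i| < dl ->
  `|(psi \o g) z - (psi \o g) (c i)| <= C1 * (n%:R * dl) * l `^ q.
Proof.
move=> iN zc.
have zr : `|z| <= `|r| + 1.
  rewrite -[z](subrK (c i)) (le_trans (ler_normD _ _))// addrC lerD//.
    by rewrite (le_trans (cen iN))// ler_norm.
  by rewrite (le_trans (ltW zc)).
apply: (le_trans (psi_growth_lip Cpsi0 Lip_psi gl (cen_rho iN) (le_rho zr))).
rewrite [leRHS]mulrAC; apply: ler_wpM2l; first by rewrite mulr_ge0// powR_ge0.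
by rewrite (le_trans (le_enorm_norm _))// mul1n ler_wpM2l// ltW.
Qed.

Let kap0 : 0 <= C1 * (n%:R * dl) * l `^ q.
Proof. by rewrite !mulr_ge0 ?powR_ge0// ltW. Qed.

Let split_cost : (\int[nu]_z (L z nu + psi (g z))%:E =
  \int[nu]_z (L z nu)%:E + \int[nu]_z (psi (g z))%:E)%E.
Proof.
rewrite -ge0_integralD//.
- by move=> z _; rewrite lee_fin L0.
- by apply/measurable_EFinP; apply: continuous_measurable_mx; exact: cL.
- by move=> z _; rewrite lee_fin.
- by apply/measurable_EFinP; exact: continuous_measurable_mx cpsig.
Qed.

(** The [m i] will be the weights of the limit measure, within [e] of those of [nu]. Exchanging one
    weight costs [e] times [psi (g (c i))], which is at most [psi 0 + C2 * l^q]. *)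
Lemma cost_upper_pou (m : nat -> R) (e : R) : 0 <= e ->
  (forall i, (i < N)%N -> `|(\int[nu]_z pou dl c i z)%R - m i| <= e) ->
  (\int[nu]_z (L z nu)%:E + (\sum_(i < N) m i * psi (g (c i)))%:E <=
   \int[nu]_z (L z nu + psi (g z))%:E +
     (C1 * (n%:R * dl) * l `^ q + N%:R * e * (psi 0 + C2 * l `^ q))%:E)%E.
Proof.
move=> e0 he; rewrite split_cost -addeA leeD2l// EFinD addeA.
apply: (@le_trans _ _ ((\sum_(i < N) (\int[nu]_z pou dl c i z)%R * psi (g (c i)))%:E
    + (N%:R * e * (psi 0 + C2 * l `^ q))%:E)%E).
  rewrite -EFinD lee_fin.
  have -> : N%:R * e * (psi 0 + C2 * l `^ q) = \sum_(i < N) e * (psi 0 + C2 * l `^ q).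
    by rewrite sumr_const card_ord -[RHS]mulr_natl mulrA.
  rewrite -big_split /=; apply: ler_sum => i _.
  have := he i (ltn_ord i); rewrite ler_norml => /andP[h1 _].
  have h2 := psi_growth_le Cpsi0 Lip_psi gl (cen_rho (ltn_ord i)).
  have h3 := ler_wpM2l e0 h2; rewrite -/C2 in h3.
  rewrite -lerBlDl -mulrBl; apply: le_trans h3.
  by rewrite ler_wpM2r//; lra.
rewrite leeD2r//.
exact: (pou_integral_le dl0 cpsig (fun z => psi0 (g z)) kap0 osc nu).
Qed.

Lemma cost_lower_pou : nu (~` K) = 0%E ->
  (forall z, K z -> \sum_(i < N) pou dl c i z = 1) ->
  (\int[nu]_z (L z nu + psi (g z))%:E <=
   \int[nu]_z (L z nu)%:E +
    (\sum_(i < N) (\int[nu]_z pou dl c i z)%R * psi (g (c i))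
      + C1 * (n%:R * dl) * l `^ q)%:E)%E.
Proof.
move=> nuK sK; rewrite split_cost leeD2l// EFinD.
exact: (pou_integral_ge dl0 (fun z => psi0 (g z)) kap0 osc
  (measurable_compact_rV cK) nuK sK).
Qed.

End pointwise.

Variables (mus : nat -> R -> probability 'rV[R]_n R) (mu : R -> probability 'rV[R]_n R).
Variables (fs : nat -> R -> 'rV[R]_n -> 'rV[R]_d) (f : R -> 'rV[R]_n -> 'rV[R]_d).
Hypothesis P1s : forall k t, P1 (mus k t).
Hypothesis P1mu : forall t, t \in `[0, T] -> P1 (mu t).
Hypothesis muK : forall t, t \in `[0, T] -> mu t (~` K) = 0%E.
Hypothesis cmu : forall t, t \in `[0, T] -> forall e : R, 0 < e ->
  exists2 delta : R, 0 < delta & forall s, s \in `[0, T] -> `|s - t| < delta ->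
    (W1 (mu s) (mu t) < e%:E)%E.
Hypothesis cvg_mus : forall e : R, 0 < e ->
  \forall k \near \oo, forall t, t \in `[0, T] -> (W1 (mus k t) (mu t) < e%:E)%E.
Hypothesis mcost : forall k,
  measurable_fun I (fun t => \int[mus k t]_z (L z (mus k t))%:E)%E.
Hypotheses (adfs : forall k, admissible T ell (fs k)) (adf : admissible T ell f).
Hypothesis cvg_fs : forall z A j, measurable A -> A `<=` I ->
  (\int[dt]_(t in A) fs k t z ord0 j)%R @[k --> \oo] -->
    (\int[dt]_(t in A) f t z ord0 j)%R.

Lemma cvg_integral_mus (g : 'rV[R]_n -> R) (M e : R) :
  continuous g -> (forall z, `|g z| <= M) -> 0 < e ->
  \forall k \near \oo, forall t, t \in `[0, T] ->
    `|(\int[mus k t]_z g z)%R - (\int[mu t]_z g z)%R| <= e.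
Proof.
move=> cg gM e0; have [w w0 h] := W1_integral_modulus cK cg gM e0.
by apply: filterS (cvg_mus w0) => k hk t tT; rewrite ltW// h// ?muK// hk.
Qed.

Lemma continuous_integral_mu (g : 'rV[R]_n -> R) (M : R) :
  continuous g -> (forall z, `|g z| <= M) ->
  continuous (fun t => (\int[mu (clamp T t)]_z g z)%R).
Proof.
move=> cg gM.
apply: (@continuous_clamp_comp R T T0 R^o (fun t => (\int[mu t]_z g z)%R)).
move=> t tT e e0; have [w w0 h] := W1_integral_modulus cK cg gM e0.
have [dl dl0 hdl] := cmu tT w0; exists dl => // s sT st.
by rewrite h// ?muK// hdl.
Qed.

Let w t : R := `|ell t| `^ q.
Let Lam : R := (\int[dt]_(t in I) w t)%R.
Let T' : R := fine (dt I).

Let T'0 : 0 <= T'. Proof. by rewrite fine_ge0. Qed.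

Let Lam0 : 0 <= Lam. Proof. by apply: Rintegral_ge0 => t _; exact: powR_ge0. Qed.

Let measurable_affine a b : measurable_fun I (fun t => a + b * w t).
Proof.
have mw : measurable_fun I w.
  by apply/measurable_EFinP; have /integrableP[] := integrable_ellq ellq.
by apply: measurable_funD; [exact: measurable_cst|apply: measurable_funM].
Qed.

Let integral_affine a b : (\int[dt]_(t in I) (a + b * w t)%:E)%E = (a * T' + b * Lam)%:E.
Proof.
have i0 : dt.-integrable I (EFin \o (fun=> a)).
  apply: measurable_bounded_integrable => //; first exact: dt_segment_fin.
  exact: bounded_cst.
have iw := integrable_ellq ellq.
have ib : dt.-integrable I (EFin \o (fun t => b * w t)) by exact: (integrableZl mI b iw).
have iab : dt.-integrable I (EFin \o (fun t => a + b * w t)) by exact: (integrableD mI i0 ib).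
have := RintegralD mI i0 ib; rewrite RintegralZl// Rintegral_cst// => <-.
by rewrite /Rintegral fineK//; exact: integrable_fin_num iab.
Qed.

Let cost k t := (\int[mus k t]_z (L z (mus k t))%:E)%E.

Let cost_ge0 k t : (0 <= cost k t)%E.
Proof. by apply: integral_ge0 => z _; rewrite lee_fin L0. Qed.

(** * Time integrals for a fixed partition of unity *)

Section discretized.
Variables (c : nat -> 'rV[R]_n) (N : nat) (dl : R).
Hypotheses (cen : forall i, (i < N)%N -> K (c i)) (dl0 : 0 < dl) (dl1 : dl <= 1).

(* The weights [m i] come from the limit measure, so that [S (fs k)] depends on
   [k] only through the controls evaluated at finitely many points. *)
Let m i t := (\int[mu (clamp T t)]_z pou dl c i z)%R.
Let S (g : R -> 'rV[R]_n -> 'rV[R]_d) t := \sum_(i < N) m i t * psi (g t (c i)).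

Let pou_bnd i z : `|pou dl c i z| <= 1.
Proof. by rewrite ger0_norm ?pou_ge0// pou_le1. Qed.

Let cpou i : continuous (pou dl c i).
Proof. by move=> z; exact: continuous_pou. Qed.

Let cm i : continuous (m i).
Proof. exact: (continuous_integral_mu (@cpou i) (pou_bnd i)). Qed.

Let m01 i t : 0 <= m i t <= 1.
Proof.
have mp : measurable_fun setT (pou dl c i) by exact: continuous_measurable_mx.
have ip := integrable_bounded_probability (mu (clamp T t)) mp (pou_bnd i).
rewrite -!lee_fin /m /Rintegral fineK; last exact: integrable_fin_num ip.
rewrite integral_ge0/=; last by move=> z _; rewrite lee_fin pou_ge0.
apply: (@le_trans _ _ (\int[mu (clamp T t)]_z (cst 1%:E) z)%E).
  by apply: le_lower_integral => z _; rewrite lee_fin pou_le1.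
by rewrite integral_cst//= mul1e probability_le1.
Qed.

Let S0 g t : 0 <= S g t.
Proof. by apply: sumr_ge0 => i _; rewrite mulr_ge0//; have /andP[] := m01 i t. Qed.

Let mmpsi i g : admissible T ell g -> measurable_fun I (fun t => m i t * psi (g t (c i))).
Proof.
move=> adg; apply: measurable_funM; first exact: (continuous_measurable_time (@cm i)).
exact: measurable_psi_control.
Qed.

Let mS g : admissible T ell g -> measurable_fun I (S g).
Proof. by move=> adg; apply: measurable_sum => i; exact: mmpsi. Qed.

Let integral_S g : admissible T ell g -> (\int[dt]_(t in I) (S g t)%:E =
  \sum_(i < N) \int[dt]_(t in I) (m i t * psi (g t (c i)))%:E)%E.
Proof.
move=> adg.
rewrite (eq_integral (fun t : time R => \sum_(i < N) (m i t * psi (g t (c i)))%:E)%E).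
  2: by move=> t _; rewrite sumEFin.
apply: ge0_integral_sum; first exact: mI.
- by move=> i; apply/measurable_EFinP; exact: mmpsi.
- by move=> i t _; rewrite lee_fin mulr_ge0//; have /andP[] := m01 i t.
Qed.

Lemma discretized_cost_fin : (\int[dt]_(t in I) (S f t)%:E)%E \is a fin_num.
Proof.
rewrite ge0_fin_numE; last by apply: integral_ge0 => t _; rewrite lee_fin.
rewrite integral_S//; apply: lte_sum_pinfty => i _.
apply: (le_lt_trans _ (psi_control_fin (c i) adf)).
apply: le_lower_integral => t _; rewrite lee_fin ler_piMl//.
by have /andP[] := m01 i t.
Qed.

Let S_lsc (e : R) : 0 < e -> \forall k \near \oo,
  (\int[dt]_(t in I) (S f t)%:E <= \int[dt]_(t in I) (S (fs k) t)%:E + (N%:R * e)%:E)%E.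
Proof.
move=> e0.
have := filter_forall eventually_filter (fun i : 'I_N => control_weak_lsc adfs adf (@cvg_fs (c i))
  (@cm i) (m01 i) e0).
apply: filterS => k hk; rewrite !integral_S//.
have -> : N%:R * e = \sum_(i < N) e by rewrite sumr_const card_ord mulr_natl.
by rewrite -sumEFin -big_split /=; apply: lee_sum => i _; exact: hk.
Qed.

Let kap := C1 * (n%:R * dl).

(** At almost every time the limit integrand is at most the lower limit of the Lagrangian costs plus
    the discretized control cost plus the mesh error [kap * ell^q]; Fatou's lemma then treats the
    first term. *)
Lemma total_cost_lower : (forall z, K z -> \sum_(i < N) pou dl c i z = 1) ->
  (\int[dt]_(t in I) \int[mu t]_z (L z (mu t) + psi (f t z))%:E <=
   limn_einf (fun k => \int[dt]_(t in I) cost k t) +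
     (\int[dt]_(t in I) (S f t)%:E + (kap * Lam)%:E))%E.
Proof.
move=> sK; have [_ cf] := adf.1; have [Z [mZ Z0 hZ]] := admissible_growth adf.
apply: (@le_trans _ _ (\int[dt]_(t in I)
    (limn_einf (cost ^~ t) + (S f t + kap * w t)%:E))%E).
  apply: (le_lower_integral_ae mZ Z0) => t [tI tZ].
  have gr : growth (f t) (ell t).
    by apply: contrapT => h; apply: tZ; apply: hZ => /= /(_ tI).
  apply: (le_trans (cost_lower_pou cen dl0 dl1 (cf t tI) gr (P1mu tI) (muK tI) sK)).
  rewrite /S /w /m clamp_id//; have [l0 _ _] := gr; rewrite (ger0_norm l0) leeD2r//.
  apply: (cost_lsc L0 cL unifL (fun k => P1s k t) (P1mu tI) (muK tI)).
  apply: (W1_narrow_cvg cK (muK tI)) => e e0.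
  by apply: filterS (cvg_mus e0) => k; exact.
have w0 t : 0 <= kap * w t by rewrite !mulr_ge0 ?powR_ge0// ltW.
have mw : measurable_fun I (fun t => kap * w t).
  rewrite (_ : (fun t => _) = (fun t => 0 + kap * w t)); first exact: measurable_affine.
  by apply/funext => t; rewrite add0r.
have l0 t : I t -> (0 <= limn_einf (cost ^~ t))%E.
  by move=> _; apply: near_le_limn_einf; apply: nearW => k; exact: cost_ge0.
have s0 t : I t -> 0 <= S f t + kap * w t by move=> _; rewrite addr_ge0.
have ms : measurable_fun I (fun t => S f t + kap * w t).
  by apply: measurable_funD => //; exact: mS.
apply: (le_trans (lower_integralD_le dt mI l0 s0 ms)).
apply: leeD; first exact: (fatou dt mI mcost (fun k t _ => cost_ge0 k t)).
under eq_integral do rewrite EFinD.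
rewrite ge0_integralD; [|exact: mI|by move=> t _; rewrite lee_fin| |
  by move=> t _; rewrite lee_fin|exact/measurable_EFinP]; last first.
  by apply/measurable_EFinP; exact: mS.
apply: leeD2l; have := integral_affine 0 kap; rewrite mul0r add0r => <-.
by apply: le_lower_integral => t _; rewrite add0r.
Qed.

(** [N * e2] pays for passing from [f] to [fs k] at the [N] centres, and the terms in [e1] pay for
    the change of weights. The full cost is not known to be measurable in time, so the measurable
    error [E] is detached from it by subadditivity of the lower integral. *)
Lemma total_cost_upper (e1 e2 : R) : 0 < e1 -> 0 < e2 -> \forall k \near \oo,
  (\int[dt]_(t in I) (S f t)%:E + \int[dt]_(t in I) cost k t <=
   (N%:R * e2 + (N%:R * e1 * psi 0 * T' + (kap + N%:R * e1 * C2) * Lam))%:E +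
     \int[dt]_(t in I) \int[mus k t]_z (L z (mus k t) + psi (fs k t z))%:E)%E.
Proof.
move=> e10 e20.
have := filter_forall eventually_filter (fun i : 'I_N =>
  cvg_integral_mus (@cpou i) (pou_bnd i) e10).
apply: filterS2 (S_lsc e20) => k hS hm.
have [_ cf] := (adfs k).1; have [Z [mZ Z0 hZ]] := admissible_growth (adfs k).
apply: (le_trans (leeD2r _ hS)).
rewrite [leLHS]addeAC EFinD -[leRHS]addeA [leRHS]addeC leeD2r// addeC.
rewrite -ge0_integralD; [|exact: mI|by move=> t _; exact: cost_ge0|exact: mcost|
  by move=> t _; rewrite lee_fin|by apply/measurable_EFinP; exact: mS].
pose E t := N%:R * e1 * psi 0 + (kap + N%:R * e1 * C2) * w t.
have a0 : 0 <= N%:R * e1 * psi 0 by rewrite !mulr_ge0// ltW.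
have b0 : 0 <= kap + N%:R * e1 * C2.
  apply: addr_ge0; first by rewrite mulr_ge0// mulr_ge0// ltW.
  by rewrite mulr_ge0// mulr_ge0// ltW.
have E0 t : 0 <= E t by rewrite addr_ge0// mulr_ge0// powR_ge0.
have mE : measurable_fun I E by exact: measurable_affine.
apply: (@le_trans _ _ (\int[dt]_(t in I)
    (\int[mus k t]_z (L z (mus k t) + psi (fs k t z))%:E + (E t)%:E))%E); last first.
  rewrite addeC -integral_affine; apply: lower_integralD_le => //.
  by move=> t _; apply: integral_ge0 => z _; rewrite lee_fin addr_ge0// L0.
apply: (le_lower_integral_ae mZ Z0) => t [tI tZ].
have gr : growth (fs k t) (ell t).
  by apply: contrapT => h; apply: tZ; apply: hZ => /= /(_ tI).
have hm' i : (i < N)%N -> `|(\int[mus k t]_z pou dl c i z)%R - m i t| <= e1.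
  by move=> iN; rewrite /m clamp_id//; exact: (hm (Ordinal iN)).
rewrite addeC.
apply: (le_trans (cost_upper_pou cen dl0 dl1 (cf t tI) gr (P1s k t) (ltW e10) hm')).
rewrite [leRHS]addeC leeD2l// lee_fin le_eqVlt; apply/orP; left; apply/eqP.
by have [l0 _ _] := gr; rewrite /E /w (ger0_norm l0) -/kap; ring.
Qed.

End discretized.

(** The discretized control cost of [f] appears on both sides and links the two bounds. The mesh
    [dl] comes first; it determines [N], on which [e1] and [e2] depend. *)
Theorem total_cost_lsc :
  (\int[dt]_(t in I) \int[mu t]_z (L z (mu t) + psi (f t z))%:E <=
   limn_einf (fun k => \int[dt]_(t in I)
     \int[mus k t]_z (L z (mus k t) + psi (fs k t z))%:E))%E.
Proof.
apply/lee_addgt0Pr => e e0.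
have transfer (A B S : \bar R) (x y : R) : (S + A <= x%:E + B)%E -> x + y <= e ->
    (A + (S + y%:E) <= B + e%:E)%E.
  move=> h xye; rewrite addeA [(A + S)%E]addeC; apply: (le_trans (leeD2r _ h)).
  by rewrite addeAC -EFinD addeC leeD2l// lee_fin.
have e30 : 0 < e / 3 by rewrite divr_gt0.
have small (a x : R) : 0 <= a -> 0 < x -> a * (x / (a + 1)) <= x.
  move=> a0 x0; rewrite mulrCA ler_piMr ?(ltW x0)//.
  by rewrite ler_pdivrMr ?ltr_wpDl// mul1r lerDl.
(* The factor 2 is there because the mesh error [kap * Lam] enters both bounds. *)
pose a := C1 * n%:R * Lam * 2.
have a0 : 0 <= a by rewrite mulr_ge0// mulr_ge0// mulr_ge0.
pose dl := Num.min 1 (e / 3 / (a + 1)).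
have dl0 : 0 < dl by rewrite lt_min ltr01 divr_gt0// ltr_wpDl.
have dl1 : dl <= 1 by rewrite ge_min lexx.
have adl : a * dl <= e / 3.
  by apply: le_trans (small _ _ a0 e30); rewrite ler_wpM2l// ge_min lexx orbT.
have [c [N [cen sK]]] := exists_pou cK dl0.
pose b := N%:R * (psi 0 * T' + C2 * Lam).
have b0 : 0 <= b by rewrite mulr_ge0// addr_ge0// mulr_ge0.
have e10 : 0 < e / 3 / (b + 1) by rewrite divr_gt0// ltr_wpDl.
have e20 : 0 < e / 3 / (N%:R + 1) by rewrite divr_gt0// ltr_wpDl.
have up := total_cost_upper cen dl0 dl1 e10 e20.
apply: (le_trans (total_cost_lower cen dl0 dl1 sK)).
have SIfin := discretized_cost_fin c N dl.
set SI := (\int[dt]_(t in I) _%:E)%E in up SIfin *.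
(* Taking the constant terms out of the lower limits is legitimate because [SI] is finite. *)
have := le_limn_einf up; rewrite !limn_einf_shift// => h.
apply: (transfer _ _ _ _ _ h).
have h1 := small _ _ (ler0n R N) e30.
have h2 := small _ _ b0 e30.
set e1 := e / 3 / (b + 1) in h2 *; set e2 := e / 3 / (N%:R + 1) in h1 *.
rewrite (_ : _ + _ = N%:R * e2 + b * e1 + a * dl); last by rewrite /a /b; ring.
have -> : e = e / 3 + e / 3 + e / 3 by field.
by rewrite !lerD.
Qed.

End total_cost.

(** * Application to the particle systems *)

Lemma P1_particles {R : realType} {d N : nat} (x v : 'I_N -> R -> 'rV[R]_d) t :
  (0 < N)%N -> P1 (particles x v t).
Proof. by case: N x v => // N x v _; exact: P1_empirical. Qed.

(** Fatou's lemma asks for this measurability. It comes from continuity in time: the trajectories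
    are continuous and the cost is sequentially continuous in the positions. *)
Lemma measurable_particle_cost {R : realType} {d N : nat} (T : R)
    (L : 'rV[R]_(d + d) -> probability 'rV[R]_(d + d) R -> R)
    (x v : 'I_N -> R -> 'rV[R]_d) : (0 < N)%N -> 0 < T ->
  (forall z nu, P1 nu -> 0 <= L z nu) ->
  (forall nu, P1 nu -> continuous (L ^~ nu)) ->
  (forall (nus : nat -> probability 'rV[R]_(d + d) R) nu,
    (forall j, P1 (nus j)) -> P1 nu -> narrow_cvg nus nu ->
    forall K : set 'rV[R]_(d + d), compact K -> forall e : R, 0 < e ->
      \forall j \near \oo, forall z, K z -> `|L z (nus j) - L z nu| < e) ->
  (forall i, abs_continuous T (x i)) -> (forall i, abs_continuous T (v i)) ->
  measurable_fun (`[0, T]%classic : set (time R))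
    (fun t => \int[particles x v t]_z (L z (particles x v t))%:E)%E.
Proof.
case: N x v => [x v hN|N x v _]; first by discriminate hN.
move=> T0 L0 cL unifL acx acv.
pose z t i : 'rV[R]_(d + d) := row_mx (x i (clamp T t)) (v i (clamp T t)).
pose g t := N.+1%:R^-1 * \sum_i L (z t i) (empirical (z t)).
have cz i : continuous (z ^~ i).
  have cx := abs_continuous_clamp T0 (acx i); have cv := abs_continuous_clamp T0 (acv i).
  move=> t; apply/cvgrPdist_lt => e e0.
  have /cvgrPdist_lt/(_ _ e0) hx := cx t; have /cvgrPdist_lt/(_ _ e0) hv := cv t.
  apply: filterS2 hx hv => s hx hv.
  rewrite /z opp_row_mx add_row_mx [ltLHS]/Num.norm/= mx_normrE.
  apply/bigmax_ltP; split => // -[a b] _ /=.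
  have [k ->|k ->] := split_ordP b; rewrite ?row_mxEl ?row_mxEr.
    by apply: le_lt_trans hx; exact: le_entry_norm.
  by apply: le_lt_trans hv; exact: le_entry_norm.
have cg : continuous g.
  move=> t; apply/(@cvg_nbhsP _ R^o) => u ut.
  apply: (cvg_empirical_cost cL unifL) => i.
  exact: (cvg_comp _ _ ut (cz i t)).
have mg : measurable_fun (`[0, T]%classic : set (time R)) (EFin \o g).
  by apply/measurable_EFinP; exact: continuous_measurable_time.
apply: eq_measurable_fun mg => t /set_mem tT.
rewrite /particles ge0_empirical_integral; first by rewrite /= /g /z clamp_id.
- apply: continuous_measurable_mx; apply: cL; exact: P1_empirical.
- by move=> y; apply: L0; exact: P1_empirical.
Qed.

Theorem corollary4p5 (R : realType) (d : nat) (T : R)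
  (H : 'rV[R]_(d + d) -> 'rV[R]_d) (C : R)
  (L : 'rV[R]_(d + d) -> probability 'rV[R]_(d + d) R -> R)
  (psi : 'rV[R]_d -> R) (Cpsi q : R) (ell : R -> R)
  (x0 v0 : forall N, 'I_N -> 'rV[R]_d) (R0 : R)
  (mu0 : probability 'rV[R]_(d + d) R)
  (fN : nat -> R -> 'rV[R]_(d + d) -> 'rV[R]_d)
  (x v : forall N, 'I_N -> R -> 'rV[R]_d)
  (p : R) (Nk : nat -> nat)
  (f : R -> 'rV[R]_(d + d) -> 'rV[R]_d)
  (mu : R -> probability 'rV[R]_(d + d) R) :
  (0 < d)%N -> 0 < T ->
  locally_Lip H -> (forall z, enorm (H z) <= C * (1 + enorm z)) ->
  (forall z nu, P1 nu -> 0 <= L z nu) ->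
  (forall nu, P1 nu -> continuous (L ^~ nu)) ->
  (forall (nus : nat -> probability 'rV[R]_(d + d) R) nu,
    (forall j, P1 (nus j)) -> P1 nu -> narrow_cvg nus nu ->
    forall K : set 'rV[R]_(d + d), compact K -> forall e : R, 0 < e ->
      \forall j \near \oo, forall z, K z -> `|L z (nus j) - L z nu| < e) ->
  (forall y, 0 <= psi y) -> convex_function setT psi ->
  0 <= Cpsi -> 1 <= q ->
  (forall r : R, 0 < r ->
    (Lip Num.norm psi (eball 0 r) <= (Cpsi * r `^ (q - 1))%:E)%E) ->
  in_Lq q T ell ->
  0 < R0 ->
  (forall N (i : 'I_N), eball 0 R0 (row_mx (x0 N i) (v0 N i))) ->
  P1 mu0 -> compact (msupp mu0) ->
  W1 (empirical (fun i : 'I_N => row_mx (x0 N i) (v0 N i))) mu0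
    @[N --> \oo] --> 0%E ->
  (forall N, (0 < N)%N -> admissible T ell (fN N)) ->
  (forall N, (0 < N)%N ->
    particle_solution T H (fN N) (x0 N) (v0 N) (x N) (v N)) ->
  1 < p ->
  {homo Nk : j k / (j < k)%N} -> (forall k, (0 < Nk k)%N) ->
  admissible T ell f ->
  local_weak_cvg p q T (fN \o Nk) f ->
  weak_solution T H f mu ->
  (forall A, measurable A -> mu 0 A = mu0 A) ->
  (forall e : R, 0 < e -> \forall k \near \oo, forall t, t \in `[0, T] ->
    (W1 (particles (x (Nk k)) (v (Nk k)) t) (mu t) < e%:E)%E) ->
  (\int[dt]_(t in (`[0%R, T] : set (time R))) \int[mu t]_z
      (L z (mu t) + psi (f t z))%:E <=
   limn_einf (fun k => \int[dt]_(t in (`[0%R, T] : set (time R)))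
     \int[particles (x (Nk k)) (v (Nk k)) t]_z
       (L z (particles (x (Nk k)) (v (Nk k)) t)
         + psi (fN (Nk k) t z))%:E))%E.
Proof.
move=> d0 T0 HLip Hgr L0 cL unifL psi0 convex_psi Cpsi0 q1 Lip_psi ellq.
move=> R00 z0R P1mu0 cmu0 W1mu0 adfN part p1 homoNk Nk0 adf fsf [P1mu cmu [r r0 mur] _] _ W1N.
have muK t : t \in `[0, T] -> mu t (~` [set z | `|z| <= r]) = 0%E.
  by move=> tT; apply: msupp_full; exact: mur.
have P1s k t : P1 (particles (x (Nk k)) (v (Nk k)) t) by exact: P1_particles.
have ad k : admissible T ell (fN (Nk k)) by exact: adfN.
(* What remains is the measurability of the particle costs and the weak convergence in time of the
   controls at each fixed point. *)
apply: (total_cost_lsc T0 q1 ellq psi0 convex_psi Cpsi0 Lip_psi L0 cL unifL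
  P1s P1mu muK cmu W1N _ ad adf).
- move=> k; have sol := part _ (Nk0 k).
  by apply: measurable_particle_cost => // i; have [] := sol i.
- move=> z A j mA AI.
  exact: (@eval_weak_cvg R _ _ T q ell q1 ellq p (fN \o Nk)).
Qed.
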